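(* Let $s$ be a string over an alphabet $\Sigma$ of size $\sigma={\cal O}(1)$ whose last symbol is a unique end-of-string symbol. Then a context adaptive transformation (i.e. a choice of total orders $\pi_x$ of $\Sigma$ for all strings $x$) minimizing the number of runs in $BWT_{*}(s)$ can be found in ${\cal O}(|s|)$ time.
   Context: Given total orders $\pi_x$ of $\Sigma$ for every string $x$ over $\Sigma$, $M_{*}(s)$ is the matrix whose rows are the cyclic rotations of $s$ (all distinct), sorted so that for distinct rotations $u\neq v$ with longest common prefix $x$ and next symbols $a$ (in $u$) and $b$ (in $v$), $u$ precedes $v$ iff $a$ precedes $b$ in $\pi_x$; $BWT_{*}(s)$ is its last column read top to bottom. A unique end-of-string symbol is a symbol occurring in $s$ only at its last position. The number of runs of a string is the number of maximal blocks of consecutive equal symbols. Model: word RAM. *)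

(* Defs.v *)
From mathcomp Require Import all_boot.

Set Implicit Arguments.
Unset Strict Implicit.
Unset Printing Implicit Defensive.

(** * Context adaptive transformations of strings over {0, ..., sigma - 1} *)

Definition total_order (T : eqType) (r : rel T) : Prop :=
  [/\ total r, antisymmetric r & transitive r].

(* [pi x a b] reads "[a] is before or equal to [b] in the order [pi_x]". *)
Definition order_family (sigma : nat) : Type := seq 'I_sigma -> rel 'I_sigma.

Definition context_adaptive (sigma : nat) (pi : order_family sigma) : Prop :=
  forall x : seq 'I_sigma, total_order (pi x).

Fixpoint lcp (T : eqType) (u v : seq T) : seq T :=
  match u, v with
  | a :: u', b :: v' => if a == b then a :: lcp u' v' else [::]
  | _, _ => [::]
  end.

(* The rows compared below have equal lengths, so the last two cases of the
   [match] arise only for equal rows. *)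
Definition row_le (sigma : nat) (pi : order_family sigma)
    (u v : seq 'I_sigma) : bool :=
  let x := lcp u v in
  match drop (size x) u, drop (size x) v with
  | a :: _, b :: _ => pi x a b
  | [::], _ => true
  | _ :: _, [::] => false
  end.

Definition rotations (T : Type) (s : seq T) : seq (seq T) :=
  [seq rot i s | i <- iota 0 (size s)].

Definition bwt_matrix (sigma : nat) (pi : order_family sigma)
    (s : seq 'I_sigma) : seq (seq 'I_sigma) :=
  sort (row_le pi) (rotations s).

(* The default value [d] of [last] is never used: all rows are nonempty. *)
Definition bwt (sigma : nat) (pi : order_family sigma)
    (s : seq 'I_sigma) : seq 'I_sigma :=
  if s is d :: _ then [seq last d row | row <- bwt_matrix pi s] else [::].

(* Each maximal block is counted at its last position. *)
Fixpoint runs (T : eqType) (l : seq T) : nat :=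
  match l with
  | [::] => 0
  | a :: l' => (if l' is b :: _ then a != b else true) + runs l'
  end.

Definition ends_with_unique_symbol (T : eqType) (s : seq T) : Prop :=
  exists (t : seq T) (d : T), s = rcons t d /\ d \notin t.

Definition minimizes_runs (sigma : nat) (s : seq 'I_sigma)
    (pi : order_family sigma) : Prop :=
  context_adaptive pi /\
  forall pi' : order_family sigma, context_adaptive pi' ->
    runs (bwt pi s) <= runs (bwt pi' s).

(** * The word RAM with [w]-bit words *)

Inductive binop : Type :=
  | Add | Sub | Mul | Div | Mod | And | Or | Xor | Shl | Shr | IsEq | IsLt.

(* Registers are named by numbers fixed in the program text; the memory is
   addressed indirectly, by the contents of a register. *)
Inductive instr : Type :=
  | Const (r c : nat)
  | Bin (o : binop) (r r1 r2 : nat)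
  | Read (r raddr : nat)
  | Write (raddr r : nat)
  | Jump (l : nat)
  | JumpIfZero (r l : nat)
  | Halt.

Definition program : Type := seq instr.

Record config : Type := Config {
  pc : nat;
  reg : nat -> nat;
  mem : nat -> nat
}.

Definition update (f : nat -> nat) (i v : nat) : nat -> nat :=
  fun j => if j == i then v else f j.

Definition trunc (w m : nat) : nat := m %% 2 ^ w.

(* Arithmetic is modulo [2 ^ w]; division by zero returns 0, and the remainder
   by zero returns the dividend. *)
Definition eval_binop (w : nat) (o : binop) (m n : nat) : nat :=
  trunc w match o with
  | Add => m + n
  | Sub => m + (2 ^ w - n)
  | Mul => m * n
  | Div => m %/ n
  | Mod => m %% n
  | And => Nat.land m n
  | Or => Nat.lor m n
  | Xor => Nat.lxor m n
  | Shl => m * 2 ^ n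
  | Shr => m %/ 2 ^ n
  | IsEq => m == n
  | IsLt => m < n
  end.

(* Running past the end of the program halts. *)
Definition current (p : program) (c : config) : instr := nth Halt p (pc c).

Definition halted (p : program) (c : config) : bool :=
  if current p c is Halt then true else false.

Definition step (w : nat) (p : program) (c : config) : config :=
  let next := (pc c).+1 in
  match current p c with
  | Const r v => Config next (update (reg c) r (trunc w v)) (mem c)
  | Bin o r r1 r2 =>
      Config next (update (reg c) r (eval_binop w o (reg c r1) (reg c r2)))
             (mem c)
  | Read r raddr =>
      Config next (update (reg c) r (mem c (reg c raddr))) (mem c)
  | Write raddr r =>
      Config next (reg c) (update (mem c) (reg c raddr) (reg c r))
  | Jump l => Config l (reg c) (mem c)
  | JumpIfZero r l =>
      Config (if reg c r == 0 then l else next) (reg c) (mem c)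
  | Halt => c
  end.

(* Register 0 holds the length of [s], and cell [i] holds the [i]-th symbol
   of [s]; all other registers and cells are 0. *)
Definition init (sigma w : nat) (s : seq 'I_sigma) : config :=
  Config 0 (update (fun=> 0) 0 (trunc w (size s)))
         (fun i => trunc w (nth 0 [seq val a | a <- s] i)).

(** * Families of orders written in memory *)

(* A family is output as a table of [reg c 1] entries, stored from address
   [reg c 0] on.  An entry is a block of [sigma + 2] cells
     i, l, rank of 0, ..., rank of sigma - 1
   giving the order [pi_x], by increasing ranks, for the context
   [x = take l (rot i s)].  The first entry for [x] is the one that counts;
   the contexts with no entry get the natural order of the symbols. *)
Definition output_family (sigma : nat) (s : seq 'I_sigma) (c : config) :
    order_family sigma :=
  fun x a b =>
    let cell j i := mem c (reg c 0 + j * (sigma + 2) + i) in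
    let m := reg c 1 in
    let j := find (fun j => take (cell j 1) (rot (cell j 0) s) == x)
                  (iota 0 m) in
    if j < m then cell j (2 + a) <= cell j (2 + b) else a <= b.

Definition output_in_memory (sigma w : nat) (c : config) : bool :=
  reg c 0 + reg c 1 * (sigma + 2) <= 2 ^ w.

(* Main.v *)
Require Import Defs.
From mathcomp Require Import all_boot zify.

(** The rows that start with [u], for a node [u] of the suffix tree of [s],
    form a segment of the matrix, and the segment of [u] is the concatenation of
    the segments of its children in the order [pi_u]. The orders at different
    nodes are independent, so the least number of symbol changes inside the
    segment of [u] with prescribed first and last symbols is obtained from the
    children by trying all orders and all end symbols, a bounded number of
    choices for a bounded alphabet. A bottom-up pass computes these numbers and
    a top-down pass reads off an optimal order at each node.

    The suffix tree is built by inserting the suffixes from the shortest to the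
    longest (Weiner's algorithm, which is also the suffix automaton of the
    reversed string). Its nodes are the longest common prefixes of two suffixes,
    and inserting [c :: z] adds only [c :: z] and its longest prefix that occurs
    in [z]. The climb towards the root is paid for by the number of nodes that
    are prefixes of the current suffix. *)

Set Implicit Arguments.
Unset Strict Implicit.
Unset Printing Implicit Defensive.

(** * A structured language for the word RAM *)

(** Since [d] ends [s] and occurs nowhere else, a factor of [s] contains it at most at its end.
    Hence the rows behave like suffixes, each leaf has a single row, and two rows always part at a
    node, so that the transform is determined by the orders at the nodes. The recurrence needs a
    value for impossible end symbols; [n] serves as infinity, since a segment has fewer than [n]
    changes.

    The orders at a node are tried by code that is unrolled in the program text, whose size depends
    on [sigma] alone. A run therefore takes at most the size of the code times one plus the number
    of loop iterations, and only iterations have to be counted. A ghost counter in a small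
    structured language does this; the climbs of the tree construction are the only loops that need
    an amortized argument. An array is addressed by a kind, a parameter bounded in terms of [sigma],
    and a cell, so the memory layout depends on the input only through the common length of the
    arrays. *)

Inductive op : Type := OAdd | OSub | OMul | OEq | OLt.

Inductive expr : Type :=
  | Cst (c : nat)
  | Var (x : nat)
  | Op (o : op) (e1 e2 : expr)
  | Ld (k : nat) (ep ei : expr).

Inductive cmd : Type :=
  | Skip
  | Asg (x : nat) (e : expr)
  | Sto (k : nat) (ep ei e : expr)
  | Sq (c1 c2 : cmd)
  | Ite (e : expr) (c1 c2 : cmd)
  | Whl (e : expr) (c : cmd).

(* The counter [tk] is ghost state: it counts the iterations of all loops. *)
Record state : Type := State {
  va : nat -> nat;
  ar : nat -> nat -> nat -> nat;
  tk : nat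
}.

Definition op_fun (o : op) (m n : nat) : nat :=
  match o with
  | OAdd => m + n
  | OSub => m - n
  | OMul => m * n
  | OEq => m == n
  | OLt => m < n
  end.

Fixpoint eval (e : expr) (st : state) : nat :=
  match e with
  | Cst c => c
  | Var x => va st x
  | Op o e1 e2 => op_fun o (eval e1 st) (eval e2 st)
  | Ld k ep ei => ar st k (eval ep st) (eval ei st)
  end.

Definition setv (st : state) (x v : nat) : state :=
  State (update (va st) x v) (ar st) (tk st).

Definition upda (f : nat -> nat -> nat -> nat) (k p i v : nat) :=
  fun k' p' i' => if [&& k' == k, p' == p & i' == i] then v else f k' p' i'.

Definition seta (st : state) (k p i v : nat) : state :=
  State (va st) (upda (ar st) k p i v) (tk st).

Definition tick (st : state) : state := State (va st) (ar st) (tk st).+1.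

(* Register [nvar] holds the length of an array, and the registers from
   [nvar.+1] on hold intermediate values. *)
Notation nvar := 32 (only parsing).

Notation nkind := 16 (only parsing).

(** * Big-step semantics and weakest preconditions *)

Section Semantics.

(* Words are smaller than [B]; an array has a kind below [nkind], a parameter
   below [PP], and [KN] cells. *)
Variables B KN PP : nat.

(** Safe operations neither overflow nor go below zero, so that arithmetic on natural numbers agrees
    with arithmetic modulo the word size. *)
Definition op_safe (o : op) (m n : nat) : bool :=
  match o with
  | OAdd => m + n < B
  | OSub => n <= m
  | OMul => m * n < B
  | _ => true
  end.

Fixpoint safe (e : expr) (st : state) : bool :=
  match e with
  | Cst c => c < B
  | Var x => x < nvar
  | Op o e1 e2 =>
      [&& safe e1 st, safe e2 st & op_safe o (eval e1 st) (eval e2 st)]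
  | Ld k ep ei =>
      [&& safe ep st, safe ei st, k < nkind, eval ep st < PP
        & eval ei st < KN]
  end.

(** A derivation exists only for runs that terminate and stay safe, so [wp] expresses total
    correctness. *)
Inductive exec : cmd -> state -> state -> Prop :=
  | ESkip st : exec Skip st st
  | EAsg x e st : x < nvar -> safe e st ->
      exec (Asg x e) st (setv st x (eval e st))
  | ESto k ep ei e st :
      safe (Ld k ep ei) st -> safe e st ->
      exec (Sto k ep ei e) st
           (seta st k (eval ep st) (eval ei st) (eval e st))
  | ESq c1 c2 st1 st2 st3 :
      exec c1 st1 st2 -> exec c2 st2 st3 -> exec (Sq c1 c2) st1 st3
  | EIte e c1 c2 st st' :
      safe e st -> exec (if eval e st == 0 then c2 else c1) st st' ->
      exec (Ite e c1 c2) st st'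
  | EWhl0 e c st : safe e st -> eval e st = 0 -> exec (Whl e c) st st
  | EWhl1 e c st st1 st2 :
      safe e st -> eval e st != 0 -> exec c st st1 ->
      exec (Whl e c) (tick st1) st2 -> exec (Whl e c) st st2.

Definition wp (c : cmd) (Q : state -> Prop) (st : state) : Prop :=
  exists2 st', exec c st st' & Q st'.

Lemma wp_mono c (Q Q' : state -> Prop) st :
  (forall st', Q st' -> Q' st') -> wp c Q st -> wp c Q' st.
Proof. by move=> QQ' [st' ex /QQ' q]; exists st'. Qed.

Lemma wp_skip (Q : state -> Prop) st : Q st -> wp Skip Q st.
Proof. by move=> q; exists st => //; constructor. Qed.

Lemma wp_asg x e (Q : state -> Prop) st :
  (x < nvar) && safe e st -> Q (setv st x (eval e st)) -> wp (Asg x e) Q st.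
Proof. by move=> /andP[xP eP] q; eexists; first exact: EAsg. Qed.

Lemma wp_sto k ep ei e (Q : state -> Prop) st :
  safe (Ld k ep ei) st && safe e st ->
  Q (seta st k (eval ep st) (eval ei st) (eval e st)) ->
  wp (Sto k ep ei e) Q st.
Proof. by move=> /andP[xP eP] q; eexists; first exact: ESto. Qed.

Lemma wp_sq c1 c2 (Q : state -> Prop) st :
  wp c1 (wp c2 Q) st -> wp (Sq c1 c2) Q st.
Proof. by move=> [s1 ex1 [s2 ex2 q]]; exists s2 => //; apply: ESq ex1 ex2. Qed.

Lemma wp_ite e c1 c2 (Q : state -> Prop) st :
  safe e st ->
  (eval e st != 0 -> wp c1 Q st) -> (eval e st = 0 -> wp c2 Q st) ->
  wp (Ite e c1 c2) Q st.
Proof.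
move=> eP w1 w2.
have [e0|e1] := eqVneq (eval e st) 0.
  by have [s1 ex q] := w2 e0; exists s1 => //; apply: EIte => //; rewrite e0.
have [s1 ex q] := w1 e1; exists s1 => //.
by apply: EIte => //; rewrite (negPf e1).
Qed.

(** Induction on a bound for the variant [mu]. The tick comes between the body and the next test,
    which is why the invariant is asked of the ticked state. *)
Lemma wp_whl (I : state -> Prop) (mu : state -> nat) e c (Q : state -> Prop)
    st :
  I st ->
  (forall st, I st -> safe e st) ->
  (forall st, I st -> eval e st = 0 -> Q st) ->
  (forall st, I st -> eval e st != 0 ->
     wp c (fun st' => I (tick st') /\ mu (tick st') < mu st) st) ->
  wp (Whl e c) Q st.
Proof.
move=> I0 Is Iq Ic; have [m] := ubnP (mu st).
elim: m st I0 => // m IH st I0 lem.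
have [e0|e1] := eqVneq (eval e st) 0.
  by exists st; [apply: EWhl0 => //; apply: Is | apply: Iq].
have [s1 ex1 [I1 lt1]] := Ic _ I0 e1.
have [s2 ex2 q] : wp (Whl e c) Q (tick s1).
  by apply: IH => //; apply: leq_trans lt1 _.
by exists s2 => //; apply: EWhl1 ex1 ex2 => //; apply: Is.
Qed.

(** Unrolled in the program text: it adds to the size of the code and spends no tick. *)
Definition foreach (T : Type) (l : seq T) (f : T -> cmd) : cmd :=
  foldr (fun a c => Sq (f a) c) Skip l.

Lemma wp_foreach (T : eqType) (I : seq T -> state -> Prop) (l : seq T)
    (f : T -> cmd) (Q : state -> Prop) st :
  I [::] st ->
  (forall done a rest st, l = done ++ a :: rest -> a \in l -> I done st ->
     wp (f a) (I (rcons done a)) st) ->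
  (forall st, I l st -> Q st) ->
  wp (foreach l f) Q st.
Proof.
move=> I0 step IQ.
suff H l2 l1 st1 : l = l1 ++ l2 -> I l1 st1 -> wp (foreach l2 f) Q st1.
  exact: (H l [::]).
elim: l2 l1 st1 => [|a l2 IH] l1 st1 El I1.
  by apply: wp_skip; apply: IQ; rewrite El cats0.
have al : a \in l by rewrite El mem_cat inE eqxx orbT.
apply: wp_sq; apply: wp_mono (step _ _ _ _ El al I1) => st2 I2.
by apply: IH I2; rewrite cat_rcons.
Qed.

End Semantics.

(** * Compilation to the word RAM *)

Definition op_code (o : op) : binop :=
  match o with
  | OAdd => Add | OSub => Defs.Sub | OMul => Mul | OEq => IsEq | OLt => IsLt
  end.

(* Turns the parameter in register [d] and the index in register [d.+1] into
   the address of a cell. *)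
Definition address_code (k d : nat) : seq instr :=
  [:: Const d.+2 nkind; Bin Mul d d d.+2; Const d.+2 k; Bin Add d d d.+2;
      Bin Mul d d nvar; Bin Add d d d.+1].

(** The registers from [d] on act as a stack and [d] receives the value. The bitwise or of a
    register with itself is a move. *)
Fixpoint expr_code (e : expr) (d : nat) : seq instr :=
  match e with
  | Cst c => [:: Const d c]
  | Var x => [:: Bin Or d x x]
  | Op o e1 e2 =>
      expr_code e1 d ++ expr_code e2 d.+1 ++ [:: Bin (op_code o) d d d.+1]
  | Ld k ep ei =>
      expr_code ep d ++ expr_code ei d.+1 ++ address_code k d ++ [:: Read d d]
  end.

(** Jumps are absolute, so the code depends on the address [o] of its first instruction. *)
Fixpoint cmd_code (c : cmd) (o : nat) : seq instr :=
  match c with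
  | Skip => [::]
  | Asg x e => expr_code e nvar.+1 ++ [:: Bin Or x nvar.+1 nvar.+1]
  | Sto k ep ei e =>
      expr_code ep nvar.+1 ++ expr_code ei nvar.+2 ++ address_code k nvar.+1
      ++ expr_code e nvar.+2 ++ [:: Write nvar.+1 nvar.+2]
  | Sq c1 c2 =>
      let l1 := cmd_code c1 o in l1 ++ cmd_code c2 (o + size l1)
  | Ite e c1 c2 =>
      let l0 := expr_code e nvar.+1 in
      let l1 := cmd_code c1 (o + size l0).+1 in
      let o2 := ((o + size l0).+1 + size l1).+1 in
      let l2 := cmd_code c2 o2 in
      l0 ++ JumpIfZero nvar.+1 o2 :: l1 ++ Jump (o2 + size l2) :: l2
  | Whl e c =>
      let l0 := expr_code e nvar.+1 in
      let l1 := cmd_code c (o + size l0).+1 in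
      l0 ++ JumpIfZero nvar.+1 ((o + size l0).+1 + size l1).+1 :: l1
      ++ [:: Jump o]
  end.

Definition straight (i : instr) : bool :=
  match i with
  | Const _ _ | Bin _ _ _ _ | Read _ _ | Write _ _ => true
  | _ => false
  end.

Section Compilation.

Variables (w KN PP : nat) (p : program).

Hypothesis KN_gt0 : 0 < KN.
Hypothesis PP_gt0 : 0 < PP.
Hypothesis memP : KN * (nkind * PP) <= 2 ^ w.
Hypothesis nkindP : nkind < 2 ^ w.

Definition code_at (o : nat) (l : seq instr) : Prop :=
  forall i, i < size l -> nth Halt p (o + i) = nth Halt l i.

Lemma code_at_cat o l1 l2 :
  code_at o (l1 ++ l2) -> code_at o l1 /\ code_at (o + size l1) l2.
Proof.
move=> H; split=> i ilt.
  by rewrite H ?nth_cat ?ilt // size_cat ltn_addr.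
rewrite -addnA H ?size_cat ?ltn_add2l // nth_cat.
by rewrite ltnNge leq_addr /= addKn.
Qed.

Lemma code_at_cons o i l :
  code_at o (i :: l) -> nth Halt p o = i /\ code_at o.+1 l.
Proof.
move=> H; split; first by have := H 0 isT; rewrite addn0.
by move=> j jlt; have := H j.+1 jlt; rewrite addnS addSn.
Qed.

Definition exec1 (i : instr) (c : (nat -> nat) * (nat -> nat)) :=
  match i with
  | Const r v => (update c.1 r (trunc w v), c.2)
  | Bin o r r1 r2 => (update c.1 r (eval_binop w o (c.1 r1) (c.1 r2)), c.2)
  | Read r a => (update c.1 r (c.2 (c.1 a)), c.2)
  | Write a r => (c.1, update c.2 (c.1 a) (c.1 r))
  | _ => c
  end.

Definition execs (l : seq instr) c := foldl (fun c i => exec1 i c) c l.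

Lemma iter_straight l o c :
  all straight l -> code_at o l ->
  iter (size l) (step w p) (Config o c.1 c.2) =
  Config (o + size l) (execs l c).1 (execs l c).2.
Proof.
elim: l o c => [|i l IH] o c; first by rewrite /= addn0.
move=> /andP[Hi Hl] /code_at_cons[Ei Hc].
rewrite [size _]/= iterSr {2}/step /current /= Ei addnS -addSn.
by case: i Hi Ei => //= *; rewrite -IH.
Qed.

Lemma straight_expr e d : all straight (expr_code e d).
Proof.
elim: e d => //= [o e1 IH1 e2 IH2|k ep IHp ei IHi] d;
  by rewrite !all_cat ?IH1 ?IH2 ?IHp ?IHi.
Qed.

Lemma trunc_small m : m < 2 ^ w -> trunc w m = m.
Proof. exact: modn_small. Qed.

Lemma exp2_gt0 : 0 < 2 ^ w. Proof. by rewrite expn_gt0. Qed.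

Definition words (c : (nat -> nat) * (nat -> nat)) : Prop :=
  (forall r, c.1 r < 2 ^ w) /\ (forall a, c.2 a < 2 ^ w).

Lemma words_exec1 i c : words c -> words (exec1 i c).
Proof.
move=> [H1 H2]; have t m : trunc w m < 2 ^ w by rewrite ltn_mod exp2_gt0.
by case: i => [r v|o r r1 r2|r a|a r|l|r l|] //=; split=> //= x;
  rewrite /update; case: eqP => // _; apply: t.
Qed.

Lemma words_execs l c : words c -> words (execs l c).
Proof. by elim: l c => //= i l IH c H; apply: IH; apply: words_exec1. Qed.

(** Blocks of [KN] cells, with the kind as the low digit of the block number. Kind 0 with parameter
    0 starts at address 0, where the input lies. *)
Definition addr (k q i : nat) : nat := KN * (k + nkind * q) + i.

Lemma addr_lt k q i : k < nkind -> q < PP -> i < KN -> addr k q i < 2 ^ w.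
Proof. rewrite /addr; nia. Qed.

Lemma addr_inj k q i k' q' i' :
  k < nkind -> k' < nkind -> i < KN -> i' < KN ->
  addr k q i = addr k' q' i' -> [/\ k = k', q = q' & i = i'].
Proof.
move=> kl kl' il il' E.
have Ei : i = i'.
  have := congr1 (modn^~ KN) E.
  by rewrite /addr /= !(mulnC KN) !modnMDl !modn_small.
have Ek : k + nkind * q = k' + nkind * q'.
  by move/eqP: E; rewrite /addr Ei eqn_add2r eqn_pmul2l // => /eqP.
split=> //; lia.
Qed.

Definition agree (st : state) (c : (nat -> nat) * (nat -> nat)) : Prop :=
  [/\ words c, forall x, x < nvar -> c.1 x = va st x, c.1 nvar = KN
    & forall k q i, k < nkind -> q < PP -> i < KN ->
        c.2 (addr k q i) = ar st k q i].

Definition scratch (d : nat) (c c' : (nat -> nat) * (nat -> nat)) : Prop :=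
  c'.2 = c.2 /\ forall r, r < d -> c'.1 r = c.1 r.

Lemma agree_scratch st d c c' :
  nvar < d -> words c' -> scratch d c c' -> agree st c -> agree st c'.
Proof.
move=> dgt wc' [E2 E1] [wc R1 R2 R3]; split=> //.
- by move=> x xl; rewrite E1 ?R1 //; lia.
- by rewrite E1.
- by move=> *; rewrite E2 R3.
Qed.

Lemma scratch_trans d d' c1 c2 c3 :
  d <= d' -> scratch d c1 c2 -> scratch d' c2 c3 -> scratch d c1 c3.
Proof.
move=> dd [E2 E1] [E2' E1']; split; first by rewrite E2'.
by move=> r rl; rewrite E1' ?E1 //; lia.
Qed.

Lemma execs_cat l1 l2 c : execs (l1 ++ l2) c = execs l2 (execs l1 c).
Proof. exact: foldl_cat. Qed.

Lemma nkind_lt k q : k < nkind -> q < PP -> k + nkind * q < nkind * PP.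
Proof. lia. Qed.

Lemma address_codeP st k d c q i :
  nvar < d -> agree st c -> c.1 d = q -> c.1 d.+1 = i ->
  k < nkind -> q < PP -> i < KN ->
  let c' := execs (address_code k d) c in
  scratch d c c' /\ c'.1 d = addr k q i.
Proof.
move=> dgt [wc R1 R2 R3] Eq Ei kl ql il.
have := nkind_lt kl ql => kq.
have lt0 : KN * (k + nkind * q) + i < 2 ^ w by apply: addr_lt.
have lt1 : nkind * PP <= 2 ^ w by apply: leq_trans memP; rewrite leq_pmull.
have Ed : (nvar == d) = false by apply/eqP; lia.
have Ed2 : (nvar == d.+2) = false by apply/eqP; lia.
have d1 : (d == d.+2) = false by apply/eqP; lia.
have d2 : (d.+1 == d) = false by apply/eqP; lia.
have d3 : (d.+1 == d.+2) = false by apply/eqP; lia.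
rewrite /= /update /eval_binop /= !eqxx ?Ed ?Ed2 ?d1 ?d2 ?d3 Eq Ei R2.
rewrite ?(trunc_small (m := nkind)) //.
rewrite ?(trunc_small (m := k)); last by lia.
rewrite (trunc_small (m := q * nkind)); last by lia.
rewrite (trunc_small (m := q * nkind + k)); last by lia.
rewrite (trunc_small (m := (q * nkind + k) * KN)); last by lia.
rewrite trunc_small; last by lia.
split; last by rewrite /addr; lia.
split=> //= r rl; have -> : (r == d) = false by apply/eqP; lia.
by have -> : (r == d.+2) = false by apply/eqP; lia.
Qed.

Lemma op_codeP o m n :
  m < 2 ^ w -> n < 2 ^ w -> op_safe (2 ^ w) o m n ->
  eval_binop w (op_code o) m n = op_fun o m n.
Proof.
have w1 : 1 <= 2 ^ w := exp2_gt0.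
have bool_small (b : bool) : 1 < 2 ^ w -> trunc w b = b.
  by move=> ?; apply: trunc_small; case: b; lia.
move=> ml nl; case: o => /=; rewrite /eval_binop /=.
- exact: trunc_small.
(* The machine adds [2 ^ w - n]; as [n <= m], the reduction removes exactly the added power. *)
- move=> nm; rewrite addnBA; last by lia.
  rewrite addnC -addnBA // /trunc modnDl modn_small //; lia.
- exact: trunc_small.
- move=> _; apply: bool_small.
  apply: leq_trans memP; nia.
- move=> _; apply: bool_small.
  apply: leq_trans memP; nia.
Qed.

Lemma scratchW d d' c c' : d <= d' -> scratch d' c c' -> scratch d c c'.
Proof. by move=> dd [E2 E1]; split=> // r rl; apply: E1; lia. Qed.

Lemma scratch_exec1 d i c :
  match i with
  | Const r _ | Bin _ r _ _ | Read r _ => r == d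
  | _ => false
  end -> scratch d c (exec1 i c).
Proof.
case: i => //= [r v|o r r1 r2|r a] /eqP->; split=> //= r' lt;
  by rewrite /update; have -> : (r' == d) = false by lia.
Qed.

Lemma expr_codeP e st d c :
  nvar < d -> agree st c -> safe (2 ^ w) KN PP e st ->
  let c' := execs (expr_code e d) c in
  [/\ scratch d c c', c'.1 d = eval e st & words c'].
Proof.
elim: e d c => [v|x|o e1 IH1 e2 IH2|k ep IHp ei IHi] d c dgt A;
  have [wc R1 R2 R3] := A.
- move=> /= vl; split; last exact: (words_exec1 (Const d v) wc).
    exact: (@scratch_exec1 _ (Const d v)).
  by rewrite /= /update eqxx trunc_small.
- move=> /= xl; split; last exact: (words_exec1 (Bin Or d x x) wc).
    exact: (@scratch_exec1 _ (Bin Or d x x)).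
  rewrite /= /update eqxx /eval_binop PeanoNat.Nat.lor_diag.
  by rewrite trunc_small ?R1 // -R1 //; apply: (proj1 wc).
- move=> /= /and3P[s1 s2 so]; rewrite !execs_cat.
  have [sc1 E1 w1] := IH1 d c dgt A s1.
  set c1 := execs _ c in sc1 E1 w1 *.
  have A1 : agree st c1 by apply: agree_scratch sc1 A.
  have [sc2 E2 w2] := IH2 d.+1 c1 (leqW dgt) A1 s2.
  set c2 := execs _ c1 in sc2 E2 w2 *.
  split; last exact: words_execs.
    apply: (scratch_trans (leqnn d) sc1).
    apply: (scratch_trans (leqnn d) (scratchW (leqnSn d) sc2)).
    exact: (@scratch_exec1 _ (Bin _ d _ _)).
  rewrite /= /update eqxx E2.
  have -> : c2.1 d = eval e1 st by rewrite (proj2 sc2).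
  by apply: op_codeP => //; [rewrite -E1; apply: (proj1 w1) |
    rewrite -E2; apply: (proj1 w2)].
- rewrite [safe _ _ _ _ _]/= => /and5P[s1 s2 kl ql il].
  rewrite -[expr_code _ _]/(expr_code ep d ++ expr_code ei d.+1
    ++ address_code k d ++ [:: Read d d]) 3!execs_cat.
  have [sc1 E1 w1] := IHp d c dgt A s1.
  set c1 := execs _ c in sc1 E1 w1 *.
  have A1 : agree st c1 by apply: agree_scratch sc1 A.
  have [sc2 E2 w2] := IHi d.+1 c1 (leqW dgt) A1 s2.
  set c2 := execs _ c1 in sc2 E2 w2 *.
  have A2 : agree st c2 :=  (agree_scratch (leqW dgt) w2 sc2 A1).
  have E2d : c2.1 d = eval ep st by rewrite (proj2 sc2).
  have [sc3 E3] := address_codeP dgt A2 E2d E2 kl ql il.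
  have w3 := words_execs (address_code k d) w2.
  set c3 := execs _ c2 in sc3 E3 w3 *; clearbody c3.
  split; last exact: words_execs.
    apply: (scratch_trans (leqnn d) sc1).
    apply: (scratch_trans (leqnn d) (scratchW (leqnSn d) sc2)).
    apply: (scratch_trans (leqnn d) sc3).
    exact: (@scratch_exec1 _ (Read d d)).
  rewrite /= /update eqxx E3 (proj1 sc3).
  by case: A2 => _ _ _ ->.
Qed.

Definition pair_of (c : config) := (reg c, Defs.mem c).

Definition reaches (t : nat) (c : config) (o : nat) (st : state) : Prop :=
  let c' := iter t (step w p) c in pc c' = o /\ agree st (pair_of c').

Lemma run_expr e st c :
  code_at (pc c) (expr_code e nvar.+1) -> agree st (pair_of c) ->
  safe (2 ^ w) KN PP e st ->
  let c' := iter (size (expr_code e nvar.+1)) (step w p) c in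
  [/\ pc c' = pc c + size (expr_code e nvar.+1), agree st (pair_of c')
    & reg c' nvar.+1 = eval e st].
Proof.
case: c => o rg mm /= Hc A es.
have [sc E ws] := expr_codeP (leqnn nvar.+1) A es.
rewrite (iter_straight (rg, mm) (straight_expr _ _) Hc).
case: (execs _ _) sc E ws => rg' mm' /= sc E ws; split=> //.
exact: (agree_scratch (leqnn nvar.+1) ws sc A).
Qed.

Lemma agree_setv st c x v :
  x < nvar -> v < 2 ^ w -> agree st c ->
  agree (setv st x v) (update c.1 x v, c.2).
Proof.
move=> xl vl [[w1 w2] R1 R2 R3]; split=> //=.
- by split=> //= r; rewrite /update; case: eqP.
- by move=> y yl; rewrite /update R1.
- by rewrite /update; have -> : (nvar == x) = false by lia.
Qed.

Lemma agree_seta st c k q i v :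
  k < nkind -> q < PP -> i < KN -> v < 2 ^ w -> agree st c ->
  agree (seta st k q i v) (c.1, update c.2 (addr k q i) v).
Proof.
move=> kl ql il vl [[w1 w2] R1 R2 R3]; split=> //=.
  by split=> //= a; rewrite /update; case: eqP.
move=> k' q' i' kl' ql' il'; rewrite /update /upda R3 //.
case: eqP => [/addr_inj[]// -> -> ->|ne]; first by rewrite !eqxx.
by case: and3P => // -[/eqP Ek /eqP Eq /eqP Ei]; case: ne; rewrite Ek Eq Ei.
Qed.

Lemma exec_tk c st st' : exec (2 ^ w) KN PP c st st' -> tk st <= tk st'.
Proof. by elim=> //= *; lia. Qed.

(** The only backward jump closes a loop iteration, and every iteration is ticked. Between two ticks
    each instruction is thus executed at most once, which gives the size of the code times one plus
    the number of ticks. *)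
Lemma cmd_codeP c st st' :
  exec (2 ^ w) KN PP c st st' ->
  forall o cf, code_at o (cmd_code c o) -> pc cf = o -> agree st (pair_of cf) ->
  exists2 t, t <= size (cmd_code c o) * (tk st' - tk st).+1 &
    reaches t cf (o + size (cmd_code c o)) st'.
Proof.
elim=> {c st st'}
  [st|x e st xl es|k ep ei e st ls es|c1 c2 st1 st2 st3 ex1 IH1 ex2 IH2
  |e c1 c2 st st' es ex IH|e c st es e0|e c st st1 st2 es e1 ex1 IH1 ex2 IH2]
  o cf Hc Epc A.
- by exists 0; rewrite // /reaches /= addn0.
- case: cf Epc A => _ rg mm /= -> A.
  exists (size (cmd_code (Asg x e) o)); first by rewrite subnn muln1.
  rewrite /reaches (iter_straight (rg, mm) _ Hc); last first.
    by rewrite all_cat straight_expr.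
  split=> //; rewrite /pair_of /= execs_cat.
  have [sc E ws] := expr_codeP (leqnn nvar.+1) A es.
  set c1 := execs _ _ in sc E ws *.
  rewrite /= /eval_binop PeanoNat.Nat.lor_diag trunc_small ?E; last first.
    by rewrite -E; apply: (proj1 ws).
  apply: agree_setv => //; first by rewrite -E; apply: (proj1 ws).
  exact: agree_scratch sc A.
- case: cf Epc A => _ rg mm /= -> A.
  exists (size (cmd_code (Sto k ep ei e) o)); first by rewrite subnn muln1.
  rewrite /reaches (iter_straight (rg, mm) _ Hc); last first.
    by rewrite !all_cat !straight_expr.
  split=> //; rewrite /pair_of -[cmd_code _ _]/(expr_code ep nvar.+1
    ++ expr_code ei nvar.+2 ++ address_code k nvar.+1
    ++ expr_code e nvar.+2 ++ [:: Write nvar.+1 nvar.+2]) 4!execs_cat.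
  move: ls => /and5P[s1 s2 kl ql il].
  have [sc1 E1 w1] := expr_codeP (leqnn nvar.+1) A s1.
  set c1 := execs _ (rg, mm) in sc1 E1 w1 *.
  have A1 : agree st c1 by apply: agree_scratch sc1 A.
  have [sc2 E2 w2] := expr_codeP (leqnSn nvar.+1) A1 s2.
  set c2 := execs _ c1 in sc2 E2 w2 *.
  have A2 : agree st c2 :=  (agree_scratch (leqnSn nvar.+1) w2 sc2 A1).
  have E2d : c2.1 nvar.+1 = eval ep st by rewrite (proj2 sc2).
  have [sc3 E3] := address_codeP (leqnn nvar.+1) A2 E2d E2 kl ql il.
  have w3 := words_execs (address_code k nvar.+1) w2.
  set c3 := execs _ c2 in sc3 E3 w3 *; clearbody c3.
  have A3 : agree st c3 by apply: agree_scratch sc3 A2.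
  have [sc4 E4 w4] := expr_codeP (leqnSn nvar.+1) A3 es.
  set c4 := execs _ c3 in sc4 E4 w4 *; clearbody c4.
  have A4 : agree st c4 :=  (agree_scratch (leqnSn nvar.+1) w4 sc4 A3).
  rewrite /= E4 (proj2 sc4) // E3.
  by apply: agree_seta => //; rewrite -E4; apply: (proj1 w4).
- move: Hc; rewrite /= => /code_at_cat[H1 H2].
  have [t1 le1 [pc1 A1]] := IH1 o cf H1 Epc A.
  have [t2 le2 [pc2 A2]] := IH2 _ _ H2 pc1 A1.
  have := exec_tk ex1; have := exec_tk ex2 => k2 k1.
  exists (t2 + t1); last by rewrite /reaches iterD size_cat addnA.
  rewrite size_cat; apply: leq_trans (leq_add le2 le1) _.
  rewrite mulnDl addnC leq_add // leq_mul //; lia.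
- move: Hc => /=; set l0 := expr_code _ _; set l1 := cmd_code c1 _.
  set o2 := ((o + size l0).+1 + size l1).+1; set l2 := cmd_code c2 _ => Hc.
  have [H0 /code_at_cons[Ej H12]] := code_at_cat Hc.
  have [H1 /code_at_cons[Ej' H2]] := code_at_cat H12.
  rewrite -Epc in H0; have [pc0 A0 E0] := run_expr H0 A es.
  set cf0 := iter _ _ _ in pc0 A0 E0; rewrite Epc -/l0 in pc0.
  have Es : iter (size l0).+1 (step w p) cf = step w p cf0 by [].
  have Est : step w p cf0 =
      Config (if eval e st == 0 then o2 else (o + size l0).+1)
             (reg cf0) (Defs.mem cf0).
    by rewrite /step /current pc0 Ej E0.
  have szE : size (l0 ++ JumpIfZero nvar.+1 o2 :: l1
      ++ Jump (o2 + size l2) :: l2) = size l0 + (size l1 + (size l2).+2).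
    by rewrite !size_cat /= size_cat /= addnS !addnS.
  rewrite szE; case: eqP ex IH Est => _ ex IH Est.
  + have [t le [pc1 A1]] := IH o2 (Config o2 (reg cf0) (Defs.mem cf0)) H2 erefl
      A0.
    exists (t + (size l0).+1).
      rewrite -/l2 in le; apply: leq_trans (leq_add le (leqnn _)) _; nia.
    rewrite /reaches iterD Es Est; split=> //.
    by rewrite pc1 -/l2 /o2; lia.
  + have [t le [pc1 A1]] :=
      IH _ (Config (o + size l0).+1 (reg cf0) (Defs.mem cf0)) H1 erefl A0.
    exists (t.+1 + (size l0).+1).
      rewrite -/l1 in le; apply: leq_trans (leq_add (le : t.+1 <= _.+1) (leqnn
        _)) _.
      nia.
    rewrite /reaches iterD Es Est iterS.
    set cf1 := iter t _ _ in pc1 A1 *.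
    rewrite /step /current pc1 -/l1 Ej' /=; split=> //=.
    by rewrite /o2; lia.
- move: Hc => /=; set l0 := expr_code _ _; set l1 := cmd_code c _ => Hc.
  have [H0 /code_at_cons[Ej H12]] := code_at_cat Hc.
  rewrite -Epc in H0; have [pc0 A0 E0] := run_expr H0 A es.
  set cf0 := iter _ _ _ in pc0 A0 E0; rewrite Epc -/l0 in pc0.
  have Es : iter (size l0).+1 (step w p) cf = step w p cf0 by [].
  exists (size l0).+1; first by rewrite subnn muln1 size_cat /=; lia.
  rewrite /reaches Es /step /current pc0 Ej E0 e0 /=; split=> //=.
  by rewrite size_cat /= size_cat /=; lia.
- move: (Hc) => /=; set l0 := expr_code _ _; set l1 := cmd_code c _ => Hc'.
  have [H0 /code_at_cons[Ej H12]] := code_at_cat Hc'.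
  have [H1 /code_at_cons[Ej' _]] := code_at_cat H12.
  rewrite -Epc in H0; have [pc0 A0 E0] := run_expr H0 A es.
  set cf0 := iter _ _ _ in pc0 A0 E0; rewrite Epc -/l0 in pc0.
  have Es : iter (size l0).+1 (step w p) cf = step w p cf0 by [].
  have [t1 le1 [pc1 A1]] :=
    IH1 _ (Config (o + size l0).+1 (reg cf0) (Defs.mem cf0)) H1 erefl A0.
  set cf1 := iter t1 _ _ in pc1 A1; rewrite -/l1 in le1 pc1.
  have [t2 le2 [pc2 A2]] :=
    IH2 o (Config o (reg cf1) (Defs.mem cf1)) Hc erefl A1.
  exists (t2 + (t1.+1 + (size l0).+1)); last first.
    rewrite /reaches iterD [iter (_ + _.+1) _ _]iterD Es.
    have -> : step w p cf0 = Config (o + size l0).+1 (reg cf0) (Defs.mem cf0).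
      by rewrite /step /current pc0 Ej E0 (negPf e1).
    rewrite iterS -/cf1.
    by have -> : step w p cf1 = Config o (reg cf1) (Defs.mem cf1)
      by rewrite /step /current pc1 Ej'.
  have := exec_tk ex1; have /= := exec_tk ex2 => k2 k1.
  move: le2; rewrite /= -/l0 -/l1; set sz := size _ => le2.
  have szE : sz = size l0 + (size l1).+2.
    by rewrite /sz size_cat /= size_cat /= addn1.
  apply: leq_trans (leq_add le2 (leqnn _)) _.
  (* The first summand pays for the rest of the loop, the second for this iteration: its test, its
     body and the jump back. *)
  have -> : (tk st2 - tk st).+1 = (tk st2 - (tk st1).+1).+1 + (tk st1 - tk
    st).+1.
    by lia.
  rewrite mulnDr leq_add2l szE; nia.
Qed.

End Compilation.

(** * Longest common prefixes and suffix tree nodes *)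

Section Lcp.

Variable T : eqType.
Implicit Types (u v x y z : seq T) (c e : T).

Lemma lcpC u v : lcp u v = lcp v u.
Proof.
elim: u v => [|a u IH] [|b v] //=; rewrite eq_sym.
by case: eqP => // ->; rewrite IH.
Qed.

Lemma lcpp u : lcp u u = u.
Proof. by elim: u => //= a u ->; rewrite eqxx. Qed.

Lemma lcp_prefixl u v : prefix (lcp u v) u.
Proof. by elim: u v => [|a u IH] [|b v] //=; case: eqP;
  rewrite //= eqxx IH. Qed.

Lemma lcp_prefixr u v : prefix (lcp u v) v.
Proof. by rewrite lcpC lcp_prefixl. Qed.

Lemma prefix_lcp x u v : prefix x (lcp u v) = prefix x u && prefix x v.
Proof.
apply/idP/andP => [xP|[]]; last first.
  move: x u v; elim=> [|a x IH] [|b u] [|c v] //=; first by case: ifP.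
  case/andP=> /eqP<- xu /andP[/eqP<- xv].
  by rewrite eqxx /= eqxx IH.
by split; apply: prefix_trans xP _; rewrite ?lcp_prefixl ?lcp_prefixr.
Qed.

Lemma prefix_comparable u v z :
  prefix u z -> prefix v z -> size u <= size v -> prefix u v.
Proof.
rewrite !prefixE => /eqP Eu /eqP Ev le; apply/eqP.
by rewrite -{1}Ev take_takel.
Qed.

Lemma prefix_eq_size u v : prefix u v -> size v <= size u -> u = v.
Proof. by rewrite prefixE => /eqP Eu le; rewrite -Eu take_oversize. Qed.

Lemma prefix_anti u v : prefix u v -> prefix v u -> u = v.
Proof. by move=> uv /size_prefix; apply: prefix_eq_size. Qed.

Lemma prefix_size_lt u v : prefix u v -> u != v -> size u < size v.
Proof.
move=> uv; apply: contraR; rewrite -leqNgt => le.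
by apply/eqP; apply: prefix_eq_size.
Qed.

(** Both [lcp u v] and [lcp u x] are prefixes of [u], hence comparable, and the shorter one is the
    common prefix of the three words. *)
Lemma lcp_or u v x : lcp (lcp u v) x = lcp u v \/ lcp (lcp u v) x = lcp u x.
Proof.
have [le|le] := leqP (size (lcp u v)) (size (lcp u x)); [left|right].
  apply: prefix_anti; first exact: lcp_prefixl.
  rewrite prefix_lcp prefix_refl /=.
  apply: prefix_trans (lcp_prefixr u x).
  exact: prefix_comparable (lcp_prefixl _ _) (lcp_prefixl _ _) le.
apply: prefix_anti; rewrite !prefix_lcp ?lcp_prefixr ?lcp_prefixl /= ?andbT.
  exact: prefix_trans (lcp_prefixl _ _) (lcp_prefixl _ _).
apply: prefix_trans (lcp_prefixr u v).
exact: prefix_comparable (lcp_prefixl _ _) (lcp_prefixl _ _) (ltnW le).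
Qed.

(* The nodes of the suffix tree of [z]: the root, the branching words, and the
   suffixes of [z]. *)
Definition expl z u : bool :=
  u \in [seq lcp (drop j z) (drop k z) | j <- iota 0 (size z).+1,
                                        k <- iota 0 (size z).+1].

Lemma explP z u :
  reflect (exists j k, u = lcp (drop j z) (drop k z)) (expl z u).
Proof.
apply: (iffP allpairsP) => [[[j k] /= [_ _ ->]]|[j [k ->]]].
  by exists j, k.
(* Every position past the end stands for the empty suffix, so the bounded enumeration in [expl]
   misses nothing. *)
have dropE i : drop i z = drop (minn i (size z)) z.
  have [//|lt] := leqP i (size z).
  by rewrite drop_size drop_oversize // ltnW.
have minI i : minn i (size z) \in iota 0 (size z).+1.
  by rewrite mem_iota add0n ltnS geq_minr.
by exists (minn j (size z), minn k (size z)); rewrite /= -!dropE.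
Qed.

Lemma expl_drop z j : expl z (drop j z).
Proof. by apply/explP; exists j, j; rewrite lcpp. Qed.

Lemma expl_nil z : expl z [::].
Proof. by rewrite -(drop_size z) expl_drop. Qed.

Lemma expl_refl z : expl z z.
Proof. by rewrite -{2}(drop0 z) expl_drop. Qed.

(** By [lcp_or], the longest common prefix of four suffixes is already that of two of them. *)
Lemma expl_lcp z u v : expl z u -> expl z v -> expl z (lcp u v).
Proof.
move=> /explP[a [b Eu]] /explP[c [d Ev]]; rewrite {1}Eu.
have [->|->] := lcp_or (drop a z) (drop b z) v.
  by rewrite -Eu; apply/explP; exists a, b.
rewrite lcpC Ev; have [->|->] := lcp_or (drop c z) (drop d z) (drop a z).
  by apply/explP; exists c, d.
by apply/explP; exists c, a.
Qed.

Lemma expl_prefix_drop z u : expl z u -> exists j, prefix u (drop j z).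
Proof. by move=> /explP[j [k ->]]; exists j; apply: lcp_prefixl. Qed.

Lemma expl_size z u : expl z u -> size u <= size z.
Proof.
by move=> /expl_prefix_drop[j /size_prefix le]; rewrite size_drop in le; lia.
Qed.

(** Shifting the two suffixes by one position removes the common first symbol: suffix links lead
    from nodes to nodes. *)
Lemma expl_cons_behead z c u : expl z (c :: u) -> expl z u.
Proof.
move=> /explP[j [k]]; move Ex: (drop j z) => [|a x] /=; first by move=> E0;
  discriminate E0.
move Ey: (drop k z) => [|b y] /=; first by move=> E0; discriminate E0.
case: (a =P b) => // _ [_ ->].
apply/explP; exists j.+1, k.+1.
by rewrite -[j.+1]add1n -[k.+1]add1n -!drop_drop Ex Ey /= !drop0.
Qed.

(* The head of the suffix [c :: z], in Weiner's terminology. *)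
Definition is_head c z h : Prop :=
  [/\ exists j, prefix h (drop j z), prefix h (c :: z)
    & forall k, size (lcp (c :: z) (drop k z)) <= size h].

Lemma head_max c z h v :
  is_head c z h -> prefix v (c :: z) -> (exists j, prefix v (drop j z)) ->
  prefix v h.
Proof.
move=> [_ hz hmax] vz [j vj]; apply: (prefix_comparable vz hz).
apply: leq_trans (hmax j); apply: size_prefix.
by rewrite prefix_lcp vz vj.
Qed.

Lemma head_lcp c z h :
  is_head c z h -> exists j, h = lcp (c :: z) (drop j z).
Proof.
move=> [[j hj] hz hmax]; exists j; apply: prefix_eq_size => //.
by rewrite prefix_lcp hj hz.
Qed.

Lemma head_size c z h : is_head c z h -> size h <= size z.
Proof. by case=> -[j /size_prefix]; rewrite size_drop; lia. Qed.

(** A common prefix of [c :: z] with a suffix of [z] is no longer than the head. If it is shorter, a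
    suffix of [z] that starts with the head can replace [c :: z] in its computation, so it was a
    node before. *)
Lemma expl_cons c z h u : is_head c z h ->
  expl (c :: z) u <-> [\/ expl z u, u = c :: z | u = h].
Proof.
move=> hP; have [jh Eh] := head_lcp hP.
have dS j : drop j.+1 (c :: z) = drop j z by [].
split; last first.
  case=> [/explP[j [k ->]]|->|->]; last 2 first.
  - exact: expl_refl.
  - by rewrite Eh; apply/explP; exists 0, jh.+1.
  - by apply/explP; exists j.+1, k.+1.
suff H k : [\/ expl z (lcp (c :: z) (drop k z)),
    lcp (c :: z) (drop k z) = c :: z | lcp (c :: z) (drop k z) = h].
  case/explP=> -[|j] [[|k] ->]; rewrite ?dS ?drop0.
  - by rewrite lcpp; constructor 2.
  - exact: H.
  - by rewrite lcpC; apply: H.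
  - by constructor 1; apply/explP; exists j, k.
have le := let: And3 _ _ H := hP in H k.
have [/eqP Es|ne] := boolP (size (lcp (c :: z) (drop k z)) == size h).
  constructor 3; apply: prefix_eq_size; rewrite -?Es //.
  apply: (head_max hP (lcp_prefixl _ _)).
  by exists k; apply: lcp_prefixr.
constructor 1; have lt : size (lcp (c :: z) (drop k z)) < size h.
  by rewrite ltn_neqAle ne.
set l := lcp _ _ in lt *; set m := lcp (drop jh z) (drop k z).
have lh : prefix l h.
  apply: (head_max hP (lcp_prefixl _ _)).
  by exists k; apply: lcp_prefixr.
have hy : prefix h (drop jh z) by rewrite Eh lcp_prefixr.
have mhl : prefix (lcp m h) l.
  rewrite /l !prefix_lcp Eh (prefix_trans (lcp_prefixr m _)) ?lcp_prefixl //.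
  by rewrite (prefix_trans (lcp_prefixl m _)) ?lcp_prefixr.
suff -> : l = m by apply: expl_lcp; apply: expl_drop.
apply: prefix_anti.
  by rewrite prefix_lcp (prefix_trans lh hy) lcp_prefixr.
have [le1|le1] := leqP (size m) (size h).
  apply: prefix_trans mhl; rewrite prefix_lcp prefix_refl /=.
  exact: prefix_comparable (lcp_prefixl _ _) hy le1.
suff /size_prefix : prefix h l by rewrite leqNgt lt.
apply: prefix_trans mhl; rewrite prefix_lcp prefix_refl andbT.
exact: prefix_comparable hy (lcp_prefixl _ _) (ltnW le1).
Qed.

End Lcp.

(** * Inserting a suffix *)

Section Tree.

Variable T : eqType.
Implicit Types (u v z h : seq T) (c e : T) (w : nat -> seq T).

(** The lower end of the edge on which the word [v] lies, or [v] itself if it is a node. *)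
Definition is_locus z v q : Prop :=
  [/\ expl z q, prefix v q & forall u, expl z u -> prefix v u -> prefix q u].

Lemma locus_inj z v q q' : is_locus z v q -> is_locus z v q' -> q = q'.
Proof. by move=> [e1 p1 m1] [e2 p2 m2]; apply: prefix_anti; auto. Qed.

Lemma locus_mono z v v' q :
  prefix v v' -> prefix v' q -> is_locus z v q -> is_locus z v' q.
Proof.
by move=> vv' v'q [Eq vq H]; split=> // u Eu v'u;
  apply: H (prefix_trans vv' v'u).
Qed.

(* The node [0] stands for a parent of the root with an edge to the root on
   every symbol, so [tlen] is the length of a node plus one, and [ext] prepends
   a symbol. *)
Definition tlen w x : nat := if x == 0 then 0 else (size (w x)).+1.
Definition ext w e x : seq T := if x == 0 then [::] else e :: w x.

Lemma tlenS w x : 0 < x -> tlen w x = (size (w x)).+1.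
Proof. by rewrite /tlen lt0n => /negPf->. Qed.

Lemma size_ext w e x : size (ext w e x) = tlen w x.
Proof. by rewrite /ext /tlen; case: eqP. Qed.

(** [link] is the parent, with no node strictly in between. [tr e x] is a Weiner link, explicit or
    implicit: the locus of [e :: w x], and 0 if this word does not occur. [t_fresh] keeps the cells
    of nodes not yet allocated clean. *)
Record tree z (cnt : nat) w (link : nat -> nat) (tr : T -> nat -> nat) : Prop :=
  Tree {
  t_cnt : 1 < cnt;
  t_root : w 1 = [::];
  t_expl : forall x, 0 < x < cnt -> expl z (w x);
  t_surj : forall u, expl z u -> exists2 x, 0 < x < cnt & w x = u;
  t_inj : forall x y, 0 < x < cnt -> 0 < y < cnt -> w x = w y -> x = y;
  t_link : forall x, 0 < x < cnt ->
    [/\ link x < cnt, tlen w (link x) < tlen w x,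
        0 < link x -> prefix (w (link x)) (w x)
      & forall v, expl z v -> prefix v (w x) -> size v < size (w x) ->
          size v < tlen w (link x)];
  t_tr0 : forall e x, x < cnt -> tr e x = 0 ->
    forall u, expl z u -> ~~ prefix (ext w e x) u;
  t_tr1 : forall e x, x < cnt -> tr e x != 0 ->
    tr e x < cnt /\ is_locus z (ext w e x) (w (tr e x));
  t_fresh : forall e x, cnt <= x -> tr e x = 0
}.

(* The potential that pays for the climbs towards the root. *)
Definition depth z m : nat := \sum_(l < m) expl z (take l z).

Lemma depthS z m : depth z m.+1 = depth z m + expl z (take m z).
Proof. exact: big_ord_recr. Qed.

Lemma depth_skip z k d :
  (forall l, k <= l < k + d -> ~~ expl z (take l z)) ->
  depth z (k + d) = depth z k.
Proof.
elim: d => [|d IH] H; first by rewrite addn0.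
rewrite addnS depthS IH; last by move=> l lP; apply: H; lia.
by rewrite (negPf (H _ _)) ?addn0 //; lia.
Qed.

(** No node lies between [x] and its parent, so a step of a climb lowers the potential by exactly
    one. *)
Lemma depth_link z cnt w link tr x :
  tree z cnt w link tr -> 0 < x < cnt -> prefix (w x) z ->
  depth z (tlen w x) = (depth z (tlen w (link x))).+1.
Proof.
move=> tP xP xz; have [l1 l2 _ l4] := t_link tP xP.
have Ex : tlen w x = (size (w x)).+1 by rewrite /tlen; case: eqP => //; lia.
have Ewx : take (size (w x)) z = w x by apply/eqP; rewrite -prefixE.
rewrite Ex depthS Ewx (t_expl tP xP) addn1; congr _.+1.
have -> : size (w x) = tlen w (link x) + (size (w x) - tlen w (link x)) by lia.
apply: depth_skip => l lP; apply/negP => El.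
have lz : l <= size z by have := size_prefix xz; lia.
have := l4 _ El _ _; rewrite size_takel // => H.
have : l < tlen w (link x); last by lia.
apply: H; last by lia.
by rewrite -Ewx prefixE take_takel ?size_takel //; lia.
Qed.

Lemma sum_eq_le1 n a : \sum_(l < n) (l == a :> nat) <= 1.
Proof.
elim: n => [|n IH]; first by rewrite big_ord0.
rewrite big_ord_recr /=; have [En|] := eqVneq n a; last by rewrite addn0.
rewrite big1 // => i _; case: eqP => // Ei.
by have := ltn_ord i; rewrite Ei En ltnn.
Qed.

(** * The effect of one insertion on nodes and loci *)

Section Step.

Variables (c : T) (z : seq T) (cnt : nat) (w : nat -> seq T).
Variables (link : nat -> nat) (tr : T -> nat -> nat).
Hypothesis tP : tree z cnt w link tr.
Variables (p : nat).
Hypothesis p_lt : p < cnt.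
Hypothesis p_pre : 0 < p -> prefix (w p) z.
Hypothesis p_tr : tr c p != 0.
Hypothesis p_max : forall x, 0 < x < cnt -> prefix (w x) z ->
  tlen w p < tlen w x -> tr c x = 0.

(** Here [p] is the deepest prefix of [z] among the nodes with a Weiner link by [c], or 0. The word
    [h] will be the head of [c :: z], and [q] is the node at its locus. *)
Let q := tr c p.
Let h := ext w c p.

Lemma step_q : 0 < q < cnt.
Proof. by rewrite lt0n p_tr; case: (t_tr1 tP p_lt p_tr). Qed.

Lemma step_locus : is_locus z h (w q).
Proof. by case: (t_tr1 tP p_lt p_tr). Qed.

Lemma tree_tlen_lt x : 0 < x < cnt -> tlen w x <= (size z).+1.
Proof.
move=> xP; have := expl_size (t_expl tP xP).
by rewrite /tlen; case: eqP.
Qed.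

(** A nonempty common prefix of [c :: z] and a suffix of [z] is [c :: x], where [x] is a common
    prefix of [z] and the next suffix. So [x] is a node with a link by [c], and [p_max] bounds its
    length. *)
Lemma step_head : is_head c z h.
Proof.
have [Eq hq hm] := step_locus; have [j qj] := expl_prefix_drop Eq.
have hz : prefix h (c :: z).
  rewrite /h /ext; case: eqP => // p0 /=.
  by rewrite eqxx p_pre // lt0n; apply/eqP.
split=> //; first by exists j; apply: prefix_trans hq qj.
move=> k; move El: (lcp _ _) => [//|a x].
have Ea : a = c.
  by have := lcp_prefixl (c :: z) (drop k z); rewrite El /= => /andP[/eqP].
have xz : prefix x z.
  by have := lcp_prefixl (c :: z) (drop k z); rewrite El /= => /andP[].
have Ex : expl z x.
  move: El; case Ek: (drop k z) => [|b y] /=; first by move=> E0;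
    discriminate E0.
  case: (c =P b) => [Eb [_ <-]|_ E0]; last by discriminate E0.
  apply/explP; exists 0, k.+1.
  by rewrite -[k.+1]add1n -drop_drop Ek /= !drop0.
have [y yP Ey] := t_surj tP Ex.
rewrite size_ext /= leqNgt; apply/negP => lt.
have y0 : (y == 0) = false by lia.
have t0 : tr c y = 0 by apply: p_max; rewrite ?/tlen ?y0 ?Ey //; lia.
have yl : y < cnt by case/andP: yP.
have := t_tr0 tP yl t0 (expl_drop z k).
by rewrite /ext y0 Ey -Ea -El lcp_prefixr.
Qed.

Lemma stepE u :
  expl (c :: z) u <-> [\/ expl z u, u = c :: z | u = h].
Proof. exact: expl_cons step_head. Qed.

Lemma prefix_head v u : expl z u -> prefix v u -> prefix v (c :: z) -> prefix v
  h.
Proof.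
move=> /expl_prefix_drop[j uj] vu vz; apply: (head_max step_head vz).
by exists j; apply: prefix_trans vu uj.
Qed.

Lemma size_head : size h <= size z.
Proof. exact: head_size step_head. Qed.

Lemma head_prefix : prefix h (c :: z).
Proof. by case: step_head. Qed.

(** The only new branching point is [h], on the edge that ends in [w q]. A locus can change only for
    the words on the upper part of this edge. *)
Lemma locus_stay v x :
  is_locus z v x -> ~ (prefix v h /\ x = w q) -> is_locus (c :: z) v x.
Proof.
move=> [Ex vx xmin] nq; split=> //; first by apply/stepE; constructor 1.
suff H : prefix v h -> prefix x h.
  move=> u /stepE[Eu|->|->] vu //; [exact: xmin| |exact: H].
  by exact: prefix_trans (H (prefix_head Ex vx vu)) head_prefix.
move=> vh; have [Eq hq qmin] := step_locus.
have xq : prefix x (w q) by apply: xmin => //; apply: prefix_trans vh hq.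
have [le|le] := leqP (size h) (size x).
  case: nq; split=> //; apply: prefix_anti => //.
  by apply: qmin => //; apply: prefix_comparable hq xq le.
exact: prefix_comparable xq hq (ltnW le).
Qed.

Lemma locus_head v : prefix v h -> is_locus z v (w q) -> is_locus (c :: z) v h.
Proof.
move=> vh [_ _ vmin]; split=> //; first by apply/stepE; constructor 3.
have [_ hq _] := step_locus.
move=> u /stepE[Eu|->|->] vu; last exact: prefix_refl.
  by apply: prefix_trans hq _; apply: vmin.
exact: head_prefix.
Qed.

Lemma locus_new v :
  (forall u, expl z u -> ~~ prefix v u) -> prefix v (c :: z) ->
  is_locus (c :: z) v (c :: z).
Proof.
move=> vno vz; split=> //; first exact: expl_refl.
have [Eq hq _] := step_locus.
move=> u /stepE[Eu|->|->] vu; first by rewrite (negPf (vno _ Eu)) in vu.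
  exact: prefix_refl.
by have := vno _ Eq; rewrite (prefix_trans vu hq).
Qed.

Lemma locus_none v :
  (forall u, expl z u -> ~~ prefix v u) -> ~~ prefix v (c :: z) ->
  forall u, expl (c :: z) u -> ~~ prefix v u.
Proof.
move=> vno vz u /stepE[/vno//|->//|->].
by apply: contra vz => vh; apply: prefix_trans vh head_prefix.
Qed.

(** The links once the leaf [c :: z] has received the number [cnt], before an edge is split. *)
Definition tr1 e x : nat :=
  if [&& e == c, 0 < x, prefix (w x) z & tr e x == 0] then cnt else tr e x.

Lemma ext_prefix_cons e x : 0 < x ->
  prefix (ext w e x) (c :: z) = (e == c) && prefix (w x) z.
Proof. by rewrite /ext lt0n => /negPf->. Qed.

Lemma tr_gt0 e x : x < cnt -> tr e x = 0 -> 0 < x.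
Proof.
move=> xl t0; rewrite lt0n; apply/eqP => x0.
by have := t_tr0 tP xl t0 (expl_nil z); rewrite x0.
Qed.

(** The excluded case, a link to [q] from a word that is a prefix of the head, is the one that
    depends on whether the edge is split. *)
Lemma tr1P e x w' : (forall y, y < cnt -> w' y = w y) -> w' cnt = c :: z ->
  x < cnt ->
  (tr1 e x = 0 -> forall u, expl (c :: z) u -> ~~ prefix (ext w e x) u) /\
  (tr1 e x != 0 ->
     ~ (prefix (ext w e x) h /\ tr1 e x = q) ->
     tr1 e x < cnt.+1 /\ is_locus (c :: z) (ext w e x) (w' (tr1 e x))).
Proof.
move=> Ew Ewc xl; rewrite /tr1; case: ifP => [/and4P[/eqP-> x0 xz /eqP t0]|nP].
  split=> [E|_ _]; first by have := t_cnt tP; rewrite E.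
  split=> //; rewrite Ewc; apply: locus_new (t_tr0 tP xl t0) _.
  by rewrite ext_prefix_cons // eqxx.
split=> [t0|tn0 nq].
  apply: locus_none (t_tr0 tP xl t0) _.
  have x0 := tr_gt0 xl t0; rewrite ext_prefix_cons //.
  by move: nP; rewrite x0 t0 eqxx andbT /= => ->.
have [tl loc] := t_tr1 tP xl tn0; split; first exact: ltnW.
rewrite Ew //; apply: locus_stay => // -[vh Ewq]; apply: nq; split=> //.
by apply: (t_inj tP) => //; [rewrite lt0n tn0 | exact: step_q].
Qed.

Lemma head_cons : 0 < p -> h = c :: w p.
Proof. by rewrite /h /ext lt0n => /negPf->. Qed.

(** An occurrence of [c :: w p] is one of [c] followed by any shorter prefix of [z]. The missing
    links thus fill the lower end of the path to [z], and one climb finds them all. *)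
Lemma tr_above x : 0 < x < cnt -> prefix (w x) z -> tlen w x <= tlen w p ->
  tr c x != 0.
Proof.
move=> xP xz le; apply/negP => /eqP t0.
have x0 : (x == 0) = false by lia.
have p0 : 0 < p by move: le; rewrite /tlen x0 lt0n; case: eqP.
have xl : x < cnt by case/andP: xP.
have [Eq hq _] := step_locus.
have := t_tr0 tP xl t0 Eq; rewrite (prefix_trans _ hq) //.
rewrite head_cons // /ext x0 /= eqxx.
apply: prefix_comparable xz (p_pre p0) _.
by move: le; rewrite /tlen x0; have -> : (p == 0) = false by lia.
Qed.

(** Turns the test for a missing link into the comparison of lengths that describes how far the
    climb went. *)
Lemma tr1_eq e x m : x < cnt -> 0 < x -> m = tlen w p ->
  tr1 e x = (if [&& e == c, prefix (w x) z & m < tlen w x] then cnt else tr e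
    x).
Proof.
move=> xl x0 ->; rewrite /tr1 x0 /=; case: eqP => [->|//].
have xP : 0 < x < cnt by rewrite x0.
case xz: (prefix _ _) => //=.
have [le|lt] := leqP (tlen w x) (tlen w p); last by rewrite p_max ?eqxx.
by rewrite (negPf (tr_above xP xz le)).
Qed.

(** * The head is already a node *)

Section NoSplit.

Hypothesis szh : size h = size (w q).

Let hq : h = w q.
Proof.
by have [_ hq _] := step_locus; apply: prefix_eq_size => //; rewrite szh.
Qed.

Lemma tree_step_nosplit w' link' tr' :
  (forall x, x < cnt -> w' x = w x) -> w' cnt = c :: z ->
  (forall x, x < cnt -> link' x = link x) -> link' cnt = q ->
  (forall e x, x < cnt -> tr' e x = tr1 e x) ->
  (forall e x, cnt <= x -> tr' e x = 0) ->
  tree (c :: z) cnt.+1 w' link' tr'.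
Proof.
move=> Ew Ewc El Elc Et Etc.
have cnt2 := t_cnt tP; have qP := step_q.
have Etl x : x < cnt -> tlen w' x = tlen w x by move=> xl; rewrite /tlen Ew.
have Ex e x : x < cnt -> ext w' e x = ext w e x by move=> xl; rewrite /ext Ew.
have c0 : (cnt == 0) = false by lia.
have stepE' u : expl (c :: z) u -> expl z u \/ u = c :: z.
  case/stepE=> [|->|->]; [by left|by right|left].
  by rewrite hq; apply: (t_expl tP).
split.
- by lia.
- by rewrite Ew ?(t_root tP).
- move=> x /andP[x0]; rewrite ltnS leq_eqVlt => /orP[/eqP->|xl].
    by rewrite Ewc expl_refl.
  by rewrite Ew //; apply/stepE; constructor 1; apply: (t_expl tP); rewrite x0.
- move=> u /stepE'[/(t_surj tP)[x /andP[x0 xl] <-]|->].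
    by exists x; rewrite ?Ew // x0 ltnW.
  by exists cnt; rewrite ?Ewc //; lia.
- have ne x : 0 < x < cnt -> w x <> c :: z.
    by move=> /(t_expl tP)/expl_size le E; rewrite E /= ltnn in le.
  move=> x y /andP[x0]; rewrite ltnS leq_eqVlt => xP.
  move=> /andP[y0]; rewrite ltnS leq_eqVlt => yP.
  case/orP: xP => [/eqP->|xl]; case/orP: yP => [/eqP->|yl] //.
  + by rewrite Ewc Ew // => /esym/ne; rewrite y0 yl => /(_ isT).
  + by rewrite Ewc Ew // => /ne; rewrite x0 xl => /(_ isT).
  + by rewrite !Ew //; apply: (t_inj tP); rewrite ?x0 ?y0.
- move=> x /andP[x0]; rewrite ltnS leq_eqVlt => /orP[/eqP->|xl].
    rewrite Elc Ewc Etl; last by lia.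
    rewrite Ew; last by lia.
    have szq : size (w q) <= size z by apply: expl_size; apply: (t_expl tP).
    have q0 : (q == 0) = false by lia.
    rewrite /tlen c0 q0 Ewc -hq /=; split=> //; try lia.
      by move=> _; apply: head_prefix.
    move=> v Ev vz vlt; rewrite ltnS; apply: size_prefix.
    case: (stepE' _ Ev) => [Ev'|Ev'];
      first exact: (prefix_head Ev' (prefix_refl _) vz).
    by move: vlt; rewrite Ev' /= ltnn.
  have xP : 0 < x < cnt by rewrite x0.
  have [l1 l2 l3 l4] := t_link tP xP.
  rewrite El // !Etl // !Ew //; split=> //; first exact: ltnW.
  move=> v /stepE'[|->] //; first exact: l4.
  move=> _; have := expl_size (t_expl tP xP) => /= *; lia.
- move=> e x; rewrite ltnS leq_eqVlt => /orP[/eqP-> _ u Eu|xl].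
    rewrite /ext c0 Ewc; apply/negP => /size_prefix /=.
    by have := expl_size Eu => /=; lia.
  by rewrite Et // Ex //; apply: (proj1 (tr1P e Ew Ewc xl)).
- move=> e x; rewrite ltnS leq_eqVlt => /orP[/eqP->|xl].
    by rewrite Etc.
  rewrite Et // Ex // => tn0.
  have [/andP[vh /eqP tq]|nq] := boolP (prefix (ext w e x) h && (tr1 e x == q)).
    rewrite tq; split; first by lia.
    rewrite Ew -?hq; last by lia.
    move: tq; rewrite /tr1; case: ifP => [_ E|_ tq]; first by lia.
    have tn0' : tr e x != 0 by rewrite tq; lia.
    have [_] := t_tr1 tP xl tn0'; rewrite tq => loc.
    exact: locus_head.
  apply: (proj2 (tr1P e Ew Ewc xl)) => // -[vh tq].
  by rewrite vh tq eqxx in nq.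
- by move=> e x xl; apply: Etc; apply: ltnW.
Qed.

End NoSplit.

(** * The head splits an edge *)

Section Split.

Hypothesis szh : size h < size (w q).

(** For [p = 0] the head is empty, and the empty word is always a node. *)
Lemma split_p0 : 0 < p.
Proof.
rewrite lt0n; apply/negP => /eqP p0.
have [_ _ hm] := step_locus.
have : prefix (w q) [::] by apply: hm (expl_nil z) _; rewrite /h /ext p0.
by move=> /size_prefix; move: szh => /=; lia.
Qed.

Lemma split_h : h = c :: w p.
Proof. exact: head_cons split_p0. Qed.

Lemma split_expl : ~~ expl z h.
Proof.
apply/negP => Eh; have [_ _ hm] := step_locus.
have /size_prefix := hm _ Eh (prefix_refl h); lia.
Qed.

(** For [x] on the path to [p], a word [c :: w x] with locus [w q] lies on the upper part of the
    split edge, which now ends in [h]. *)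
Definition tr2 e x : nat :=
  if [&& e == c, 0 < x, prefix (w x) (w p) & tr1 e x == q] then cnt.+1
  else tr1 e x.

(** [c :: w y] lies between [c :: w x] and [h], which have the same locus. The links to [q] on the
    path to [p] are thus contiguous and end at [p], so a climb that stops at the first other link
    redirects all of them. *)
Lemma locus_below x y : 0 < x < cnt -> 0 < y < cnt -> prefix (w x) (w y) ->
  prefix (w y) (w p) -> tr c x = q -> tr c y = q.
Proof.
move=> xP yP xy yp tx.
have x0 : (x == 0) = false by lia.
have y0 : (y == 0) = false by lia.
have xl : x < cnt by case/andP: xP.
have yl : y < cnt by case/andP: yP.
have tn0 : tr c x != 0 by rewrite tx; have := step_q; lia.
have [Eq hq _] := step_locus.
have yq : prefix (ext w c y) (w q).
  by apply: prefix_trans hq; rewrite split_h /ext y0 /= eqxx.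
have [_] := t_tr1 tP xl tn0; rewrite tx => loc.
have loc' : is_locus z (ext w c y) (w q).
  by apply: locus_mono loc => //; rewrite /ext x0 y0 /= eqxx.
have tyn0 : tr c y != 0.
  by apply/negP => /eqP t0; have := t_tr0 tP yl t0 Eq; rewrite yq.
have [tl loc''] := t_tr1 tP yl tyn0.
apply: (t_inj tP); rewrite ?step_q ?lt0n ?tyn0 //.
exact: locus_inj loc'' loc'.
Qed.

(** Without its first symbol [u] is still a node, and a node that extends [h] extends [w q]. This is
    why the new node can copy the links of [q]. *)
Lemma locus_cons_head e u :
  expl z u -> prefix (e :: h) u -> prefix (e :: w q) u.
Proof.
case: u => [//|b u] Eu /=; case/andP=> /eqP<- hu; rewrite eqxx /=.
by have [_ _ hm] := step_locus; apply: hm => //; apply: expl_cons_behead Eu.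
Qed.

(** A node at or below [h] on this path would be a locus of [h] above [w q]. *)
Lemma prefix_split v : expl z v -> prefix v (w q) -> size v < size (w q) ->
  size v < size h.
Proof.
move=> Ev vq lt; rewrite ltnNge; apply/negP => le.
have [_ hq hm] := step_locus.
have /size_prefix := hm _ Ev (prefix_comparable hq vq le); lia.
Qed.

Lemma tree_step_split w' link' tr' :
  (forall x, x < cnt -> w' x = w x) -> w' cnt = c :: z -> w' cnt.+1 = h ->
  (forall x, x < cnt -> link' x = if x == q then cnt.+1 else link x) ->
  link' cnt = cnt.+1 -> link' cnt.+1 = link q ->
  (forall e x, x < cnt -> tr' e x = tr2 e x) ->
  (forall e, tr' e cnt = 0) -> (forall e, tr' e cnt.+1 = tr1 e q) ->
  (forall e x, cnt.+1 < x -> tr' e x = 0) ->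
  tree (c :: z) cnt.+2 w' link' tr'.
Proof.
move=> Ew Ewc Ewr El Elc Elr Et Etc Etr Ef.
have cnt2 := t_cnt tP; have qP := step_q.
have Etl x : x < cnt -> tlen w' x = tlen w x by move=> xl; rewrite /tlen Ew.
have Ex e x : x < cnt -> ext w' e x = ext w e x by move=> xl; rewrite /ext Ew.
have c0 : (cnt == 0) = false by lia.
have q0 : (q == 0) = false by lia.
have [Eq hq hm] := step_locus; have szq := expl_size Eq.
have ltP x : x < cnt.+2 -> [\/ x < cnt, x = cnt | x = cnt.+1].
  by rewrite !ltnS leq_eqVlt ltnS leq_eqVlt => /or3P[/eqP->|/eqP->|];
    [constructor 3|constructor 2|constructor 1].
have hz : h != c :: z by apply/eqP => E; have := size_head; rewrite E /= ltnn.
split.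
- by lia.
- by rewrite Ew ?(t_root tP).
- move=> x /andP[x0 /ltP[xl|->|->]].
  + by rewrite Ew //; apply/stepE; constructor 1; apply: (t_expl tP);
      rewrite x0.
  + by rewrite Ewc expl_refl.
  + by rewrite Ewr; apply/stepE; constructor 3.
- move=> u /stepE[/(t_surj tP)[x /andP[x0 xl] <-]|->|->].
  + by exists x; rewrite ?Ew // x0 /=; lia.
  + by exists cnt; rewrite ?Ewc //; lia.
  + by exists cnt.+1; rewrite ?Ewr //; lia.
- have ne x : 0 < x -> x < cnt -> w x <> c :: z.
    move=> x0 xl E; have xP : 0 < x < cnt by rewrite x0.
    by have /expl_size := t_expl tP xP; rewrite E /= ltnn.
  have ne' x : 0 < x -> x < cnt -> w x <> h.
    move=> x0 xl E; have xP : 0 < x < cnt by rewrite x0.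
    by have := t_expl tP xP; rewrite E (negPf split_expl).
  move=> x y /andP[x0 /ltP[xl|->|->]] /andP[y0 /ltP[yl|->|->]] //;
    rewrite ?Ewc ?Ewr ?(Ew x) // ?(Ew y) //.
  + by apply: (t_inj tP); rewrite ?x0 ?y0.
  + by move/ne => /(_ x0 xl).
  + by move/ne' => /(_ x0 xl).
  + by move/esym/ne => /(_ y0 yl).
  + by move/esym/eqP; rewrite (negPf hz).
  + by move/esym/ne' => /(_ y0 yl).
  + by move/eqP; rewrite (negPf hz).
- move=> x /andP[x0 /ltP[xl|->|->]].
  + have xP : 0 < x < cnt by rewrite x0.
    have [l1 l2 l3 l4] := t_link tP xP.
    have szx := expl_size (t_expl tP xP).
    rewrite El //; case: eqP => [xq|xq].
      have Er : tlen w' cnt.+1 = (size h).+1 by rewrite /tlen /= Ewr.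
      rewrite ltnS leqnn (Etl x) // Er Ewr {1}/tlen xq q0 Ew; last by lia.
      split=> //.
      move=> v /stepE[Ev|->|->] vq vlt; rewrite ltnS //.
        by apply: ltnW; apply: prefix_split.
      by move: vlt => /=; lia.
    rewrite !Etl // !Ew //; split=> //; first by lia.
    move=> v /stepE[Ev|->|->] vx vlt.
    * exact: l4.
    * by move: vlt => /=; lia.
    (* A node below [h] other than [q] lies below [q], so [h] does not come between it and its
       parent. *)
    * have qx := hm _ (t_expl tP xP) vx.
      have ne : w q != w x.
        by apply/eqP => E; apply: xq; apply/esym; apply: (t_inj tP).
      by have := l4 _ Eq qx (prefix_size_lt qx ne); lia.
  + have Er : tlen w' cnt.+1 = (size h).+1 by rewrite /tlen /= Ewr.
    rewrite Elc Er Ewr Ewc /tlen c0 Ewc /=; split=> //.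
    * by have := size_head; lia.
    * by move=> _; apply: head_prefix.
    * move=> v /stepE[Ev|->|->] vz vlt; rewrite ltnS //.
        by apply: size_prefix; apply: prefix_head Ev (prefix_refl v) vz.
      by move: vlt => /=; rewrite ltnn.
  + have [l1 l2 l3 l4] := t_link tP qP.
    have lw : 0 < link q -> size (w (link q)) < size (w q).
      by move: l2; rewrite /tlen q0 => l2 l0; move: l2; case: eqP; lia.
    have lE : 0 < link q -> expl z (w (link q)).
      by move=> l0; apply: (t_expl tP); rewrite l0.
    have Er : tlen w' cnt.+1 = (size h).+1 by rewrite /tlen /= Ewr.
    rewrite Elr Er Etl // Ewr Ew //; split=> //.
    * by lia.
    * rewrite /tlen; case: eqP => // l0; rewrite ltnS.
      by apply: prefix_split; [apply: lE|apply: l3|apply: lw]; lia.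
    * move=> l0; apply: prefix_comparable (l3 l0) hq _; apply: ltnW.
      by apply: prefix_split; [apply: lE|apply: l3|apply: lw].
    * move=> v /stepE[Ev|->|->] vh vlt.
      - by apply: l4 => //; [apply: prefix_trans vh hq|lia].
      - by move: vlt => /=; have := size_head; lia.
      - by rewrite ltnn in vlt.
- move=> e x /ltP[xl|->|->].
  + rewrite Et // Ex // /tr2; case: ifP => // _.
    exact: (proj1 (tr1P e Ew Ewc xl)).
  + move=> _ u Eu; rewrite /ext c0 Ewc; apply/negP => /size_prefix /=.
    by have := expl_size Eu => /=; lia.
  + rewrite Etr /ext /= Ewr => t0.
    have ql : q < cnt by case/andP: qP.
    have tq0 : tr e q = 0.
      by move: t0; rewrite /tr1; case: ifP => // _ E; lia.
    apply: locus_none.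
      move=> u Eu; apply/negP => /(locus_cons_head Eu).
      by have := t_tr0 tP ql tq0 Eu; rewrite /ext q0 => /negPf->.
    apply/negP => /= /andP[/eqP Ee hz'].
    move: t0; rewrite /tr1 Ee eqxx lt0n q0 /= -Ee tq0 eqxx andbT.
    by rewrite hm ?expl_refl // => E; lia.
- move=> e x /ltP[xl|->|->].
  + rewrite Et // Ex // /tr2;
      case: ifP => [/and4P[/eqP-> x0 xp /eqP tq]|nP] tn0.
      split=> //; rewrite Ewr.
      have x0' : (x == 0) = false by lia.
      have vh : prefix (ext w c x) h by rewrite split_h /ext x0' /= eqxx.
      move: tq; rewrite /tr1; case: ifP => [_ E|_ tq]; first by lia.
      have tn0' : tr c x != 0 by rewrite tq; lia.
      have [_] := t_tr1 tP xl tn0'; rewrite tq => loc.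
      exact: locus_head.
    have [||tl loc] := proj2 (tr1P e Ew Ewc xl); last by split=> //; lia.
      by [].
    move=> [vh tq]; move: nP; rewrite tq eqxx andbT => /negP; apply.
    have x0 : 0 < x.
      rewrite lt0n; apply/eqP => x0; move: tq; rewrite /tr1 x0 !andbF /= => tq.
      have tn0' : tr e x != 0 by rewrite x0 tq; lia.
      have [_] := t_tr1 tP xl tn0'; rewrite x0 tq => -[_ _ hm'].
      have /size_prefix := hm' [::] (expl_nil z) isT; rewrite /=; lia.
    rewrite x0 /=; move: vh; rewrite split_h /ext.
    by have -> : (x == 0) = false by lia.
  + by rewrite Etc.
  + have ql : q < cnt by case/andP: qP.
    have nh e' : ~~ prefix (e' :: h) h.
      by apply/negP => /size_prefix /=; rewrite ltnn.
    rewrite Etr /ext /= Ewr => tn0; move: (tn0); rewrite /tr1.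
    case: ifP => [/and4P[/eqP-> _ qz /eqP tq0]|nP tn0'].
      split=> //; rewrite Ewc; apply: locus_new.
        move=> u Eu; apply/negP => /(locus_cons_head Eu).
        by have := t_tr0 tP ql tq0 Eu; rewrite /ext q0 => /negPf->.
      by rewrite /= eqxx (prefix_trans hq).
    have [tl loc] := t_tr1 tP ql tn0'.
    split; first by lia.
    rewrite Ew //; apply: locus_stay; last by move=> -[];
      rewrite (negPf (nh e)).
    case: loc; rewrite /ext q0 => E1 E2 E3; split=> //.
      by apply: prefix_trans E2; rewrite /= eqxx.
    by move=> u Eu /(locus_cons_head Eu); apply: E3.
- by move=> e x xl; apply: Ef.
Qed.

End Split.

(** Apart from the empty word, the head and the suffix itself, which account for the 3, a node that
    is a prefix of [c :: z] is [c :: x] with [x] a node shorter than [m]: from [m] up to [p] all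
    links by [c] lead to [q], and beyond [p] there are none. In the applications [m] marks where the
    last climb stopped. *)
Lemma depth_step m : m <= (size z).+1 ->
  (forall x, 0 < x < cnt -> prefix (w x) z -> m < tlen w x <= tlen w p ->
     tr c x = q) ->
  depth (c :: z) (size z).+2 <= depth z m + 3.
Proof.
move=> mz mP; rewrite /depth big_ord_recl /=.
have low l : expl (c :: z) (c :: take l z) -> expl z (take l z).
  case/stepE=> [/expl_cons_behead|[->]|Eh] //; first exact: expl_refl.
  have p0 : 0 < p.
    by rewrite lt0n; apply/eqP => p0; move: Eh; rewrite /h /ext p0.
  move: Eh; rewrite head_cons // => -[->].
  by apply: (t_expl tP); rewrite p0.
have high l : m <= l < size z -> expl (c :: z) (c :: take l z) ->
    l = (size h).-1.
  move=> /andP[ml lz]; case/stepE=> [Ev|[E]|<-]; last first.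
  - by rewrite /= size_takel // ltnW.
  - have := congr1 size E; rewrite size_takel ?(ltnW lz) // => El.
    by rewrite El ltnn in lz.
  have [x xP Ex] := t_surj tP (expl_cons_behead Ev).
  have x0 : (x == 0) = false by lia.
  have Etx : tlen w x = l.+1 by rewrite /tlen x0 Ex size_takel // ltnW.
  have xz : prefix (w x) z by rewrite Ex prefix_take.
  have xl : x < cnt by case/andP: xP.
  have [le|gt] := leqP (tlen w x) (tlen w p).
    have tq : tr c x = q by apply: mP => //; lia.
    have tn0 : tr c x != 0 by rewrite tq; have := step_q; lia.
    have [_ [_ _ xm]] := t_tr1 tP xl tn0.
    have := xm _ Ev; rewrite /ext x0 Ex tq => /(_ (prefix_refl _)) /size_prefix.
    have [_ /size_prefix hq _] := step_locus.
    move: le hq; rewrite Etx -(size_ext w c) -/h /= size_takel ?(ltnW lz) //.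
    by move: (size h) (size (w q)) => *; lia.
  by have := t_tr0 tP xl (p_max xP xz gt) Ev; rewrite /ext x0 Ex prefix_refl.
apply: (@leq_trans (1 + (\sum_(l < (size z).+1)
   ((if l < m then expl z (take l z) : nat else 0) + (l == (size h).-1 :> nat)
    + (l == size z :> nat))))).
  apply: leq_add; first by case: (expl _ _).
  apply: leq_sum => l _ /=.
  have := ltn_ord l; move: (nat_of_ord l) => {}l lz.
  case Ev: (expl (c :: z) _) => //; case: ltnP => [_|ml].
    by rewrite (low _ Ev).
  have [->|ne] := eqVneq l (size z); first by rewrite addn1.
  by rewrite (high l _ Ev) ?eqxx //; lia.
rewrite !big_split /= -big_mkcond /=.
have -> : \sum_(i < (size z).+1 | i < m) (expl z (take i z) : nat) = depth z m.
  by rewrite /depth (big_ord_widen _ (fun i => expl z (take i z) : nat) mz).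
rewrite -/(depth z m) -addnA addnCA leq_add2l.
exact: leq_add (leqnn 1) (leq_add (sum_eq_le1 _ _) (sum_eq_le1 _ _)).
Qed.

End Step.

End Tree.

(** * Building the suffix tree *)

Notation vN := 0 (only parsing).
Notation vI := 2 (only parsing).
Notation vC := 3 (only parsing).
Notation vLast := 4 (only parsing).
Notation vCur := 5 (only parsing).
Notation vCnt := 6 (only parsing).
Notation vP := 7 (only parsing).
Notation vQ := 8 (only parsing).
Notation vR := 9 (only parsing).

(* [kLen] holds the length of a node plus one. *)
Notation kS := 0 (only parsing).
Notation kLen := 1 (only parsing).
Notation kPos := 2 (only parsing).
Notation kLink := 3 (only parsing).
Notation kTr := 4 (only parsing).

Notation "c1 ;; c2" := (Sq c1 c2) (at level 90, right associativity).
Notation Get k e := (Ld k (Cst 0) e).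
Notation Put k e := (Sto k (Cst 0) e).

Arguments update f i v j /.
Arguments upda f k p i v k' p' i' /.

(** Used twice: to fill missing links with the new leaf, and to redirect links from [q] to the node
    that splits its edge. Node 0, whose links lead to the root, stops both. *)
Definition climb (eX eY : expr) : cmd :=
  Whl (Op OEq (Ld kTr (Var vC) (Var vP)) eX)
    (Sto kTr (Var vC) (Var vP) eY ;; Asg vP (Get kLink (Var vP))).

(** Both kinds of new node are prefixes of the suffix at [vI]. Each is one symbol longer than an
    existing node, whose [kLen] entry is therefore exactly the new length; the added 1 is the offset
    of [kLen]. *)
Definition new_node (v : nat) (len : expr) : cmd :=
  Asg v (Var vCnt) ;;
  Asg vCnt (Op OAdd (Var vCnt) (Cst 1)) ;;
  Put kLen (Var v) (Op OAdd len (Cst 1)) ;;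
  Put kPos (Var v) (Var vI).

Definition split_code (sigma : nat) : cmd :=
  new_node vR (Get kLen (Var vP)) ;;
  foreach (iota 0 sigma)
    (fun e => Sto kTr (Cst e) (Var vR) (Ld kTr (Cst e) (Var vQ))) ;;
  climb (Var vQ) (Var vR) ;;
  Put kLink (Var vR) (Get kLink (Var vQ)) ;;
  Put kLink (Var vQ) (Var vR) ;;
  Put kLink (Var vCur) (Var vR).

Definition head_code : cmd :=
  Asg vI (Op OSub (Var vI) (Cst 1)) ;;
  Asg vC (Get kS (Var vI)) ;;
  new_node vCur (Get kLen (Var vLast)) ;;
  Asg vP (Var vLast) ;;
  climb (Cst 0) (Var vCur) ;;
  Asg vQ (Ld kTr (Var vC) (Var vP)).

(** The head is one symbol longer than [p], also for [p = 0] in terms of [tlen]. The test thus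
    compares the lengths of the head and of its locus: equality means that the head is a node. *)
Definition insert_code (sigma : nat) : cmd :=
  head_code ;;
  Ite (Op OEq (Op OAdd (Get kLen (Var vP)) (Cst 1)) (Get kLen (Var vQ)))
    (Put kLink (Var vCur) (Var vQ))
    (split_code sigma) ;;
  Asg vLast (Var vCur).

Definition build_code (sigma : nat) : cmd :=
  foreach (iota 0 sigma) (fun e => Sto kTr (Cst e) (Cst 0) (Cst 1)) ;;
  Put kLen (Cst 1) (Cst 1) ;;
  Asg vLast (Cst 1) ;;
  Asg vCnt (Cst 2) ;;
  Asg vI (Var vN) ;;
  Whl (Var vI) (insert_code sigma).

Section Build.

Variables (sigma : nat) (s : seq 'I_sigma) (n B KN PP : nat).

Hypothesis size_s : size s = n.

Hypothesis s_gt0 : 0 < n.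
Hypothesis KN_ge : 2 * n + 2 <= KN.
Hypothesis B_gt : KN < B.
Hypothesis PP_lt : PP < B.
Hypothesis PP_gt : sigma < PP.

Local Notation wp := (wp B KN PP).

Definition wordat (st : state) (x : nat) : seq 'I_sigma :=
  take (ar st kLen 0 x).-1 (drop (ar st kPos 0 x) s).

(** The state of a climb from [p0] that has reached the current [vP]. Its last equation says that
    ticks plus potential remain constant. *)
Definition climbed (st0 : state) (z : seq 'I_sigma) cnt
    (w : nat -> seq 'I_sigma) (c x0 y0 p0 : nat) (st : state) : Prop :=
  let p := va st vP in
  [/\ forall y, y != vP -> va st y = va st0 y,
      forall k q i, k != kTr -> ar st k q i = ar st0 k q i,
      forall e x, ar st kTr e x =
        if [&& e == c, 0 < x < cnt, prefix (w x) (w p0) & tlen w p < tlen w x]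
        then y0 else ar st0 kTr e x,
      p < cnt /\ (0 < p -> prefix (w p) (w p0))
    & (forall x, 0 < x < cnt -> prefix (w x) (w p0) -> tlen w p < tlen w x ->
        ar st0 kTr c x = x0)
      /\ tk st + depth z (tlen w p) = tk st0 + depth z (tlen w p0)].

(** The entry of node 0 differs from [x0], so the loop never leaves the table. Each iteration moves
    to the parent and is paid for by [depth_link]. *)
Lemma wp_climb z cnt w link tr (c : 'I_sigma) x0 y0 p0 eX eY st0 :
  tree z cnt w link tr -> cnt <= KN ->
  0 < p0 < cnt -> prefix (w p0) z ->
  va st0 vP = p0 -> va st0 vC = c ->
  (forall st, (forall y, y != vP -> va st y = va st0 y) ->
    [/\ eval eX st = x0, safe B KN PP eX st, eval eY st = y0
      & safe B KN PP eY st]) ->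
  ar st0 kTr c 0 != x0 ->
  (forall x, 0 < x < cnt -> ar st0 kLink 0 x = link x) ->
  wp (climb eX eY) (fun st =>
    climbed st0 z cnt w c x0 y0 p0 st /\ ar st kTr c (va st vP) != x0) st0.
Proof.
move=> tP cntP p0P p0z Ep Ec eXY tr0 El.
have cP : c < PP by apply: ltn_trans PP_gt.
apply: (@wp_whl _ _ _ (climbed st0 z cnt w c x0 y0 p0)
  (fun st => tlen w (va st vP))).
- split=> //; rewrite ?Ep.
  + move=> e x; case: ifP => // /and4P[_ xP xp lt].
    by have := size_prefix xp; move: lt; rewrite !tlenS; lia.
  + by case/andP: p0P => _ ->; rewrite prefix_refl.
  + split=> // x xP xp lt; have := size_prefix xp; move: lt; rewrite !tlenS;
      lia.
- move=> st [V A R [pl pp] [H D]].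
  have [X1 X2 _ _] := eXY _ V.
  by rewrite /= X2 V // Ec cP /= (leq_trans pl).
- move=> st [V A R [pl pp] [H D]] e0; split=> //.
  have [X1 X2 _ _] := eXY _ V.
  by move/eqP: e0; rewrite /= V // Ec X1 eqb0.
move=> st [V A R [pl pp] [H D]] e0.
have [X1 X2 Y1 Y2] := eXY _ V.
have VC : va st vC = c by rewrite V.
move: e0; rewrite /= VC X1 => e0.
have {}e0 : ar st kTr c (va st vP) = x0 by move: e0; rewrite eqb0 negbK => /eqP.
set p := va st vP in pl pp H D e0 *.
have Rp : ar st kTr c p = ar st0 kTr c p by rewrite R ltnn !andbF.
have pgt : 0 < p.
  by rewrite lt0n; apply/eqP => p00; rewrite -e0 Rp p00 eqxx in tr0.
have pP : 0 < p < cnt by rewrite pgt.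
have [l1 l2 l3 l4] := t_link tP pP.
have pz : prefix (w p) z by apply: prefix_trans (pp pgt) p0z.
have lE : ar st kLink 0 p = link p by rewrite A // El.
(* Between [p] and its parent there is no node. *)
have gap x : 0 < x < cnt -> prefix (w x) (w p0) ->
    (tlen w (link p) < tlen w x) = (tlen w p < tlen w x) || (x == p).
  move=> xP xp; have [->|ne] /= := eqVneq x p; first by rewrite l2 orbT.
  rewrite orbF; apply/idP/idP; last by apply: ltn_trans.
  move=> lt; rewrite ltnNge; apply/negP => le.
  have sle : size (w x) <= size (w p) by move: le; rewrite !tlenS //; lia.
  have xp' := prefix_comparable xp (pp pgt) sle.
  have nw : w x != w p.
    by apply/eqP => E; rewrite (t_inj tP xP pP E) eqxx in ne.
  have := l4 _ (t_expl tP xP) xp' (prefix_size_lt xp' nw).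
  by move: lt; rewrite (tlenS w (x := x)); lia.
apply: wp_sq; apply: wp_sto.
  by rewrite /= VC cP Y2 (leq_trans pl).
have PP0 : 0 < PP by apply: leq_ltn_trans PP_gt.
apply: wp_asg; first by rewrite /= PP0 (leq_trans pl) // (leq_ltn_trans _ B_gt).
rewrite /= -/p lE Y1 VC; split; last by [].
split=> /=.
- by move=> y /negPf yP; rewrite yP; apply: V; rewrite yP.
- by move=> k q i /negPf kP; rewrite kP /=; apply: A; rewrite kP.
- move=> e x; rewrite R; case: (eqVneq e c) => [->|//] /=.
  have [->|ne] := eqVneq x p.
    by rewrite pP (pp pgt) l2.
  case xP: (0 < x < cnt) => //=; case xp: (prefix _ _) => //=.
  by rewrite gap // (negPf ne) orbF.
- by split=> // l0; apply: prefix_trans (l3 l0) (pp pgt).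
- split.
    move=> x xP xp; rewrite gap // => /orP[|/eqP->]; first exact: H.
    by rewrite -Rp.
  by rewrite addSnnS -(depth_link tP pP pz).
Qed.

Variable st0 : state.

Hypothesis inputP : forall j (c : 'I_sigma) z, drop j s = c :: z ->
  ar st0 kS 0 j = c.

Definition trans (st : state) (c : 'I_sigma) (x : nat) : nat := ar st kTr c x.

(** In [b_time], each symbol contributes one tick for the outer loop and at most 3 of potential; the
    extra 1 is the potential of the root. In [b_cnt], each symbol adds at most two nodes to node 0
    and the root. *)
Record built (i : nat) (st : state) : Prop := Built {
  b_n : va st vN = n;
  b_i : va st vI = i;
  b_in : i <= n;
  b_frame : forall k q x, (k == kS) || (kTr < k) -> ar st k q x = ar st0 k q x;
  b_tree : tree (drop i s) (va st vCnt) (wordat st) (ar st kLink 0) (trans st);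
  b_len : forall x, x < va st vCnt -> ar st kLen 0 x = tlen (wordat st) x;
  b_pos : forall x, x < va st vCnt -> ar st kPos 0 x < n;
  b_last : 0 < va st vLast < va st vCnt;
  b_lastw : wordat st (va st vLast) = drop i s;
  b_cnt : va st vCnt <= 2 * (n - i) + 2;
  b_time : tk st + depth (drop i s) (n - i).+1 <= 4 * (n - i) + 1
}.

(** The state after the first climb: the leaf is allocated and linked to, but has no parent yet. *)
Record headed (i : nat) (c : 'I_sigma) (st st' : state) : Prop := Headed {
  h_n : va st' vN = n;
  h_i : va st' vI = i;
  h_c : va st' vC = c;
  h_cur : va st' vCur = va st vCnt;
  h_cnt : va st' vCnt = (va st vCnt).+1;
  h_q : va st' vQ = trans st c (va st' vP);
  h_frame : forall k q x, (k == kS) || (k == kLink) || (kTr < k) ->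
    ar st' k q x = ar st k q x;
  h_len : forall x, ar st' kLen 0 x =
    if x == va st vCnt then (n - i).+1 else ar st kLen 0 x;
  h_pos : forall x, ar st' kPos 0 x =
    if x == va st vCnt then i else ar st kPos 0 x;
  h_tr : forall e x, ar st' kTr e x =
    if [&& e == c, 0 < x < va st vCnt, prefix (wordat st x) (drop i.+1 s)
         & tlen (wordat st) (va st' vP) < tlen (wordat st) x]
    then va st vCnt else ar st kTr e x;
  h_plt : va st' vP < va st vCnt;
  h_pre : 0 < va st' vP -> prefix (wordat st (va st' vP)) (drop i.+1 s);
  h_ptr : trans st c (va st' vP) != 0;
  h_max : forall x, 0 < x < va st vCnt ->
    prefix (wordat st x) (drop i.+1 s) ->
    tlen (wordat st) (va st' vP) < tlen (wordat st) x -> trans st c x = 0;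
  h_time : tk st' + depth (drop i.+1 s) (tlen (wordat st) (va st' vP)) =
    tk st + depth (drop i.+1 s) (n - i)
}.

Lemma PP_gt0 : 0 < PP. Proof. exact: leq_ltn_trans PP_gt. Qed.
Lemma B_gt0 : 0 < B. Proof. exact: leq_ltn_trans B_gt. Qed.

Lemma wordat_eq st st' x : ar st' kLen 0 x = ar st kLen 0 x ->
  ar st' kPos 0 x = ar st kPos 0 x -> wordat st' x = wordat st x.
Proof. by rewrite /wordat => -> ->. Qed.

Lemma wp_head i c st :
  drop i s = c :: drop i.+1 s -> built i.+1 st ->
  wp head_code (headed i c st) st.
Proof.
move=> Ez [Bn Bi Bin Bfr Bt Bl Bp Bla Blw Bc Btm].
have P0 := PP_gt0; have B0 := B_gt0.
have cntK : (va st vCnt).+1 < KN by lia.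
set cnt := va st vCnt in Bt Bl Bp Bla Bc cntK *.
apply: wp_sq; apply: wp_asg; first by rewrite /= Bi; lia.
rewrite [eval _ _]/= Bi subn1 /=.
apply: wp_sq; apply: wp_asg; first by rewrite /= P0 B0; lia.
rewrite [eval _ _]/= Bfr // (inputP Ez).
have Elast : ar st kLen 0 (va st vLast) = (n - i).
  case/andP: Bla => l0 lc; rewrite Bl // tlenS // Blw size_drop size_s; lia.
apply: wp_sq; apply: wp_sq; apply: wp_asg; first by [].
apply: wp_sq; apply: wp_asg; first by rewrite /= -/cnt; lia.
apply: wp_sq; apply: wp_sto.
  by rewrite /= -/cnt Elast P0 B0; case/andP: Bla => ? ?; lia.
apply: wp_sto; first by rewrite /= -/cnt P0 B0; lia.
apply: wp_sq; apply: wp_asg; first by [].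
rewrite /= Elast -/cnt.
set st1 := setv _ _ _.
have E1 x : x < cnt -> wordat st1 x = wordat st x.
  move=> xl; have xn : (x == cnt) = false by lia.
  by apply: wordat_eq; rewrite /st1 /= xn.
apply: wp_sq.
have tr0 : ar st1 kTr c 0 != 0.
  apply/eqP => t0; have c0 : 0 < cnt by lia.
  by have := tr_gt0 Bt c0 t0.
have lz : prefix (wordat st (va st vLast)) (drop i.+1 s).
  by rewrite Blw prefix_refl.
have cK : cnt <= KN by lia.
have ev st' : (forall y, y != vP -> va st' y = va st1 y) ->
    [/\ eval (Cst 0) st' = 0, safe B KN PP (Cst 0) st',
        eval (Var vCur) st' = cnt & safe B KN PP (Var vCur) st'].
  by move=> V; rewrite /= B0 V.
have Ep : va st1 vP = va st vLast by [].
have Ec : va st1 vC = c by [].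
have El x : 0 < x < cnt -> ar st1 kLink 0 x = ar st kLink 0 x by [].
apply: wp_mono (wp_climb Bt cK Bla lz Ep Ec ev tr0 El).
move=> st2 [[V A R [pl pp] [H D]] tn0]; apply: wp_asg.
  rewrite /= V //= (ltn_trans (ltn_ord c) PP_gt) /=.
  by apply: ltn_trans pl _; lia.
have Rp : ar st2 kTr c (va st2 vP) = ar st kTr c (va st2 vP).
  by rewrite R ltnn !andbF.
split; rewrite /= ?(V vN) ?(V vI) ?(V vC) ?(V vCur) ?(V vCnt) //=.
- by rewrite addn1.
- by move=> k q x kP; rewrite A ?/st1 /=; case: k kP => [|[|[|[|[|]]]]].
- by move=> x; rewrite A //= addn1.
- by move=> x; rewrite A.
- by move=> e x; rewrite R Blw.
- by rewrite Blw in pp.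
- by rewrite /trans -Rp.
- by move=> x xP xz lt; apply: H => //; rewrite Blw.
- move: D => /=; rewrite (tlenS _ (x := va st vLast)); last by case/andP: Bla.
  by rewrite Blw size_drop size_s => ->; congr (_ + depth _ _); lia.
Qed.

(** * Completing an insertion in either case *)

Section Finish.

Variables (i : nat) (c : 'I_sigma) (st st' : state).
Hypothesis Ez : drop i s = c :: drop i.+1 s.
Hypothesis bP : built i.+1 st.
Hypothesis hP : headed i c st st'.

Let z := drop i.+1 s.
Let w := wordat st.
Let p := va st' vP.
Let q := trans st c p.
Let cnt := va st vCnt.

Lemma i_lt : i < n. Proof. exact: b_in bP. Qed.

Lemma size_z : size z = n - i.+1. Proof. by rewrite size_drop size_s. Qed.

Lemma q_bounds : 0 < q < cnt.
Proof. by have := step_q (b_tree bP) (h_plt hP) (h_ptr hP). Qed.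

Lemma p_tlen : tlen w p <= (size z).+1.
Proof.
have [->//|p0] := posnP p.
by apply: (tree_tlen_lt (b_tree bP)); rewrite p0 (h_plt hP).
Qed.

Lemma head_len x : x < cnt -> ar st' kLen 0 x = tlen w x.
Proof. by move=> xl; rewrite (h_len hP) ltn_eqF // (b_len bP). Qed.

Lemma word_old st2 x : x < cnt -> ar st2 kLen 0 x = ar st' kLen 0 x ->
  ar st2 kPos 0 x = ar st' kPos 0 x -> wordat st2 x = w x.
Proof.
move=> xl El Ep; apply: wordat_eq.
  by rewrite El (h_len hP) ltn_eqF.
by rewrite Ep (h_pos hP) ltn_eqF.
Qed.

Lemma word_new st2 : ar st2 kLen 0 cnt = ar st' kLen 0 cnt ->
  ar st2 kPos 0 cnt = ar st' kPos 0 cnt -> wordat st2 cnt = c :: z.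
Proof.
move=> El Ep; rewrite /wordat El Ep (h_len hP) (h_pos hP) !eqxx -Ez /=.
by rewrite take_oversize // size_drop size_s.
Qed.

Lemma trans_tr1 e x : x < cnt ->
  (if [&& nat_of_ord e == c, 0 < x < cnt, prefix (w x) z & tlen w p < tlen w x]
   then cnt else ar st kTr e x) = tr1 c z cnt w (trans st) e x.
Proof.
move=> xl; have [->|x0] := posnP x; first by rewrite /tr1 andbF.
rewrite (tr1_eq (b_tree bP) (h_plt hP) (h_pre hP) (h_ptr hP) (h_max hP) e
  xl x0 erefl).
by rewrite xl.
Qed.

Lemma wp_nosplit :
  (tlen w p).+1 = tlen w q ->
  wp (Put kLink (Var vCur) (Var vQ))
     (fun st2 => built i (tick (setv st2 vLast (va st2 vCur)))) st'.
Proof.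
move=> Epq; have tP := b_tree bP; have il := i_lt; have qP := q_bounds.
have cntP := b_cnt bP; rewrite -/cnt in cntP.
apply: wp_sto.
  by rewrite /= PP_gt0 B_gt0 (h_cur hP) -/cnt; lia.
rewrite /= (h_cur hP) (h_q hP) -/p -/q -/cnt.
set F := tick _.
have wo x : x < cnt -> wordat F x = w x by move=> xl; apply: word_old.
have wn : wordat F cnt = c :: z by apply: word_new.
have szh : size (ext w c p) = size (w q).
  by rewrite size_ext; move: Epq; rewrite (tlenS w (x := q)); [case|lia].
split; rewrite ?Ez.
- by rewrite /= (h_n hP).
- by rewrite /= (h_i hP).
- exact: ltnW.
- move=> k r x kP; rewrite /= -(b_frame bP) //.
  have -> : (k == kLink) = false by lia.
  by rewrite /= (h_frame hP) //; lia.
- rewrite /= (h_cnt hP) -/cnt.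
  apply: (tree_step_nosplit tP (h_plt hP) (h_pre hP) (h_ptr hP) (h_max hP) szh).
  + exact: wo.
  + exact: wn.
  + by move=> x xl; rewrite /= ltn_eqF // (h_frame hP).
  + by rewrite /= eqxx.
  + by move=> e x xl; rewrite /trans /= (h_tr hP) trans_tr1.
  + move=> e x xl; rewrite /trans /= (h_tr hP) -/cnt.
    have -> : x < cnt = false by rewrite ltnNge xl.
    by rewrite !andbF; apply: (t_fresh tP).
- move=> x; rewrite /= (h_cnt hP) -/cnt ltnS leq_eqVlt => /orP[/eqP->|xl].
    rewrite (h_len hP) eqxx tlenS; last by lia.
    by rewrite wn /= size_z; lia.
  by rewrite head_len // /tlen wo.
- move=> x; rewrite /= (h_cnt hP) -/cnt (h_pos hP) ltnS leq_eqVlt -/cnt.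
  by case: eqP => // _ /= xl; apply: (b_pos bP).
- by rewrite /= (h_cnt hP) -/cnt; lia.
- by rewrite /= -/F wn.
- by rewrite /= (h_cnt hP) -/cnt; lia.
(* There is no second climb here, so [m] is taken at [p] and the range in which links must lead to
   [q] is empty. *)
- have D : depth (c :: z) (size z).+2 <= depth z (tlen w p) + 3.
    apply: (depth_step tP (h_plt hP) (h_pre hP) (h_ptr hP) (h_max hP) p_tlen).
    by move=> x _ _ /andP[lt le]; rewrite ltnNge le in lt.
  have := h_time hP; have := b_time bP; rewrite -/z -/w -/p.
  have E1 : (n - i.+1).+1 = n - i by lia.
  move: D; rewrite size_z E1 /= => D T1 T2.
  suff : tk st' + depth (c :: z) (n - i).+1 <= 4 * (n - i) by lia.
  have E2 : 4 * (n - i) = 4 * (n - i.+1) + 4 by lia.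
  rewrite E2; lia.
Qed.

Lemma wp_split :
  (tlen w p).+1 <> tlen w q ->
  wp (split_code sigma)
     (fun st2 => built i (tick (setv st2 vLast (va st2 vCur)))) st'.
Proof.
move=> Epq; have tP := b_tree bP; have il := i_lt; have qP := q_bounds.
have PP0 := PP_gt0; have B0 := B_gt0.
have cntP := b_cnt bP; rewrite -/cnt in cntP.
have pl : p < cnt := h_plt hP.
have szh : size (ext w c p) < size (w q).
  have [_ [_ /size_prefix hq _]] := t_tr1 tP pl (h_ptr hP).
  rewrite ltn_neqAle hq andbT size_ext; apply/eqP => E; apply: Epq.
  by rewrite E tlenS //; case/andP: qP.
have p0 : 0 < p := split_p0 tP pl (h_pre hP) (h_ptr hP) szh.
have Elp : ar st' kLen 0 p = tlen w p by rewrite head_len.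
have tpn : tlen w p <= n by have := p_tlen; rewrite size_z; lia.
apply: wp_sq; apply: wp_sq; apply: wp_asg; first by [].
apply: wp_sq; apply: wp_asg; first by rewrite /= (h_cnt hP) -/cnt; lia.
apply: wp_sq; apply: wp_sto.
  by rewrite /= (h_cnt hP) -/p -/cnt Elp PP0 B0; lia.
apply: wp_sto; first by rewrite /= PP0 B0 (h_cnt hP) -/cnt; lia.
rewrite /= (h_cnt hP) (h_i hP) -/p -/cnt Elp !addn1.
set st1 := seta _ _ _ _ _.
apply: wp_sq.
pose copied (l : seq nat) (st2 : state) :=
  [/\ va st2 =1 va st1, tk st2 = tk st1,
     forall k r x, k != kTr -> ar st2 k r x = ar st1 k r x
   & forall e x, ar st2 kTr e x =
       if (x == cnt.+1) && (e \in l) then ar st1 kTr e q else ar st1 kTr e x].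
apply: (wp_foreach (I := copied)).
- by split=> // e x; rewrite andbF.
- move=> done e rest st2 _; rewrite mem_iota add0n => /= es [V K A R].
  have V9 : va st2 vR = cnt.+1 by rewrite V.
  have V8 : va st2 vQ = q by rewrite V /= (h_q hP).
  apply: wp_sto; first by rewrite /= V9 V8; lia.
  rewrite /= V9 V8; split=> //=.
    by move=> k r x /negPf kP; rewrite kP /= A // kP.
  move=> e' x; rewrite !R mem_rcons inE.
  have -> : (q == cnt.+1) = false by lia.
  by case: (e' =P e) => [->|//]; case: (x =P cnt.+1) => [->|//].
move=> st2 [V K A R].
have Vl y : va st2 y = va st1 y by apply: V.
apply: wp_sq.
have V7 : va st2 vP = p by rewrite Vl.
have V3 : va st2 vC = c by rewrite Vl /= (h_c hP).
have V5 : va st2 vCur = cnt by rewrite Vl /= (h_cur hP).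
have V8 : va st2 vQ = q by rewrite Vl /= (h_q hP).
have V9 : va st2 vR = cnt.+1 by rewrite Vl.
have cK : cnt <= KN by lia.
have pP : 0 < p < cnt by rewrite p0.
have pz : prefix (w p) z := h_pre hP p0.
have ev st3 : (forall y, y != vP -> va st3 y = va st2 y) ->
    [/\ eval (Var vQ) st3 = q, safe B KN PP (Var vQ) st3,
        eval (Var vR) st3 = cnt.+1 & safe B KN PP (Var vR) st3].
  by move=> W; rewrite /= !W // V8 V9.
have R1 e x : x < cnt -> ar st2 kTr e x = ar st' kTr e x.
  by move=> xl; rewrite R; have -> : (x == cnt.+1) = false by lia.
have c0 : 0 < cnt by lia.
(* From node 0 every symbol leads to the root, and [q] is not the root because the head is strictly
   shorter than [w q]. *)
have tr0 : ar st2 kTr c 0 != q.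
  rewrite R1 // (h_tr hP) andbF /=.
  apply/negP => /eqP t0.
  have tn0 : trans st c 0 != 0 by rewrite /trans t0; lia.
  have [_] := t_tr1 tP c0 tn0; rewrite /trans t0 => -[_ _ hm].
  have /size_prefix H := hm [::] (expl_nil _) isT.
  by have := leq_trans szh H.
have El x : 0 < x < cnt -> ar st2 kLink 0 x = ar st kLink 0 x.
  by move=> _; rewrite A //= (h_frame hP).
apply: wp_mono (wp_climb tP cK pP pz V7 V3 ev tr0 El).
move=> st3 [[W A3 R3 [pl' pp'] [H D]] tq];
  set p' := va st3 vP in pl' pp' H D tq R3.
have A3' k r x : k != kTr -> ar st3 k r x = ar st1 k r x.
  by move=> kP; rewrite A3 // A.
have W8 : va st3 vQ = q by rewrite W.
have W9 : va st3 vR = cnt.+1 by rewrite W.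
have W5 : va st3 vCur = cnt by rewrite W.
apply: wp_sq; apply: wp_sto; first by rewrite /= ?W8 ?W9 PP0 B0; lia.
apply: wp_sq; apply: wp_sto; first by rewrite /= ?W8 ?W9 PP0 B0; lia.
apply: wp_sto; first by rewrite /= ?W5 ?W9 PP0 B0; lia.
rewrite /= W5 W8 W9.
set F := tick _.
have wo x : x < cnt -> wordat F x = w x.
  move=> xl; have xc : (x == cnt.+1) = false by lia.
  by apply: word_old => //=; rewrite A3' //= xc.
have cc : (cnt == cnt.+1) = false by lia.
have wn : wordat F cnt = c :: z.
  by apply: word_new => /=; rewrite A3' //= cc.
have lF : ar F kLen 0 cnt.+1 = (tlen w p).+1 by rewrite /= A3' //= eqxx.
have pF : ar F kPos 0 cnt.+1 = i by rewrite /= A3' //= eqxx.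
have wr : wordat F cnt.+1 = ext w c p.
  rewrite /wordat lF pF /= Ez; apply/esym/eqP.
  have : prefix (ext w c p) (c :: z) := head_prefix tP pl (h_pre hP) (h_ptr hP)
    (h_max hP).
  by rewrite prefixE size_ext eq_sym.
split; rewrite ?Ez.
- by rewrite /= W //= Vl /= (h_n hP).
- by rewrite /= W //= Vl /= (h_i hP).
- exact: ltnW.
- move=> k r x kP; rewrite /= -(b_frame bP) //.
  have -> : (k == kLink) = false by lia.
  rewrite /= A3'; last by lia.
  rewrite /=; have -> : (k == kPos) = false by lia.
  have -> : (k == kLen) = false by lia.
  by rewrite /= (h_frame hP) //; lia.
- have VC : va F vCnt = cnt.+2 by rewrite /= W //= Vl /=.
  rewrite VC.
  apply: (tree_step_split tP (h_plt hP) (h_pre hP) (h_ptr hP) (h_max hP) szh).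
  + exact: wo.
  + exact: wn.
  + exact: wr.
  + move=> x xl; rewrite /= ltn_eqF // -/q.
    case: eqP => // _; have -> : (x == cnt.+1) = false by lia.
    by rewrite /= A3' //= (h_frame hP).
  + by rewrite /= eqxx.
  + rewrite /= -/q; have -> : (cnt.+1 == cnt) = false by lia.
    have -> : (cnt.+1 == q) = false by lia.
    by rewrite eqxx A3' //= (h_frame hP).
  + move=> e x xl; have -> : trans F e x = ar st3 kTr e x by [].
    rewrite R3 R1 // (h_tr hP) -/w -/z -/cnt -/p trans_tr1 // /tr2 -/q.
    rewrite -[nat_of_ord e == c]/(e == c) xl andbT.
    case: (eqVneq e c) => [->|//] /=.
    case x0: (0 < x) => //=; case xp: (prefix (w x) (w p)) => //=.
    have xP : 0 < x < cnt by rewrite x0 xl.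
    have xle : tlen w x <= tlen w p.
      by rewrite !tlenS //; apply: size_prefix xp.
    have E1 : tr1 c z cnt w (trans st) c x = trans st c x.
      rewrite -trans_tr1 //; case: ifP => // /and4P[_ _ _]; lia.
    case: ltnP => [lt|le].
      have := H x xP xp lt.
      rewrite R1 // (h_tr hP) -/w -/z -/cnt -/p trans_tr1 // => ->.
      by rewrite eqxx.
    rewrite E1; case: (eqVneq (trans st c x) q) => // tx.
    have p'0 : 0 < p'.
      by rewrite lt0n; apply/eqP => p'0; move: le; rewrite p'0 tlenS.
    have p'P : 0 < p' < cnt by rewrite p'0.
    have xp' : prefix (w x) (w p').
      apply: prefix_comparable xp (pp' p'0) _.
      by move: le; rewrite !tlenS.
    (* A link to [q] left above the stopping point [p'] would force one at [p'], where the climb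
       found another value. *)
    have := locus_below tP pl (h_pre hP) (h_ptr hP) szh xP p'P xp' (pp' p'0) tx.
    have p'p : tlen w p' <= tlen w p.
      by rewrite !tlenS //; apply: size_prefix (pp' p'0).
    move: tq; rewrite R3 ltnn !andbF R1 // (h_tr hP) -/w -/z -/p.
    case: ifP => [/and4P[_ _ _]|_ /negP nq E]; first by lia.
    by case: nq; rewrite -/(trans st c p') E.
  + move=> e; rewrite /trans /= R3 ltnn !andbF R cc /= (h_tr hP).
    by rewrite -/cnt ltnn !andbF; apply: (t_fresh tP).
  + move=> e; rewrite /trans /= R3 -/cnt.
    have -> : (cnt.+1 < cnt) = false by lia.
    rewrite !andbF R eqxx mem_iota add0n ltn_ord /= (h_tr hP) trans_tr1 //.
    by case/andP: qP.
  + move=> e x xl; rewrite /trans /= R3 -/cnt.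
    have -> : (x < cnt) = false by lia.
    rewrite !andbF R; have -> : (x == cnt.+1) = false by lia.
    rewrite /= (h_tr hP) -/cnt; have -> : (x < cnt) = false by lia.
    by rewrite !andbF; apply: (t_fresh tP); rewrite -/cnt; lia.
- move=> x; have -> : va F vCnt = cnt.+2 by rewrite /= W //= Vl /=.
  rewrite ltnS leq_eqVlt => /orP[/eqP->|].
    by rewrite lF (tlenS _ (x := cnt.+1)) // wr size_ext.
  rewrite ltnS leq_eqVlt => /orP[/eqP->|xl].
    rewrite /= A3' //= cc (h_len hP) eqxx tlenS; last by lia.
    by rewrite wn /= size_z; lia.
  have xc : (x == cnt.+1) = false by lia.
  by rewrite /= A3' //= xc head_len // /tlen wo.
- move=> x; have -> : va F vCnt = cnt.+2 by rewrite /= W //= Vl /=.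
  rewrite ltnS leq_eqVlt => /orP[/eqP->|].
    by rewrite pF.
  rewrite ltnS leq_eqVlt => /orP[/eqP->|xl].
    by rewrite /= A3' //= cc (h_pos hP) eqxx.
  have xc : (x == cnt.+1) = false by lia.
  by rewrite /= A3' //= xc (h_pos hP) ltn_eqF //; apply: (b_pos bP).
- by rewrite /= W //= Vl /=; lia.
- by rewrite /= -/F wn.
- by rewrite /= W //= Vl /=; lia.
(* With [m] at the end [p'] of the second climb, the ticks of that climb are paid for by the drop of
   potential from [p] to [p']. *)
- have D1 : depth (c :: z) (size z).+2 <= depth z (tlen w p') + 3.
    apply: (depth_step tP (h_plt hP) (h_pre hP) (h_ptr hP) (h_max hP)).
      have [->//|p'0] := posnP p'.
      by apply: (tree_tlen_lt tP); rewrite p'0.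
    move=> x xP xz /andP[lt le].
    have x0 : 0 < x by case/andP: xP.
    have xl : x < cnt by case/andP: xP.
    have xp : prefix (w x) (w p).
      apply: prefix_comparable xz (h_pre hP p0) _.
      by move: le; rewrite !tlenS.
    have := H x xP xp lt; rewrite R1 // (h_tr hP) -/w -/z -/p.
    case: ifP => [/and4P[_ _ _]|_] //; lia.
  have := h_time hP; have := b_time bP; rewrite -/z -/w -/p.
  have E1 : (n - i.+1).+1 = n - i by lia.
  have K1 : tk st1 = tk st' by [].
  move: D1; rewrite size_z E1 /= => D1 T1 T2.
  suff : tk st3 + depth (c :: z) (n - i).+1 <= 4 * (n - i) by lia.
  have E2 : 4 * (n - i) = 4 * (n - i.+1) + 4 by lia.
  move: D; rewrite K K1 E2 -/z -/w; lia.
Qed.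

End Finish.

Lemma wp_insert i st : built i.+1 st ->
  wp (insert_code sigma) (fun st' => built i (tick st')) st.
Proof.
move=> bP; have il := b_in bP.
have [c Ez] : exists c, drop i s = c :: drop i.+1 s.
  move Ed: (drop i s) => [|c z].
    by have := congr1 size Ed; rewrite size_drop size_s /=; lia.
  by exists c; rewrite -[i.+1]add1n -drop_drop Ed /= drop0.
apply: wp_sq; apply: wp_mono (wp_head Ez bP) => st' hP.
have pl := h_plt hP; have qP := q_bounds bP hP.
have PP0 := PP_gt0; have B0 := B_gt0; have cntP := b_cnt bP.
have Elp := head_len bP hP pl.
have Elq : ar st' kLen 0 (va st' vQ) = tlen (wordat st) (va st' vQ).
  by apply: (head_len bP hP); rewrite (h_q hP); case/andP: qP.
have tpn := p_tlen bP hP; have szz := size_z i.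
have Ec : eval (Op OEq (Op OAdd (Get kLen (Var vP)) (Cst 1))
    (Get kLen (Var vQ))) st' =
  ((tlen (wordat st) (va st' vP)).+1 == tlen (wordat st) (va st' vQ)).
  by rewrite /= Elp Elq addn1.
apply: wp_sq; apply: wp_mono (_ : wp _ (fun st2 =>
  built i (tick (setv st2 vLast (va st2 vCur)))) st').
  by move=> st2 b2; apply: wp_asg.
apply: wp_ite.
- rewrite /= (h_q hP) Elp PP0 B0; lia.
- rewrite Ec (h_q hP) eqb0 negbK => /eqP E.
  exact: wp_nosplit Ez bP hP E.
- rewrite Ec (h_q hP) => /eqP; rewrite eqb0 => /eqP E.
  exact: wp_split Ez bP hP E.
Qed.

Lemma wp_build : st0 = State (va st0) (ar st0) 0 -> va st0 vN = n ->
  (forall k q x, k != kS -> ar st0 k q x = 0) ->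
  wp (build_code sigma) (built 0) st0.
Proof.
move=> t0 vn z0.
have PP0 := PP_gt0; have B0 := B_gt0.
pose I (l : seq nat) (st : state) :=
  [/\ va st =1 va st0, tk st = 0 & forall k q x, ar st k q x =
     if [&& k == kTr, x == 0 & q \in l] then 1 else ar st0 k q x].
apply: wp_sq; apply: (wp_foreach (I := I)).
- by split=> //; [rewrite t0 | move=> k q x; rewrite !andbF].
- move=> done e rest st _; rewrite mem_iota add0n => /= es [V K A].
  apply: wp_sto; first by rewrite /=; lia.
  split=> //= k q x; rewrite A mem_rcons inE.
  case: (k =P kTr) => //= _; case: (q =P e) => [->|_]; case: (x =P 0) => //= ->.
move=> st [V K A].
apply: wp_sq; apply: wp_sto; first by rewrite /=; lia.
apply: wp_sq; apply: wp_asg; first by rewrite /=; lia.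
apply: wp_sq; apply: wp_asg; first by rewrite /=; lia.
apply: wp_sq; apply: wp_asg; first by [].
rewrite /= V vn.
set st1 := setv _ _ _.
have A1 k q x : k != kTr -> k != kLen -> ar st1 k q x = ar st0 k q x.
  by move=> /negPf k1 /negPf k2; rewrite /= k2 A k1.
have T1 e x : trans st1 e x = (x == 0).
  rewrite /trans /= A /= mem_iota add0n ltn_ord andbT z0 //.
  by case: (x == 0).
have L1 x : ar st1 kLen 0 x = (x == 1).
  by rewrite /= A /= z0 //; case: (x == 1).
have W1 x : wordat st1 x = [::].
  by rewrite /wordat L1; case: (x == 1); rewrite take0.
have dn : drop n s = [::] by rewrite -size_s drop_size.
apply: (@wp_whl _ _ _ (fun st => built (va st vI) st) (fun st => va st vI)).
- split=> //.
  + by rewrite /= V.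
  + move=> k q x kP; apply: A1; lia.
  + rewrite [va st1 vI]/= dn.
    have ex0 u : expl [::] u -> u = [::] by move=> /expl_size; case: u.
    split=> //.
    * move=> x _; rewrite W1; exact: expl_nil.
    * by move=> u /ex0->; exists 1.
    * by move=> x y /=; lia.
    * move=> x xP; have -> : x = 1 by move: xP => /=; lia.
      have -> : ar st1 kLink 0 1 = 0 by rewrite A1 // z0.
      by split=> //; rewrite ?W1.
    * move=> e x xl; rewrite T1; case: posnP => [_ //|x0 _] u /ex0->.
      by rewrite /ext; have -> : (x == 0) = false by lia.
    * move=> e x xl; rewrite T1; case: (x =P 0) => [->|//] _.
      by split=> //; rewrite W1 /ext /=; split=> //; apply: expl_nil.
    * by move=> e x; rewrite T1; case: x.
  + by move=> [|[|x]] xl //; rewrite L1 /tlen W1.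
  + by move=> x _; rewrite A1 // z0.
  + by rewrite [va st1 vI]/= dn W1.
  + by rewrite [va st1 vI]/= /=; lia.
  + rewrite [va st1 vI]/= dn subnn /= /depth big_ord_recl big_ord0 K.
    by case: (expl _ _).
- by [].
- by move=> st2 b2 /= e0; rewrite e0 in b2.
- move=> st2 b2 /= en0.
  have Ei : va st2 vI = (va st2 vI).-1.+1 by rewrite prednK // lt0n.
  rewrite Ei in b2; apply: wp_mono (wp_insert b2) => st3 b3.
  have E3 := b_i b3; rewrite /= in E3; rewrite /= E3; split=> //.
  by rewrite [X in _ < X]Ei.
Qed.

End Build.

(** * Children and breadth-first order *)

Notation vH := 10 (only parsing).
Notation vT := 11 (only parsing).
Notation vX := 12 (only parsing).
Notation vY := 13 (only parsing).

Notation kCh := 5 (only parsing).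
Notation kOrd := 6 (only parsing).

(** The first symbol on the edge to a node follows an occurrence of the parent at the start of the
    node; the subtracted 1 is the offset of [kLen]. *)
Definition child_code : cmd :=
  Asg vI (Cst 2) ;;
  Whl (Op OLt (Var vI) (Var vCnt))
    (Asg vP (Get kLink (Var vI)) ;;
     Sto kCh
       (Get kS (Op OSub (Op OAdd (Get kPos (Var vI)) (Get kLen (Var vP)))
                  (Cst 1)))
       (Var vP) (Var vI) ;;
     Asg vI (Op OAdd (Var vI) (Cst 1))).

(** [kOrd] is the queue and, once it is exhausted, the list of all nodes with parents before
    children. *)
Definition bfs_code (sigma : nat) : cmd :=
  Put kOrd (Cst 0) (Cst 1) ;;
  Asg vH (Cst 0) ;;
  Asg vT (Cst 1) ;;
  Whl (Op OLt (Var vH) (Var vT))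
    (Asg vX (Get kOrd (Var vH)) ;;
     foreach (iota 0 sigma) (fun e =>
       Asg vY (Ld kCh (Cst e) (Var vX)) ;;
       Ite (Var vY)
         (Put kOrd (Var vT) (Var vY) ;; Asg vT (Op OAdd (Var vT) (Cst 1)))
         Skip) ;;
     Asg vH (Op OAdd (Var vH) (Cst 1))).

(** * Trees given by child tables, and their traversal *)

Section ChildTree.

Variable sigma : nat.
Implicit Types (s : seq 'I_sigma) (w : nat -> seq 'I_sigma).

Record ctree s (cnt : nat) w (ch : nat -> nat -> nat) : Prop := Ctree {
  c_cnt : 1 < cnt;
  c_root : w 1 = [::];
  c_expl : forall x, 0 < x < cnt -> expl s (w x);
  c_surj : forall u, expl s u -> exists2 x, 0 < x < cnt & w x = u;
  c_inj : forall x y, 0 < x < cnt -> 0 < y < cnt -> w x = w y -> x = y;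
  c_child : forall x (e : 'I_sigma), 0 < x < cnt -> ch e x != 0 ->
    1 < ch e x < cnt /\ is_locus s (rcons (w x) e) (w (ch e x));
  c_child0 : forall x (e : 'I_sigma), 0 < x < cnt -> ch e x = 0 ->
    forall u, expl s u -> ~~ prefix (rcons (w x) e) u;
  c_parent : forall y, 1 < y < cnt ->
    exists x, exists e : 'I_sigma, 0 < x < cnt /\ ch e x = y
}.

Lemma prefix_rcons_lt (T : eqType) (u v : seq T) : prefix u v -> u != v ->
  exists e, prefix (rcons u e) v.
Proof.
move=> /prefixP[[|e x] ->]; first by rewrite cats0 eqxx.
by exists e; rewrite -cat_rcons prefix_prefix.
Qed.

Variables (s : seq 'I_sigma) (cnt : nat) (w : nat -> seq 'I_sigma).
Variables (ch : nat -> nat -> nat).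
Hypothesis cP : ctree s cnt w ch.

Lemma child_size x (e : 'I_sigma) : 0 < x < cnt -> ch e x != 0 ->
  size (w x) < size (w (ch e x)).
Proof.
by move=> xP /(c_child cP xP)[_ [_ /size_prefix]]; rewrite size_rcons.
Qed.

(** If the parents differed, the longer one would lie strictly inside the edge from the shorter one
    to the common child. *)
Lemma child_inj x x' (e e' : 'I_sigma) : 0 < x < cnt -> 0 < x' < cnt ->
  ch e x != 0 -> ch e x = ch e' x' -> x = x' /\ e = e'.
Proof.
move=> + + + E.
wlog le : x x' e e' E / size (w x) <= size (w x') => [H xP x'P n0|].
  have [le|lt] := leqP (size (w x)) (size (w x')); first exact: H.
  by have [|-> ->] // := H x' x e' e (esym E) (ltnW lt) x'P xP; rewrite -E.
move=> xP x'P n0.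
have [yP [Ey xy ymin]] := c_child cP xP n0.
have n0' : ch e' x' != 0 by rewrite -E.
have [_ [_ x'y _]] := c_child cP x'P n0'.
rewrite -E in x'y.
have Ew : w x = w x'.
  have xx' : prefix (w x) (w x').
    apply: prefix_comparable le;
      last exact: prefix_trans (prefix_rcons _ _) x'y.
    exact: prefix_trans (prefix_rcons _ _) xy.
  apply/eqP/negPn/negP => ne; have lt := prefix_size_lt xx' ne.
  have x'y' := prefix_trans (prefix_rcons _ _) x'y.
  have /size_prefix : prefix (w (ch e x)) (w x').
    apply: ymin; first exact: (c_expl cP).
    by apply: prefix_comparable xy x'y' _; rewrite size_rcons.
  by have := size_prefix x'y; rewrite size_rcons; lia.
split; first exact: (c_inj cP).
move: xy x'y; rewrite !prefixE !size_rcons Ew => /eqP-> /eqP.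
by move/rcons_inj=> [].
Qed.

Lemma child_ne1 x (e : 'I_sigma) : 0 < x < cnt -> ch e x <> 1.
Proof.
move=> xP E; have n0 : ch e x != 0 by rewrite E.
by have [+ _] := c_child cP xP n0; rewrite E.
Qed.

Definition children (x : nat) (es : seq nat) : seq nat :=
  [seq ch e x | e <- es & ch e x != 0].

Lemma childrenP x y : reflect (exists2 e : 'I_sigma, ch e x != 0 & y = ch e x)
  (y \in children x (iota 0 sigma)).
Proof.
apply: (iffP mapP) => [[e]|[e n0 ->]]; last first.
  by exists (nat_of_ord e) => //; rewrite mem_filter n0 mem_iota add0n /=.
rewrite mem_filter mem_iota add0n /= => /andP[n0 es] ->.
by exists (Ordinal es).
Qed.

(** [l] lists all nodes enqueued so far, of which the first [h] have been expanded. The bound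
    [minn h j] says that the parent has been expanded and also stands before its child. *)
Record bfs_inv (h : nat) (l : seq nat) : Prop := BfsInv {
  bi_uniq : uniq l;
  bi_mem : forall x, x \in l -> 0 < x < cnt;
  bi_root : nth 0 l 0 = 1;
  bi_size : 0 < size l;
  bi_h : h <= size l;
  bi_parent : forall j, j < size l -> nth 0 l j <> 1 ->
    exists x, exists e : 'I_sigma, x \in take (minn h j) l /\ ch e x = nth 0 l
      j;
  bi_child : forall x (e : 'I_sigma), x \in take h l -> ch e x != 0 ->
    ch e x \in l
}.

Lemma bfs_inv0 : bfs_inv 0 [:: 1].
Proof.
split=> //.
  by move=> x; rewrite inE => /eqP->; rewrite (c_cnt cP).
by case.
Qed.

Lemma bfs_size h l : bfs_inv h l -> size l < cnt.
Proof.
move=> H; have := uniq_leq_size (bi_uniq H) (s2 := iota 1 cnt.-1).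
rewrite size_iota; have := c_cnt cP => c1 /(_ _); rewrite -ltnS prednK;
  last by lia.
apply=> x /(bi_mem H) xP; rewrite mem_iota; lia.
Qed.

(** The appended children are new: a node has one parent, and entry [h] had not been expanded. *)
Lemma bfs_step h l : bfs_inv h l -> h < size l ->
  bfs_inv h.+1 (l ++ children (nth 0 l h) (iota 0 sigma)).
Proof.
move=> H hl; set x := nth 0 l h; set l' := children _ _.
have xl : x \in l by apply: mem_nth.
have xP := bi_mem H xl.
have xnot : x \notin take h l.
  have := bi_uniq H; rewrite -{1}(cat_take_drop h l) cat_uniq.
  case/and3P=> _ /hasPn H1 _; apply: H1.
  by rewrite (drop_nth 0 hl) inE eqxx.
split.
- rewrite cat_uniq (bi_uniq H) /=; apply/andP; split.
    apply/hasPn => y /childrenP[e n0 Ey]; apply/negP => yl.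
    have Ej := nth_index 0 yl; set j := index y l in Ej.
    have jl : j < size l by rewrite index_mem.
    have ne : nth 0 l j <> 1 by rewrite Ej Ey; apply: (child_ne1 xP).
    have [x' [e' [x't Ex']]] := bi_parent H jl ne.
    have x'h : x' \in take h l.
      have : take (minn h j) l = take (minn h j) (take h l).
        by rewrite take_takel // geq_minl.
      by move=> E; rewrite E in x't; apply: mem_take x't.
    have x'P := bi_mem H (mem_take x'h).
    have [E _] : x = x' /\ e = e'.
      by apply: child_inj => //; rewrite -Ey -Ej.
    by rewrite E x'h in xnot.
  rewrite map_inj_in_uniq ?filter_uniq ?iota_uniq // => e e'.
  rewrite !mem_filter !mem_iota !add0n /= => /andP[n0 es] /andP[n0' es'] E.
  by have [_ /(congr1 val)] := @child_inj x x (Ordinal es) (Ordinal es') xP xP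
    n0 E.
- move=> y; rewrite mem_cat => /orP[/(bi_mem H)//|/childrenP[e n0 ->]].
  by have [yP _] := c_child cP xP n0; lia.
- by rewrite nth_cat (bi_size H) (bi_root H).
- by rewrite size_cat; have := bi_size H; lia.
- by rewrite size_cat; lia.
- move=> j; rewrite size_cat nth_cat => jl; case: ltnP => [jl1|jl1] ne.
    have [x' [e' [x't Ex']]] := bi_parent H jl1 ne.
    exists x', e'; split=> //; rewrite takel_cat;
      last by rewrite geq_min (ltnW jl1) orbT.
    have E : take (minn h j) l = take (minn h j) (take (minn h.+1 j) l).
      by rewrite take_takel // leq_min geq_minr andbT (leq_trans (geq_minl _
        _)).
    by rewrite E in x't; apply: mem_take x't.
  have : nth 0 l' (j - size l) \in l' by rewrite mem_nth // ltn_subLR.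
  case/childrenP => e n0 ->; exists x, e; split=> //.
  rewrite (minn_idPl _); last by lia.
  by rewrite takel_cat // (take_nth 0 hl) mem_rcons inE eqxx.
- move=> y e; rewrite takel_cat // (take_nth 0 hl) mem_rcons inE.
  case/orP=> [/eqP->|yt] n0; rewrite mem_cat; last by rewrite (bi_child H).
  by apply/orP; right; apply/childrenP; exists e.
Qed.

Record bfs_order (l : seq nat) : Prop := BfsOrder {
  bo_uniq : uniq l;
  bo_mem : forall x, (x \in l) = (0 < x < cnt);
  bo_child : forall j (e : 'I_sigma), j < size l -> ch e (nth 0 l j) != 0 ->
    exists2 k, j < k < size l & nth 0 l k = ch e (nth 0 l j);
  bo_parent : forall k, k < size l -> nth 0 l k <> 1 ->
    exists2 j, j < k & exists e : 'I_sigma, ch e (nth 0 l j) = nth 0 l k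
}.

(** Every node is reached, by induction on its length through its parent. *)
Lemma bfs_done l : bfs_inv (size l) l -> bfs_order l.
Proof.
move=> H; have Et : take (size l) l = l by rewrite take_size.
have par k : k < size l -> nth 0 l k <> 1 ->
    exists2 j, j < k & exists e : 'I_sigma, ch e (nth 0 l j) = nth 0 l k.
  move=> kl /(bi_parent H kl)[x [e [xt Ex]]].
  rewrite (minn_idPr (ltnW kl)) in xt.
  exists (index x (take k l)).
    by rewrite -[X in _ < X](size_takel (ltnW kl)) index_mem.
  exists e; rewrite -Ex -(nth_take 0 (n0 := k)) ?nth_index //.
  by rewrite -[X in _ < X](size_takel (ltnW kl)) index_mem.
split=> //.
- exact: bi_uniq H.
- move=> x; apply/idP/idP => [/(bi_mem H)//|].
  have [m] := ubnP (size (w x)); elim: m x => // m IH x szx xP.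
  have [->|x1] := x =P 1.
    by rewrite -(bi_root H); apply: mem_nth; apply: bi_size H.
  have xP1 : 1 < x < cnt by lia.
  have [y [e [yP Ey]]] := c_parent cP xP1.
  have n0 : ch e y != 0 by rewrite Ey; lia.
  rewrite -Ey; apply: (bi_child H) => //; rewrite Et; apply: IH => //.
  by have := child_size yP n0; rewrite Ey; lia.
- move=> j e jl n0; set x := nth 0 l j in n0 *.
  have xl : x \in l by apply: mem_nth.
  have xP := bi_mem H xl.
  have yl : ch e x \in l by apply: (bi_child H); rewrite ?Et.
  exists (index (ch e x) l); last exact: nth_index.
  rewrite index_mem yl andbT.
  have kl : index (ch e x) l < size l by rewrite index_mem.
  have ne : nth 0 l (index (ch e x) l) <> 1.
    by rewrite nth_index //; apply: (child_ne1 xP).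
  have [i ik [e' Ei]] := par _ kl ne; rewrite nth_index // in Ei.
  have il : i < size l by apply: ltn_trans ik kl.
  have [E _] : x = nth 0 l i /\ e = e'.
    by apply: child_inj => //; apply: (bi_mem H); apply: mem_nth.
  suff -> : j = i by [].
  by apply/eqP; rewrite -(nth_uniq 0 jl il (bi_uniq H)) -/x E.
Qed.

End ChildTree.

(** * Correctness of the child table and of the traversal *)

Section Walk.

Variables (sigma : nat) (s : seq 'I_sigma) (n B KN PP : nat).

Hypothesis size_s : size s = n.
Hypothesis s_gt0 : 0 < n.
Hypothesis KN_ge : 2 * n + 2 <= KN.
Hypothesis B_gt : KN < B.
Hypothesis PP_lt : PP < B.
Hypothesis PP_gt : sigma < PP.

Local Notation wp := (wp B KN PP).

Variable st0 : state.

Hypothesis inputP : forall j (c : 'I_sigma) z, drop j s = c :: z ->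
  ar st0 kS 0 j = c.

Section Child.

Variable st : state.
Hypothesis bP : built s n st0 0 st.
Hypothesis childless : forall e x, ar st0 kCh e x = 0.

Let cnt := va st vCnt.
Let w := wordat s st.
Let link := ar st kLink 0.

Let tP : tree s cnt w link (trans st).
Proof. by have := b_tree bP; rewrite drop0. Qed.

Definition sym (y : nat) : nat :=
  ar st kS 0 (ar st kPos 0 y + ar st kLen 0 (link y) - 1).

Lemma link_gt0 y : 1 < y < cnt -> 0 < link y < cnt.
Proof.
move=> /andP[y1 yc]; have yP : 0 < y < cnt by rewrite yc ltnW.
have [l1 l2 _ l4] := t_link tP yP; rewrite l1 andbT.
have oneP : 0 < 1 < cnt by have := t_cnt tP.
have ne : [::] != w y.
  rewrite -(t_root tP); apply/eqP => /(t_inj tP oneP yP); lia.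
have := l4 [::] (expl_nil s) (prefix0s _); rewrite /tlen lt0n.
by case: eqP => //= _; case: (w y) ne => // _ _ _ /(_ isT).
Qed.

Lemma symP y : 1 < y < cnt ->
  exists2 e : 'I_sigma, sym y = e & prefix (rcons (w (link y)) e) (w y).
Proof.
move=> yP1; have lP := link_gt0 yP1; have /andP[y1 yc] := yP1.
have yP : 0 < y < cnt by rewrite yc ltnW.
have /andP[l0 lc] := lP.
have [_ l2 /(_ l0) l3 _] := t_link tP yP.
have ne : w (link y) != w y.
  by apply/eqP => E; move: l2; rewrite !tlenS ?E ?ltnn //; lia.
have [e eP] := prefix_rcons_lt l3 ne; exists e => //.
have Ed : drop (ar st kPos 0 y + size (w (link y))) s =
    e :: drop (ar st kPos 0 y + size (w (link y))).+1 s.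
  have : prefix (rcons (w (link y)) e) (drop (ar st kPos 0 y) s).
    by apply: prefix_trans eP _; apply: prefix_take.
  move=> /prefixP[x Ex]; rewrite addnC -addSn -!drop_drop Ex -cats1 -catA.
  by rewrite -[(size _).+1]add1n -drop_drop !drop_size_cat //= drop0.
rewrite /sym (b_len bP lc) tlenS // addnS subn1 /= -(inputP Ed).
by rewrite (b_frame bP).
Qed.

(** Otherwise the longest common prefix of the two words would be a node strictly between the parent
    and one of them. So no entry of the table is written twice. *)
Lemma link_sym_inj y y' : 1 < y < cnt -> 1 < y' < cnt ->
  link y = link y' -> sym y = sym y' -> y = y'.
Proof.
wlog le : y y' / size (w y) <= size (w y') => [H yP y'P|].
  have [le|lt] := leqP (size (w y)) (size (w y')); first exact: H.
  by move=> El Es; apply/esym/H => //; apply: ltnW.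
move=> yP1 y'P1 El Es; have [e Ee eP] := symP yP1.
have [e' Ee' eP'] := symP y'P1.
have {Ee'}Eee : e' = e by apply: val_inj; rewrite /= -Ee' -Ee.
rewrite Eee -El in eP'.
have yP : 0 < y < cnt by lia.
have y'P : 0 < y' < cnt by lia.
apply: (t_inj tP) => //.
set m := lcp (w y) (w y').
have Em : expl s m by apply: expl_lcp; apply: (t_expl tP).
have em : prefix (rcons (w (link y)) e) m by rewrite prefix_lcp eP.
have szm := size_prefix em; rewrite size_rcons in szm.
have l0 : 0 < link y by case/andP: (link_gt0 yP1).
have H x : 0 < x < cnt -> link x = link y -> prefix m (w x) -> m = w x.
  move=> xP Elx mx; apply/eqP/negPn/negP => ne.
  have [_ _ _ l4] := t_link tP xP.
  have := l4 _ Em mx (prefix_size_lt mx ne); rewrite Elx tlenS //; lia.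
rewrite -(H y) ?lcp_prefixl //.
by apply: H => //; rewrite ?lcp_prefixr.
Qed.

Record childed (st' : state) : Prop := Childed {
  ch_va : forall x, x \notin [:: vI; vP] -> va st' x = va st x;
  ch_ar : forall k q x, k != kCh -> ar st' k q x = ar st k q x;
  ch_tree : ctree s cnt w (ar st' kCh);
  ch_tk : tk st' <= tk st + cnt
}.

Lemma wp_child : wp child_code childed st.
Proof.
have cnt2 := t_cnt tP.
have PP0 := PP_gt0 PP_gt; have B0 := B_gt0 B_gt.
have cntK : cnt <= 2 * n + 2 by have := b_cnt bP; rewrite subn0.
apply: wp_sq; apply: wp_asg; first by rewrite /=; lia.
set st1 := setv _ _ _.
pose I (st' : state) :=
  [/\ forall x, x \notin [:: vI; vP] -> va st' x = va st x,
      forall k q x, k != kCh -> ar st' k q x = ar st k q x,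
      1 < va st' vI <= cnt /\ tk st' + 2 = tk st + va st' vI,
      forall e x, ar st' kCh e x != 0 -> let y := ar st' kCh e x in
        [/\ 1 < y < va st' vI, link y = x & sym y = e]
    & forall y, 1 < y < va st' vI -> ar st' kCh (sym y) (link y) = y].
apply: (@wp_whl _ _ _ I (fun st' => cnt - va st' vI)).
- split=> //=.
  + by move=> x; rewrite !inE negb_or => /andP[/negPf->].
  + by move=> e x; rewrite (b_frame bP) //= childless.
  + by move=> y; lia.
- by move=> st' [V _ _ _ _] /=; lia.
- move=> st' [V A [m1 Et] F1 F2]; rewrite /= (V vCnt) // -/cnt => /eqP.
  rewrite eqb0 -leqNgt => m2.
  have Em : va st' vI = cnt by lia.
  rewrite Em in F1 F2 Et.
  split=> //; last by lia.
  split=> //.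
  + exact: t_root tP.
  + exact: t_expl tP.
  + exact: t_surj tP.
  + exact: t_inj tP.
  + move=> x e xP n0; have [yP El Es] := F1 _ _ n0; split=> //.
    set y := ar st' _ _ _ in yP El Es *.
    have [e' Ee' eP] := symP yP.
    have {Ee'}Eee : e' = e by apply: val_inj; rewrite /= -Ee' -Es.
    rewrite Eee El in eP.
    have yP0 : 0 < y < cnt by lia.
    have Ey := t_expl tP yP0.
    split=> // u Eu xu.
    have Em' : expl s (lcp (w y) u) by apply: expl_lcp.
    suff -> : w y = lcp (w y) u by apply: lcp_prefixr.
    apply/eqP/negPn/negP; rewrite eq_sym => ne.
    have [_ _ _ l4] := t_link tP yP0.
    have := l4 _ Em' (lcp_prefixl _ _) (prefix_size_lt (lcp_prefixl _ _) ne).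
    rewrite El tlenS; last by case/andP: xP.
    have : prefix (rcons (w x) e) (lcp (w y) u) by rewrite prefix_lcp eP.
    by move/size_prefix; rewrite size_rcons; lia.
  (* From a node [u] that extends [rcons (w x) e] the parents lead up to a child of [x] on [e],
     whose table entry is not 0. *)
  + move=> x e xP t0 u; have [m] := ubnP (size u).
    elim: m u => // m IH u szu Eu; apply/negP => xu.
    have [y yP0 Ewy] := t_surj tP Eu.
    have yP : 1 < y < cnt.
      case: (y =P 1) => [E|]; last by lia.
      by move: xu; rewrite -Ewy E (t_root tP); case: (w x).
    have lP := link_gt0 yP; have /andP[l0 _] := lP.
    have [_ l2 /(_ l0) l3 l4] := t_link tP yP0.
    rewrite !tlenS ?Ewy in l2 l4; try lia.
    rewrite Ewy in l3.
    have szxu := size_prefix xu; rewrite size_rcons in szxu.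
    have xu' := prefix_trans (prefix_rcons (w x) e) xu.
    have := l4 _ (t_expl tP xP) xu' szxu.
    rewrite ltnS leq_eqVlt => /orP[/eqP szx|lt]; last first.
      have := IH (w (link y)) _ (t_expl tP lP) => /(_ _)/negP; apply;
        first by lia.
      by apply: prefix_comparable xu l3 _; rewrite size_rcons.
    have Ex : x = link y.
      by apply: (t_inj tP) => //;
        apply: (prefix_eq_size (prefix_comparable xu' l3 _)); rewrite szx.
    have [e' Ee' eP] := symP yP.
    have Eee : e' = e.
      move: eP xu; rewrite Ewy -Ex !prefixE !size_rcons => /eqP-> /eqP.
      by move/rcons_inj=> [].
    by move: (F2 _ yP); rewrite Ee' Eee -Ex t0; lia.
  + move=> y yP; exists (link y).
    have [e Ee _] := symP yP; exists e; split; first exact: link_gt0.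
    by rewrite -Ee F2.
- move=> st' [V A [m1 Et] F1 F2]; rewrite /= (V vCnt) // -/cnt eqb0 negbK => m2.
  set m := va st' vI in m1 Et F1 F2 m2 *.
  have mP : 1 < m < cnt by lia.
  have lP := link_gt0 mP.
  have [e Ee eP] := symP mP.
  have lE : ar st' kLink 0 m = link m by rewrite A.
  have szl : ar st' kLen 0 (link m) = tlen w (link m).
    by rewrite A // (b_len bP) //; case/andP: lP.
  have posE : ar st' kPos 0 m < n by rewrite A //; apply: (b_pos bP); lia.
  apply: wp_sq; apply: wp_asg; first by rewrite /= -/m PP0 B0; lia.
  rewrite /= -/m lE.
  have lK : link m < KN by lia.
  have szw : size (w (link m)) <= n.
    by rewrite -size_s; apply: expl_size; apply: (t_expl tP).
  have lS : tlen w (link m) = (size (w (link m))).+1 by rewrite tlenS //; lia.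
  have lt1 : ar st' kPos 0 m + ar st' kLen 0 (link m) - 1 < KN by lia.
  have symE : ar st' kS 0 (ar st' kPos 0 m + ar st' kLen 0 (link m) - 1) = e.
    by rewrite !A // -Ee.
  apply: wp_sq; apply: wp_sto.
    rewrite /= -/m symE PP0 B0 (ltn_trans (ltn_ord e) PP_gt) lK lt1 szl lS.
    by rewrite -/m; lia.
  rewrite /= -/m symE -Ee.
  apply: wp_asg; first by rewrite /= -/m; lia.
  rewrite /= -/m addn1; split; last by lia.
  split=> //=.
  + by move=> x xP; rewrite -(V x) //; move: xP;
      rewrite !inE negb_or => /andP[/negPf-> /negPf->].
  + by move=> k q x kP; rewrite (negPf kP) A.
  + by split; lia.
  + move=> e' x; case: ifP => [/andP[/eqP-> /eqP->] _|_ n0].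
      by split=> //; lia.
    by have [? ? ?] := F1 _ _ n0; split=> //; lia.
  + move=> y yP; case: ifP => [/andP[/eqP Es /eqP El]|ne].
      by apply: link_sym_inj => //; lia.
    apply: F2; case: (y =P m) => [Ey|]; last by lia.
    by rewrite Ey !eqxx in ne.
Qed.

End Child.

Section Bfs.

Variables (st : state) (cnt : nat) (w : nat -> seq 'I_sigma).
Hypothesis cP : ctree s cnt w (ar st kCh).
Hypothesis cntP : cnt <= KN.

Record listed (l : seq nat) (st' : state) : Prop := Listed {
  li_va : forall x, x \notin [:: vH; vT; vX; vY] -> va st' x = va st x;
  li_ar : forall k q x, k != kOrd -> ar st' k q x = ar st k q x;
  li_order : forall j, j < size l -> ar st' kOrd 0 j = nth 0 l j;
  li_size : va st' vT = size l
}.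

Lemma wp_bfs : wp (bfs_code sigma) (fun st' => exists l,
   [/\ listed l st', bfs_order sigma cnt (ar st kCh) l & tk st' <= tk st +
     cnt]) st.
Proof.
have PP0 := PP_gt0 PP_gt; have B0 := B_gt0 B_gt.
apply: wp_sq; apply: wp_sto; first by rewrite /= PP0 B0; lia.
apply: wp_sq; apply: wp_asg; first by rewrite /=; lia.
apply: wp_sq; apply: wp_asg; first by rewrite /=; lia.
set st1 := setv _ _ _.
pose I (st' : state) := exists l, [/\ listed l st',
  bfs_inv sigma cnt (ar st kCh) (va st' vH) l & tk st' = tk st + va st' vH].
apply: (@wp_whl _ _ _ I (fun st' => cnt - va st' vH)).
- exists [:: 1]; split; last by rewrite /= addn0.
    split=> //=.
    + by move=> x; rewrite !inE !negb_or => /and4P[/negPf-> /negPf->].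
    + by move=> k q x /negPf->.
    + by case.
  exact: bfs_inv0 cP.
- by [].
- move=> st' [l [L H T]] /= /eqP; rewrite eqb0 -leqNgt (li_size L) => le.
  have Eh : va st' vH = size l by apply/eqP; rewrite eqn_leq le (bi_h H).
  exists l; rewrite Eh in H T; split=> //; first exact: bfs_done cP _ H.
  by rewrite T leq_add2l ltnW // (bfs_size cP H).
move=> st' [l [L H T]] /=; rewrite eqb0 negbK (li_size L) => hl.
have szl := bfs_size cP H.
set h := va st' vH in H T hl *.
apply: wp_sq; apply: wp_asg; first by rewrite /= PP0 -/h; lia.
rewrite /= -/h (li_order L hl); set x := nth 0 l h.
have xP : 0 < x < cnt by apply: (bi_mem H); apply: mem_nth.
have H' := bfs_step cP H hl; rewrite -/x in H'.
have szl' := bfs_size cP H'.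
set st2 := setv _ _ _.
pose J (done : seq nat) (st3 : state) :=
  [/\ listed (l ++ children (ar st kCh) x done) st3, va st3 vH = h,
     va st3 vX = x & tk st3 = tk st'].
apply: wp_sq; apply: (wp_foreach (I := J)).
- split=> //; rewrite /children /= cats0; case: L => V A O S; split=> //=.
  by move=> y yP; rewrite -(V y) //; move: yP;
    rewrite !inE !negb_or => /and4P[_ _ /negPf->].
- move=> done e rest st3 El + [[V A O S] Eh Ex Et].
  rewrite mem_iota add0n => /= es.
  apply: wp_sq; apply: wp_asg; first by rewrite /= Ex; lia.
  rewrite /= Ex A //.
  have chE : children (ar st kCh) x (rcons done e) =
      children (ar st kCh) x done ++ (if ar st kCh e x != 0 then [:: ar st kCh
        e x] else [::]).
    by rewrite /children -cats1 filter_cat map_cat /=; case: ifP.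
  apply: wp_ite => //=.
    move=> n0; rewrite n0 in chE.
    have szT : size (l ++ children (ar st kCh) x (rcons done e)) < cnt.
      apply: leq_ltn_trans szl';
        rewrite !size_cat leq_add2l /children !size_map.
      by rewrite El -cat_rcons filter_cat size_cat leq_addr.
    rewrite chE catA size_cat addn1 in szT.
    apply: wp_sq; apply: wp_sto; first by rewrite /= PP0 S; lia.
    apply: wp_asg; first by rewrite /= S; lia.
    rewrite /= S; split=> //; rewrite chE catA; split=> //=.
    + move=> y yP; rewrite -(V y) //.
      by move: yP; rewrite !inE !negb_or => /and4P[_ /negPf-> _ /negPf->].
    + by move=> k q y /negPf kP; rewrite kP A // kP.
    + move=> j; rewrite size_cat addn1 ltnS nth_cat.
      case: ltngtP => // [jl|->] _; first by rewrite O.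
      by rewrite subnn.
    + by rewrite [RHS]size_cat.
  move=> e0; rewrite e0 /= in chE; apply: wp_skip; split=> //.
  rewrite chE cats0; split=> //=.
  move=> y yP; rewrite -(V y) //.
  by move: yP; rewrite !inE !negb_or => /and4P[_ _ _ /negPf->].
move=> st3 [L3 Eh Ex Et].
apply: wp_asg; first by rewrite /= Eh; lia.
rewrite /= Eh addn1; split; last by lia.
eexists; split; [|exact: H'|by rewrite /= Et T addnS].
case: L3 => V A O S; split=> //=.
move=> y yP; rewrite -(V y) //.
by move: yP; rewrite !inE !negb_or => /and4P[/negPf->].
Qed.

End Bfs.

End Walk.

(** * Segments of the transform *)

Section RowOrder.

Variable sigma : nat.
Implicit Types (pi : order_family sigma) (u v x y : seq 'I_sigma).

(** After a common first symbol [a] the tails are compared by the orders at contexts that start with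
    [a]; this lets the order axioms be proved by induction on rows. *)
Definition shift pi (a : 'I_sigma) : order_family sigma := fun x => pi (a :: x).

Lemma row_le_cons pi a b u v :
  row_le pi (a :: u) (b :: v) =
  if a == b then row_le (shift pi a) u v else pi [::] a b.
Proof. by rewrite /row_le /=; case: eqP. Qed.

Lemma context_adaptive_shift pi a :
  context_adaptive pi -> context_adaptive (shift pi a).
Proof. by move=> H x; apply: H. Qed.

Lemma row_le_total pi : context_adaptive pi -> total (row_le pi).
Proof.
move=> piP u; elim: u pi piP => [|a u IH] pi piP [|b v] //.
rewrite !row_le_cons [b == a]eq_sym; case: eqP => [->|_].
  exact: IH (context_adaptive_shift b piP) v.
by have [tot _ _] := piP [::]; apply: tot.
Qed.

Lemma row_le_anti pi : context_adaptive pi -> antisymmetric (row_le pi).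
Proof.
move=> piP u; elim: u pi piP => [|a u IH] pi piP [|b v] //.
rewrite !row_le_cons [b == a]eq_sym; case: eqP => [->|ne].
  by move/(IH _ (context_adaptive_shift b piP)) ->.
by have [_ anti _] := piP [::] => /anti.
Qed.

Lemma row_le_trans pi : context_adaptive pi -> transitive (row_le pi).
Proof.
move=> piP v u; elim: u v pi piP => [|a u IH] [|b v] pi piP [|c x] //.
rewrite !row_le_cons; have [_ anti trans] := piP [::].
case: (a =P b) => [->|ab]; case: (b =P c) => [bc|bc] //.
- rewrite bc => uv vx; exact: IH (context_adaptive_shift c piP) _ uv vx.
- by rewrite bc in ab *; case: (a =P c).
- move=> H1 H2; case: (a =P c) => [ac|_]; last exact: trans H1 H2.
  by case: ab; apply: anti; rewrite H1 ac.
Qed.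

Lemma lcp_split u a b x y : a != b -> lcp (u ++ a :: x) (u ++ b :: y) = u.
Proof.
move=> /negPf ab; elim: u => [|e u IH] /=; first by rewrite ab.
by rewrite eqxx IH.
Qed.

Lemma row_le_split pi u a b x y : a != b ->
  row_le pi (u ++ a :: x) (u ++ b :: y) = pi u a b.
Proof. by move=> ab; rewrite /row_le lcp_split // !drop_size_cat. Qed.

End RowOrder.

(** * Symbol changes in a concatenation *)

Section Changes.

Variables (T : eqType) (d : T).
Implicit Types (l : seq T).

Fixpoint changes_from (a : T) l : nat :=
  if l is b :: l' then (a != b) + changes_from b l' else 0.

Definition changes l : nat := changes_from (head d l) (behead l).

Definition ends l : T * T := (head d l, last d l).

(** The changes at the boundaries of consecutive pieces, each known only by its first and last
    symbols. *)
Fixpoint gaps (r : seq (T * T)) : nat :=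
  if r is p :: r' then
    (if r' is q :: _ then (p.2 != q.1 : nat) else 0) + gaps r'
  else 0.

Lemma runs_changes l : l != [::] -> runs l = (changes l).+1.
Proof.
case: l => // a l _; rewrite /changes [head _ _]/= [behead _]/=.
elim: l a => [//|b l IH] a.
have -> : runs [:: a, b & l] = (a != b) + runs (b :: l) by [].
by rewrite IH addnS.
Qed.

Lemma changes_from_cat a l1 l2 :
  changes_from a (l1 ++ l2) = changes_from a l1 + changes_from (last a l1) l2.
Proof. by elim: l1 a => //= b l1 IH a; rewrite IH addnA. Qed.

Lemma changes_from_size a l : changes_from a l <= size l.
Proof. by elim: l a => //= b l IH a; have := IH b; case: (a != b) => /=;
  lia. Qed.

Lemma changes_lt l : l != [::] -> changes l < size l.
Proof. by case: l => // a l _; rewrite ltnS changes_from_size. Qed.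

Lemma changes_cat l1 l2 : l1 != [::] -> l2 != [::] ->
  changes (l1 ++ l2) = changes l1 + (last d l1 != head d l2) + changes l2.
Proof.
case: l1 => // a l1 _; case: l2 => // b l2 _.
by rewrite /changes /= changes_from_cat /= addnA.
Qed.

Lemma changes_flatten (ls : seq (seq T)) : all (fun l => l != [::]) ls ->
  changes (flatten ls) = \sum_(l <- ls) changes l + gaps (map ends ls).
Proof.
elim: ls => [_|l1 ls IH /= /andP[l1P lsP]]; first by rewrite big_nil.
rewrite big_cons; case: ls lsP IH => [_ _|l2 ls lsP IH].
  by rewrite /= big_nil cats0 !addn0.
have l2P : l2 != [::] by case/andP: lsP.
have fP : flatten (l2 :: ls) != [::] by case: (l2) l2P.
rewrite changes_cat // IH //=.
have -> : head d (l2 ++ flatten ls) = head d l2 by case: (l2) l2P.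
lia.
Qed.

Lemma ends_flatten (ls : seq (seq T)) l0 : all (fun l => l != [::]) ls ->
  ls != [::] ->
  ends (flatten ls) = ((ends (head l0 ls)).1, (ends (last l0 ls)).2).
Proof.
elim: ls l0 => // l1 ls IH l0 /= /andP[l1P lsP] _.
case: ls IH lsP => [_ _|l2 ls IH lsP]; first by rewrite /= cats0.
have l2P : l2 != [::] by case/andP: lsP.
have := IH l1 lsP isT; rewrite /ends /= => -[_ E].
congr pair; first by case: (l1) l1P.
by rewrite last_cat -E; case: (l2) l2P.
Qed.

End Changes.

(** * Rows that share a prefix *)

Section Segments.

Variables (sigma : nat) (t : seq 'I_sigma) (d : 'I_sigma).
Hypothesis dt : d \notin t.

Notation s := (rcons t d).
Notation n := (size s).

Lemma drop_end j : j < n -> drop j s = rcons (drop j t) d.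
Proof. by rewrite size_rcons ltnS => jn; rewrite drop_rcons. Qed.

Lemma index_drop j : j < n -> index d (drop j s) = size t - j.
Proof.
move=> jn; rewrite drop_end // -cats1 index_cat.
have /negPf-> : d \notin drop j t by apply: contra dt; apply: mem_drop.
by rewrite /= eqxx addn0 size_drop.
Qed.

Lemma mem_drop_end j : j < n -> d \in drop j s.
Proof. by move=> jn; rewrite drop_end // mem_rcons inE eqxx. Qed.

(** The place of [d] in [u] gives the distance to the end of [s], hence the position of [u]. *)
Lemma prefix_drop_inj j k u : j < n -> k < n -> d \in u ->
  prefix u (drop j s) -> prefix u (drop k s) -> j = k.
Proof.
move=> jn kn du /prefixP[x Ex] /prefixP[y Ey].
have := index_drop jn; have := index_drop kn.
rewrite Ex Ey !index_cat du => ->.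
by move: jn kn; rewrite size_rcons; lia.
Qed.

Lemma prefix_drop_full j u : j < n -> d \in u -> prefix u (drop j s) ->
  u = drop j s.
Proof.
move=> jn du uj; apply: prefix_eq_size => //.
have /prefixP[x Ex] := uj; have := index_drop jn.
rewrite Ex index_cat du => E; rewrite -Ex size_drop size_rcons.
move: jn; rewrite size_rcons ltnS => jn.
by have := du; rewrite -index_mem E subSn.
Qed.

Definition prev (j : nat) : 'I_sigma := last d (rot j s).

Definition rotle (pi : order_family sigma) : rel nat :=
  fun j k => row_le pi (rot j s) (rot k s).

(** Suffixes may replace rotations: a factor of [s] has [d] at most at its end, so no row starts
    with it by wrapping around. *)
Definition occ (u : seq 'I_sigma) : seq nat :=
  [seq j <- iota 0 n | prefix u (drop j s)].

(* The part of the BWT that comes from the rows starting with [u], for [u] a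
   prefix of a suffix of [s]. *)
Definition segment pi u : seq 'I_sigma := map prev (sort (rotle pi) (occ u)).

Lemma bwt_segment pi : bwt pi s = segment pi [::].
Proof.
have -> : bwt pi s = map (last d) (bwt_matrix pi s).
  have rowsP : forall r, r \in bwt_matrix pi s -> r != [::].
    move=> r; rewrite mem_sort => /mapP[i _ ->].
    by rewrite -size_eq0 size_rot size_rcons.
  have sP : s != [::] by rewrite -size_eq0 size_rcons.
  rewrite /bwt; move: (bwt_matrix pi s) rowsP sP; case: (s) => // a l M rowsP _.
  by apply/eq_in_map => r /rowsP; case: r.
rewrite /segment /occ (eq_filter (a2 := predT)) ?filter_predT; last first.
  by move=> j; rewrite prefix0s.
by rewrite /bwt_matrix /rotations sort_map -map_comp.
Qed.

Lemma mem_occ u j : (j \in occ u) = (j < n) && prefix u (drop j s).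
Proof. by rewrite mem_filter mem_iota add0n andbC. Qed.

(** Strict, so that a set of positions has only one sorted enumeration. *)
Definition rotlt pi : rel nat := fun j k => (j != k) && rotle pi j k.

Section Order.

Variable pi : order_family sigma.
Hypothesis piP : context_adaptive pi.

Lemma index_rot j : j < n -> index d (rot j s) = size t - j.
Proof. by move=> jn; rewrite /rot index_cat mem_drop_end // index_drop. Qed.

Lemma rotle_anti j k : j < n -> k < n -> rotle pi j k -> rotle pi k j -> j = k.
Proof.
move=> jn kn jk kj; have E : rot j s = rot k s.
  by apply: (row_le_anti piP); apply/andP.
have := index_rot jn; rewrite E index_rot //.
by move: jn kn; rewrite size_rcons; lia.
Qed.

Lemma rotlt_trans : {in (fun j => j < n) & &, transitive (rotlt pi)}.
Proof.
move=> k j m kn jn mn /andP[jk Hjk] /andP[km Hkm].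
have Hjm : rotle pi j m := row_le_trans piP Hjk Hkm.
rewrite /rotlt Hjm andbT; apply: contra jk => /eqP Ejm.
by apply/eqP/rotle_anti => //; rewrite Ejm.
Qed.

Lemma occ_sorted u : sorted (rotlt pi) (sort (rotle pi) (occ u)).
Proof.
have H : sorted (rotle pi) (sort (rotle pi) (occ u)).
  by apply: sort_sorted => j k; apply: row_le_total.
have U : uniq (sort (rotle pi) (occ u)).
  by rewrite sort_uniq filter_uniq // iota_uniq.
move: H U; case: (sort _ _) => // a l; elim: l a => // b l IH a.
rewrite [sorted _ _]/= => /andP[ab H] /andP[].
rewrite inE negb_or => /andP[ne _] /(IH _ H) Hu.
by rewrite /= {1}/rotlt ne ab; apply: Hu.
Qed.

Lemma eq_sorted_rot (l1 l2 : seq nat) : (forall j, j \in l1 -> j < n) ->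
  sorted (rotlt pi) l1 -> sorted (rotlt pi) l2 -> l1 =i l2 -> l1 = l2.
Proof.
move=> ln S1 S2 E; apply: (irr_sorted_eq_in _ _ S1 S2 E).
  by move=> k j m /ln kn /ln jn /ln mn; apply: rotlt_trans.
by move=> j _; rewrite /rotlt eqxx.
Qed.

End Order.

Section Nodes.

Variables (cnt : nat) (w : nat -> seq 'I_sigma) (ch : nat -> nat -> nat).
Hypothesis cP : ctree s cnt w ch.

Lemma leaf_word x : 0 < x < cnt -> d \in w x ->
  exists2 j, j < n & w x = drop j s.
Proof.
move=> xP dx; have [j wj] := expl_prefix_drop (c_expl cP xP).
have jn : j < n.
  rewrite ltnNge; apply/negP => /drop_oversize E.
  by move: wj dx; rewrite E prefixs0 => /eqP->.
by exists j => //; apply: prefix_drop_full.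
Qed.

Lemma leaf_childless x (e : 'I_sigma) : 0 < x < cnt -> d \in w x -> ch e x = 0.
Proof.
move=> xP dx; apply/eqP/negPn/negP => n0.
have [/andP[/ltnW y0 yc] [_ xy _]] := c_child cP xP n0.
have yP : 0 < ch e x < cnt by rewrite y0.
have xy' := prefix_trans (prefix_rcons _ _) xy.
have dy : d \in w (ch e x) by move/prefixP: xy' => [u ->]; rewrite mem_cat dx.
have [k kn Ey] := leaf_word yP dy; rewrite Ey in xy xy'.
by have := size_prefix xy;
  rewrite -(prefix_drop_full kn dx xy') size_rcons ltnn.
Qed.

Lemma segment_leaf pi j : j < n -> segment pi (drop j s) = [:: prev j].
Proof.
move=> jn; rewrite /segment; have -> : occ (drop j s) = [:: j].
  rewrite -(filter_pred1_uniq (iota_uniq 0 n)) ?mem_iota //.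
  apply: eq_in_filter => k; rewrite mem_iota add0n /= => kn.
  apply/idP/eqP => [H|->]; last exact: prefix_refl.
  exact: (prefix_drop_inj kn jn (mem_drop_end jn) H (prefix_refl _)).
by [].
Qed.

Definition letters x : seq 'I_sigma :=
  [seq e : 'I_sigma <- enum 'I_sigma | ch e x != 0].

Lemma mem_letters x e : (e \in letters x) = (ch e x != 0).
Proof. by rewrite mem_filter mem_enum andbT. Qed.

Lemma letters_uniq x : uniq (letters x).
Proof. by rewrite filter_uniq ?enum_uniq. Qed.

Lemma occ_child pi x j : 0 < x < cnt -> d \notin w x ->
  (j \in occ (w x)) =
  has (fun e : 'I_sigma => j \in occ (w (ch e x))) (sort (pi (w x)) (letters
    x)).
Proof.
move=> xP dx; apply/idP/hasP => [|[e]]; last first.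
  rewrite mem_sort mem_letters !mem_occ => n0 /andP[-> /=].
  have [_ [_ xy _]] := c_child cP xP n0.
  exact: prefix_trans (prefix_trans (prefix_rcons _ _) xy).
rewrite mem_occ => /andP[jn xj].
have ne : w x != drop j s.
  by apply/eqP => E; rewrite E mem_drop_end in dx.
have [e ej] := prefix_rcons_lt xj ne; exists e; last first.
  have n0 : ch e x != 0.
    apply/eqP => t0.
    by have := c_child0 cP xP t0 (expl_drop s j); rewrite ej.
  have [_ [_ _ H]] := c_child cP xP n0.
  by rewrite mem_occ jn H // expl_drop.
rewrite mem_sort mem_letters; apply/eqP => t0.
by have := c_child0 cP xP t0 (expl_drop s j); rewrite ej.
Qed.

(** Both sides enumerate the same positions and both are strictly sorted: rows of different children
    part right after [w x], where [pi (w x)] compares them. *)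
Lemma segment_node pi x : context_adaptive pi -> 0 < x < cnt -> d \notin w x ->
  segment pi (w x) =
  flatten [seq segment pi (w (ch e x)) | e : 'I_sigma <- sort (pi (w x))
    (letters x)].
Proof.
move=> piP xP dx; rewrite /segment.
set es := sort (pi (w x)) _.
rewrite (map_comp (map prev) (fun e : 'I_sigma => sort (rotle pi) (occ (w (ch e
  x))))).
rewrite -map_flatten; congr map.
apply: (eq_sorted_rot piP).
- by move=> j; rewrite mem_sort mem_occ => /andP[].
- exact: occ_sorted.
- have [tot anti trans] := piP (w x).
  have esS : pairwise (pi (w x)) es.
    by rewrite -sorted_pairwise //; apply: sort_sorted.
  have esU : uniq es by rewrite sort_uniq letters_uniq.
  have esL e : e \in es -> ch e x != 0 by rewrite mem_sort mem_letters.
  suff : pairwise (rotlt pi)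
      (flatten [seq sort (rotle pi) (occ (w (ch e x))) | e : 'I_sigma <- es]).
    exact: pairwise_sorted.
  elim: (es) esS esU esL => // e l IH /= /andP[el lS] /andP[en lU] elL.
  rewrite pairwise_cat IH ?andbT //; last first.
    by move=> e' e'l; apply: elL; rewrite inE e'l orbT.
  apply/andP; split; last first.
    have ln : all (fun j => j < n) (sort (rotle pi) (occ (w (ch e x)))).
      by apply/allP => j; rewrite mem_sort mem_occ => /andP[].
    rewrite -(sorted_pairwise_in (rotlt_trans piP) ln).
    exact: occ_sorted.
  apply/allrelP => j k; rewrite mem_sort mem_occ => /andP[jn ej].
  case/flattenP => _ /mapP[e' e'l ->]; rewrite mem_sort mem_occ.
  move=> /andP[kn e'k].
  have n0 : ch e x != 0 by apply: elL; rewrite inE eqxx.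
  have n0' : ch e' x != 0 by apply: elL; rewrite inE e'l orbT.
  have ee' : e != e' by apply: contra en => /eqP->.
  have [_ [_ xy _]] := c_child cP xP n0.
  have [_ [_ xy' _]] := c_child cP xP n0'.
  have /prefixP[y Ey] := prefix_trans xy ej.
  have /prefixP[y' Ey'] := prefix_trans xy' e'k.
  apply/andP; split.
    apply: contra ee' => /eqP Ejk; move: Ey'; rewrite -Ejk Ey.
    by rewrite !cat_rcons => /eqP;
      rewrite eqseq_cat // eqxx /= eqseq_cons => /andP[].
  rewrite /rotle /rot Ey Ey' !cat_rcons -!catA !cat_cons row_le_split //.
  exact: allP el _ e'l.
- move=> j; rewrite mem_sort (occ_child pi) //.
  apply/hasP/flattenP => [[e ee je]|[_ /mapP[e ee ->]]].
    exists (sort (rotle pi) (occ (w (ch e x)))); last by rewrite mem_sort.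
    by apply: map_f ee.
  by rewrite mem_sort; exists e.
Qed.

Lemma occ_nonempty x : 0 < x < cnt -> exists j, j \in occ (w x).
Proof.
move=> xP; have [j wj] := expl_prefix_drop (c_expl cP xP).
case: (ltnP j n) => jn; first by exists j; rewrite mem_occ jn.
exists 0; rewrite mem_occ size_rcons /=; move: wj.
by rewrite drop_oversize // prefixs0 => /eqP->; rewrite prefix0s.
Qed.

Lemma segment_neq0 pi x : 0 < x < cnt -> segment pi (w x) != [::].
Proof.
move=> /occ_nonempty[j]; rewrite -(mem_sort (rotle pi)) /segment.
by case: (sort _ _).
Qed.

Lemma segment_size pi u : size (segment pi u) <= n.
Proof.
rewrite size_map size_sort size_filter.
by apply: leq_trans (count_size _ _) _; rewrite size_iota.
Qed.

End Nodes.

End Segments.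

(** * The optimum over all families *)

(* A choice at a node: the symbols of its children in the order chosen, each
   with the first and the last symbol of the segment of the child. *)
Definition choice (sigma : nat) : Type :=
  seq ('I_sigma * ('I_sigma * 'I_sigma)).

Section Choices.

Variable sigma : nat.
Implicit Types (c : choice sigma) (F : 'I_sigma * 'I_sigma -> nat -> nat).

Definition symbols c : seq 'I_sigma := map fst c.

Definition valid (ch : nat -> nat -> nat) x c : bool :=
  [&& c != [::], uniq (symbols c)
    & [forall e : 'I_sigma, (e \in symbols c) == (ch e x != 0)]].

Definition choice_ends (d : 'I_sigma) c : 'I_sigma * 'I_sigma :=
  let r := map snd c in ((head (d, d) r).1, (last (d, d) r).2).

Definition cost F (ch : nat -> nat -> nat) x c : nat :=
  \sum_(p <- c) F p.2 (ch p.1 x) + gaps (map snd c).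

End Choices.

(** * The recurrence bounds every family and is attained *)

Section Optimum.

Variables (sigma : nat) (t : seq 'I_sigma) (d : 'I_sigma).
Hypothesis dt : d \notin t.

Notation s := (rcons t d).
Notation n := (size s).

Variables (cnt : nat) (w : nat -> seq 'I_sigma) (ch : nat -> nat -> nat).
Hypothesis cP : ctree s cnt w ch.

Variable F : 'I_sigma * 'I_sigma -> nat -> nat.

(** Values from [n] on stand for infinity: a segment has at most [n] symbols and thus fewer than [n]
    changes. *)
Hypothesis F_leaf : forall x j, 0 < x < cnt -> j < n -> w x = drop j s ->
  F (prev t d j, prev t d j) x = 0 /\
  forall ab, F ab x < n -> ab = (prev t d j, prev t d j).
Hypothesis F_le : forall x c, 0 < x < cnt -> d \notin w x -> valid ch x c ->
  F (choice_ends d c) x <= cost F ch x c.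

Local Notation segm pi x := (segment t d pi (w x)).

Lemma child_bounds x (e : 'I_sigma) : 0 < x < cnt -> ch e x != 0 ->
  0 < ch e x < cnt.
Proof. by move=> xP /(c_child cP xP)[/andP[/ltnW-> ->]]. Qed.

Lemma letters_neq0 (pi : order_family sigma) x : 0 < x < cnt -> d \notin w x ->
  sort (pi (w x)) (letters sigma ch x) != [::].
Proof.
move=> xP dx; apply/eqP => E.
have [k jk] := occ_nonempty cP xP.
by move: jk; rewrite (occ_child cP pi) // E.
Qed.

Lemma changes_node pi x : context_adaptive pi -> 0 < x < cnt -> d \notin w x ->
  let es := sort (pi (w x)) (letters sigma ch x) in
  let c := [seq (e, ends d (segm pi (ch e x))) | e : 'I_sigma <- es] in
  [/\ valid ch x c, ends d (segm pi x) = choice_ends d c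
    & changes d (segm pi x) =
      \sum_(e <- es) changes d (segm pi (ch (e : 'I_sigma) x))
      + gaps (map snd c)].
Proof.
move=> piP xP dx es c; have esN := letters_neq0 pi xP dx.
have esL e : e \in es -> ch e x != 0 by rewrite mem_sort mem_letters.
have Ec : symbols c = es by rewrite /symbols -map_comp map_id_in.
have sP : all (fun l => l != [::]) [seq segm pi (ch e x) | e : 'I_sigma <- es].
  apply/allP => _ /mapP[e /esL n0 ->].
  exact: (segment_neq0 cP pi (child_bounds xP n0)).
split.
- apply/and3P; split; first by move: esN; rewrite /c -/es; case: (es).
    by rewrite Ec sort_uniq letters_uniq.
  by apply/forallP => e; rewrite Ec mem_sort mem_letters.
- rewrite (segment_node dt cP) // -/es (ends_flatten d [::]) //; last first.
    by move: esN; rewrite -/es; case: (es).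
  rewrite /choice_ends /c; move: esN; rewrite -/es; case: (es) => // e l _ /=.
  rewrite -map_comp (last_map (fun e : 'I_sigma => segm pi (ch e x))).
  by rewrite (last_map (fun e : 'I_sigma => ends d (segm pi (ch e x)))).
- rewrite (segment_node dt cP) // -/es changes_flatten // big_map.
  by rewrite /c -!map_comp.
Qed.

(** Induction from the leaves upwards: the order at [x] with the ends of the segments of the
    children is one of the choices in the recurrence. *)
Lemma lower_bound pi x : context_adaptive pi -> 0 < x < cnt ->
  F (ends d (segm pi x)) x <= changes d (segm pi x).
Proof.
move=> piP; have [m] := ubnP (n - size (w x)); elim: m x => // m IH x szx xP.
have [dx|dx] := boolP (d \in w x).
  have [j jn Ew] := leaf_word dt cP xP dx.
  rewrite Ew segment_leaf //=.
  by have [-> _] := F_leaf xP jn Ew.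
have [vc -> ->] := changes_node piP xP dx.
apply: leq_trans (F_le xP dx vc) _; rewrite /cost leq_add2r big_map.
rewrite !big_seq; apply: leq_sum => e; rewrite mem_sort mem_letters => n0 /=.
apply: IH; last exact: child_bounds.
have := child_size cP xP n0.
have := expl_size (c_expl cP (child_bounds xP n0)) => H1 H2.
have := leq_trans H2 H1 => H3.
by apply: leq_trans (_ : n - size (w x) <= m); [apply: ltn_sub2l|].
Qed.

Section Realization.

Variables (pi : order_family sigma) (tgt : nat -> 'I_sigma * 'I_sigma).
Hypothesis piP : context_adaptive pi.
Hypothesis tgtP : forall x, 0 < x < cnt -> F (tgt x) x < n.
Hypothesis chosenP : forall x, 0 < x < cnt -> d \notin w x ->
  exists c, [/\ valid ch x c, choice_ends d c = tgt x,
      cost F ch x c = F (tgt x) x, forall p, p \in c -> tgt (ch p.1 x) = p.2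
    & {in symbols c &, forall e e',
        pi (w x) e e' = (index e (symbols c) <= index e' (symbols c))}].

(** Sorting the letters at [x] by [pi (w x)] gives back the symbols of the chosen [c], so by
    induction the segment has exactly the ends and the changes that [c] promises. *)
Lemma realized x : 0 < x < cnt ->
  ends d (segm pi x) = tgt x /\ changes d (segm pi x) = F (tgt x) x.
Proof.
have [m] := ubnP (n - size (w x)); elim: m x => // m IH x szx xP.
have [dx|dx] := boolP (d \in w x).
  have [j jn Ew] := leaf_word dt cP xP dx.
  rewrite Ew segment_leaf //=.
  have [F0 /(_ _ (tgtP xP))->] := F_leaf xP jn Ew.
  by rewrite F0.
have [c [vc ec Fc tc oc]] := chosenP xP dx.
have [/and3P[_ cU /forallP cL]] := (vc, tt).
have [vc' -> ->] := changes_node piP xP dx.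
have Es : sort (pi (w x)) (letters sigma ch x) = symbols c.
  have [tot anti trans] := piP (w x).
  apply: (sorted_eq trans anti).
  - exact: sort_sorted.
  - apply/(sortedP d) => i il; have il' := ltnW il.
    by rewrite oc ?mem_nth // !index_uniq.
  - apply: uniq_perm; rewrite ?sort_uniq ?letters_uniq // => e.
    by rewrite mem_sort mem_letters; apply/esym/eqP.
have IHc p : p \in c ->
    ends d (segm pi (ch p.1 x)) = p.2 /\
    changes d (segm pi (ch p.1 x)) = F p.2 (ch p.1 x).
  move=> pc; have n0 : ch p.1 x != 0.
    by rewrite -(eqP (cL p.1)); apply: map_f.
  rewrite -(tc _ pc); apply: IH; last exact: child_bounds.
  have H2 := child_size cP xP n0.
  have H1 := expl_size (c_expl cP (child_bounds xP n0)).
  apply: leq_trans (_ : n - size (w x) <= m); last by [].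
  exact: ltn_sub2l (leq_trans H2 H1) H2.
have Ec : [seq (e, ends d (segm pi (ch e x)))
    | e : 'I_sigma <- symbols c] = c.
  rewrite /symbols -map_comp -[RHS]map_id; apply/eq_in_map => p /IHc[/= -> _].
  by case: p.
rewrite Es Ec; split=> //; rewrite -Fc /cost big_map; congr (_ + _).
by rewrite !big_seq; apply: eq_bigr => p /IHc[_ ->].
Qed.

End Realization.

End Optimum.

(** * The bottom-up pass *)

Notation vM := 14 (only parsing).
Notation vA := 15 (only parsing).
Notation vJ := 16 (only parsing).
Notation vV := 17 (only parsing).

Notation kCost := 7 (only parsing).
Notation kTgt := 8 (only parsing).
Notation kOut := 9 (only parsing).

Section Codes.

Variable sigma : nat.
Implicit Types (c : choice sigma) (ab : 'I_sigma * 'I_sigma).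

Definition pair_code ab : nat := ab.1 * sigma + ab.2.

Lemma pair_code_inj : injective pair_code.
Proof.
move=> [a b] [a' b']; rewrite /pair_code /= => E.
have s0 : 0 < sigma by apply: leq_ltn_trans (ltn_ord a).
have Eb : nat_of_ord b = b'.
  by have := congr1 (modn^~ sigma) E; rewrite /= !modnMDl !modn_small.
have Ea : nat_of_ord a = a'.
  have := congr1 (divn^~ sigma) E.
  by rewrite /= !divnMDl // !divn_small // !addn0.
by congr pair; apply: val_inj.
Qed.

Lemma pair_code_lt ab : pair_code ab < sigma * sigma.
Proof. by case: ab => a b; rewrite /pair_code /=; have := ltn_ord a;
  have := ltn_ord b; nia. Qed.

(** All orders of all sets of symbols with all possible ends of the children: a list that depends on
    [sigma] alone and is unrolled in the program. *)
Definition choices : seq (choice sigma) :=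
  [seq c <- flatten [seq [seq tval u | u <- enum {: k.-tuple ('I_sigma *
    ('I_sigma * 'I_sigma))}]
              | k <- iota 0 sigma.+1] | (c != [::]) && uniq (symbols c)].

Lemma symbols_size c : uniq (symbols c) -> size c <= sigma.
Proof.
move=> cU; rewrite -(size_map fst) -(card_uniqP cU) -[X in _ <= X](card_ord
  sigma).
exact: max_card.
Qed.

Lemma mem_choices c : (c \in choices) = (c != [::]) && uniq (symbols c).
Proof.
rewrite mem_filter; apply: andb_idr => /andP[_ cU].
apply/flattenP; exists [seq tval u | u <- enum {: (size c).-tuple ('I_sigma *
  ('I_sigma * 'I_sigma))}].
  by apply/mapP; exists (size c); rewrite // mem_iota add0n ltnS symbols_size.
by apply/mapP; exists (in_tuple c); rewrite ?mem_enum.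
Qed.

(** A product of 0/1 tests acts as a conjunction. *)
Definition valid_expr c : expr :=
  foldr (fun e acc => Op OMul
     (if e \in symbols c then Op OLt (Cst 0) (Ld kCh (Cst (nat_of_ord e)) (Var
       vV))
      else Op OEq (Ld kCh (Cst (nat_of_ord e)) (Var vV)) (Cst 0)) acc)
    (Cst 1) (enum 'I_sigma).

(** The changes at the boundaries depend only on [c] and enter as a constant. *)
Definition cost_expr c : expr :=
  foldr (fun p acc => Op OAdd
     (Ld kCost (Cst (pair_code p.2)) (Ld kCh (Cst (nat_of_ord p.1)) (Var vV)))
       acc)
    (Cst (gaps (map snd c))) c.

(** The default of [choice_ends] is a symbol of [c], which keeps the program text independent of the
    input. *)
Definition end_code c : nat :=
  if c is p :: _ then pair_code (choice_ends p.1 c) else 0.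

Lemma end_codeE d c : c != [::] -> end_code c = pair_code (choice_ends d c).
Proof. by case: c => [//|p c] _; rewrite /end_code /choice_ends. Qed.

Definition pairs : seq nat := iota 0 (sigma * sigma).

(** With [kLen] one more than the length, the equation says that the word ends where [s] ends. *)
Definition leaf_expr : expr :=
  Op OEq (Op OAdd (Get kPos (Var vV)) (Get kLen (Var vV)))
    (Op OAdd (Var vN) (Cst 1)).

(** The row at position 0 ends with the last symbol of [s], every other row with the symbol before
    its position. A single row has equal ends, and the pair of [a] with itself has code
    [a * sigma + a]. *)
Definition leaf_code : cmd :=
  Ite (Get kPos (Var vV))
    (Asg vA (Get kS (Op OSub (Get kPos (Var vV)) (Cst 1))))
    (Asg vA (Get kS (Op OSub (Var vN) (Cst 1)))) ;;
  Sto kCost (Op OAdd (Op OMul (Var vA) (Cst sigma)) (Var vA)) (Var vV) (Cst 0).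

Definition try_choice c : cmd :=
  Ite (valid_expr c)
    (Asg vX (cost_expr c) ;;
     Ite (Op OLt (Var vX) (Ld kCost (Cst (end_code c)) (Var vV)))
       (Sto kCost (Cst (end_code c)) (Var vV) (Var vX)) Skip)
    Skip.

(** Reverse breadth-first order treats children before their parent. The entries of a node start
    from [n], the infinite value. *)
Definition bottom_code : cmd :=
  Asg vJ (Var vT) ;;
  Whl (Var vJ)
    (Asg vJ (Op OSub (Var vJ) (Cst 1)) ;;
     Asg vV (Get kOrd (Var vJ)) ;;
     foreach pairs (fun q => Sto kCost (Cst q) (Var vV) (Var vN)) ;;
     Ite leaf_expr leaf_code (foreach choices try_choice)).

End Codes.

(** * Correctness of the bottom-up pass *)

Section Dp.

Variables (sigma : nat) (t : seq 'I_sigma) (d : 'I_sigma).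
Hypothesis dt : d \notin t.

Notation s := (rcons t d).

Variables (n B KN PP : nat).

Hypothesis size_s : size s = n.
(** A single array has to hold an output row of [sigma + 2] cells for each of at most [2 * n + 2]
    nodes. The parameters include all codes of pairs, which are below [sigma * sigma]. *)
Hypothesis KN_ge : (2 * n + 2) * (sigma + 2) <= KN.
Hypothesis B_gt : KN < B.
Hypothesis PP_lt : PP < B.
Hypothesis PP_gt : sigma * sigma + 2 * sigma < PP.

Local Notation wp := (wp B KN PP).

Variables (st1 : state) (cnt : nat) (w : nat -> seq 'I_sigma) (l : seq nat).

Let ch := ar st1 kCh.

(** What both passes use of the tree; the links of the construction are forgotten. *)
Record ready : Prop := Ready {
  r_n : va st1 vN = n;
  r_cnt : va st1 vCnt = cnt;
  r_T : va st1 vT = size l;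
  r_cntle : cnt <= 2 * n + 2;
  r_input : forall j c z, drop j s = c :: z -> ar st1 kS 0 j = nat_of_ord c;
  r_tree : ctree s cnt w ch;
  r_pos : forall x, x < cnt -> ar st1 kPos 0 x < n;
  r_len : forall x, 0 < x < cnt -> ar st1 kLen 0 x = (size (w x)).+1;
  r_word : forall x, 0 < x < cnt ->
    w x = take (size (w x)) (drop (ar st1 kPos 0 x) s);
  r_order : bfs_order sigma cnt ch l;
  r_ord : forall j, j < size l -> ar st1 kOrd 0 j = nth 0 l j;
  r_cost : forall q x, ar st1 kCost q x = 0;
  r_tgt : forall q x, ar st1 kTgt q x = 0
}.

Hypothesis rP : ready.

Let cP := r_tree rP.

Lemma n_gt0 : 0 < n. Proof. by rewrite -size_s size_rcons. Qed.

Lemma sigma_gt0 : 0 < sigma. Proof. exact: leq_ltn_trans (ltn_ord d). Qed.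

Lemma cnt_KN : cnt * (sigma + 2) <= KN.
Proof. by apply: leq_trans KN_ge; rewrite leq_mul2r (r_cntle rP) orbT. Qed.

Lemma cnt_lt_KN : cnt < KN.
Proof. by move: cnt_KN (c_cnt cP) sigma_gt0; clear; nia. Qed.

Lemma sums_lt_B : sigma * n + sigma + n + 1 < B.
Proof. by move: KN_ge B_gt; clear; nia. Qed.

Lemma order_cnt j : j < size l -> 0 < nth 0 l j < cnt.
Proof. by move=> jl; rewrite -(bo_mem (r_order rP)) mem_nth. Qed.

Lemma order_size : size l < cnt.
Proof.
have := uniq_leq_size (bo_uniq (r_order rP)) (s2 := iota 1 cnt.-1).
have c1 := c_cnt cP; rewrite size_iota => H.
suff : size l <= cnt.-1 by move: c1; clear; lia.
by apply: H => x; rewrite (bo_mem (r_order rP)) mem_iota; move: c1; clear; lia.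
Qed.

Lemma leaf_end x : 0 < x < cnt ->
  (ar st1 kPos 0 x + ar st1 kLen 0 x == n + 1) = (d \in w x).
Proof.
move=> xP; have xl : x < cnt by case/andP: xP.
have pn := r_pos rP xl; have pn' : ar st1 kPos 0 x < size s by rewrite size_s.
rewrite (r_len rP xP) addn1 addnS eqSS; have Ew := r_word rP xP.
apply/eqP/idP => [E|dx].
  suff -> : w x = drop (ar st1 kPos 0 x) s by apply: mem_drop_end.
  by rewrite Ew take_oversize // size_drop size_s; move: E; clear; lia.
have wp : prefix (w x) (drop (ar st1 kPos 0 x) s).
  by rewrite {1}Ew; apply: prefix_take.
rewrite (prefix_drop_full dt pn' dx wp) size_drop size_s.
by move: pn; clear; lia.
Qed.

Lemma leaf_drop x : 0 < x < cnt -> d \in w x ->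
  w x = drop (ar st1 kPos 0 x) s.
Proof.
move=> xP dx; have xl : x < cnt by case/andP: xP.
have pn := r_pos rP xl; have pn' : ar st1 kPos 0 x < size s by rewrite size_s.
apply: (prefix_drop_full dt pn' dx).
by rewrite {1}(r_word rP xP); apply: prefix_take.
Qed.

Lemma prev_input j : j < n ->
  ar st1 kS 0 (if j == 0 then n - 1 else j - 1) = prev t d j.
Proof.
move=> jn; rewrite /prev /rot; have [->|j0] := posnP j.
  rewrite drop0 take0 cats0 last_rcons subn1.
  apply: (r_input rP (z := [::])).
  by rewrite -size_s size_rcons drop_rcons // drop_size.
have jn' : j - 1 < size s by rewrite size_s; move: jn; clear; lia.
have Ej : j = (j - 1).+1 by move: j0; clear; lia.
have Et : take j s = rcons (take (j - 1) s) (nth d s (j - 1)).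
  by rewrite {1}Ej (take_nth d).
rewrite last_cat Et last_rcons.
exact: (r_input rP (drop_nth d jn')).
Qed.

Definition Fof (st : state) (ab : 'I_sigma * 'I_sigma) (x : nat) : nat :=
  ar st kCost (pair_code ab) x.

Lemma valid_exprP c st x : c \in choices sigma -> 0 < x < cnt ->
  va st vV = x -> (forall e y, ar st kCh e y = ch e y) ->
  safe B KN PP (valid_expr c) st /\ eval (valid_expr c) st = valid ch x c.
Proof.
rewrite mem_choices => /andP[c0 cU] xP Ex Ech.
have xK : x < KN by have := cnt_lt_KN; move: xP; clear; lia.
have B1 : 1 < B by have := sums_lt_B; have := n_gt0; clear; lia.
rewrite /valid c0 cU /=.
suff H es : let ex := foldr (fun e acc => Op OMul
     (if e \in symbols c then Op OLt (Cst 0) (Ld kCh (Cst (nat_of_ord e)) (Var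
       vV))
      else Op OEq (Ld kCh (Cst (nat_of_ord e)) (Var vV)) (Cst 0)) acc)
    (Cst 1) es in safe B KN PP ex st /\
  eval ex st = all (fun e : 'I_sigma => (e \in symbols c) == (ch e x != 0)) es.
  have [H1 H2] := H (enum 'I_sigma); split=> //; rewrite /valid_expr H2.
  congr nat_of_bool; apply/allP/forallP => [H3 e|H3 e _]; last exact: H3.
  by apply: H3; rewrite mem_enum.
elim: es => [|e es /= [IH1 IH2]] //=.
have eP : e < PP by have := ltn_ord e; have := PP_gt; clear; lia.
have eB : e < B by apply: ltn_trans PP_lt.
rewrite IH1 IH2; case: (e \in symbols c) => /=;
  rewrite Ex Ech eP eB xK (ltnW B1) /=.
  rewrite lt0n; split; last by case: (ch e x != 0); rewrite ?mul1n ?mul0n.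
  by case: (ch e x != 0); case: (all _ es);
    rewrite /= ?mul1n ?mul0n ?B1 ?(ltnW B1).
split; last by case: (ch e x); rewrite /= ?mul1n ?mul0n.
by case: (ch e x == 0); case: (all _ es);
  rewrite /= ?mul1n ?mul0n ?B1 ?(ltnW B1).
Qed.

Lemma gaps_size (r : seq ('I_sigma * 'I_sigma)) : gaps r <= size r.
Proof. by elim: r => //= p [|q r] IH //=; case: (_ != _); move: IH; rewrite /=;
  lia. Qed.

Lemma cost_exprP c st x : c \in choices sigma -> 0 < x < cnt -> valid ch x c ->
  va st vV = x -> (forall e y, ar st kCh e y = ch e y) ->
  (forall q y, ar st kCost q y <= n) ->
  [/\ safe B KN PP (cost_expr c) st, eval (cost_expr c) st = cost (Fof st) ch x
    c
    & cost (Fof st) ch x c < B].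
Proof.
rewrite mem_choices => /andP[c0 cU] xP /and3P[_ _ /forallP cL] Ex Ech Fn.
have cE p : p \in c -> 0 < ch p.1 x < cnt.
  move=> pc; apply: (child_bounds cP xP).
  by rewrite -(eqP (cL p.1)); apply: map_f.
have xK : x < KN by have := cnt_lt_KN; move: xP; clear; lia.
have szc := symbols_size cU.
have cB : size c * n + size c <= sigma * n + sigma by rewrite leq_add //
  leq_mul2r szc orbT.
have sB := sums_lt_B.
have Bg : gaps (map snd c) + size c * n < B.
  have H : gaps (map snd c) <= size c.
    by rewrite -(size_map snd c); apply: gaps_size.
  apply: leq_ltn_trans (_ : sigma * n + sigma < B); last first.
    by move: sB; clear; lia.
  by apply: leq_trans cB; rewrite addnC leq_add2l.
rewrite /cost_expr /cost.
set g := gaps _ in Bg *.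
(* Generalized to lists of elements of [c]; the bound on the partial sums makes each addition
   safe. *)
suff H c' : {subset c' <= c} -> g + size c' * n < B ->
   let ex := foldr (fun p acc => Op OAdd
     (Ld kCost (Cst (pair_code p.2)) (Ld kCh (Cst (nat_of_ord p.1)) (Var vV)))
       acc)
    (Cst g) c' in
   [/\ safe B KN PP ex st, eval ex st = \sum_(p <- c') Fof st p.2 (ch p.1 x) + g
     & \sum_(p <- c') Fof st p.2 (ch p.1 x) <= size c' * n].
  have [//|//|H1 H2 H3] := H c; split=> //.
  by apply: leq_ltn_trans Bg; rewrite addnC leq_add2l.
elim: c' => [|p c' IH] sub ltB /=; first by rewrite big_nil add0n; split=> //;
  lia.
have [||H1 H2 H3] := IH.
- by move=> q qc; apply: sub; rewrite inE qc orbT.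
- by move: ltB; rewrite /= mulSn; lia.
have pc : p \in c by apply: sub; rewrite inE eqxx.
have eP : p.1 < PP by have := ltn_ord p.1; have := PP_gt; clear; lia.
have eB : p.1 < B by apply: ltn_trans PP_lt.
have qP : pair_code p.2 < PP.
  by have := pair_code_lt p.2; have := PP_gt; clear; lia.
have qB : pair_code p.2 < B by apply: ltn_trans PP_lt.
have yK : ch p.1 x < KN.
  by have := cE p pc; have := cnt_lt_KN; clear; lia.
have Fp := Fn (pair_code p.2) (ch p.1 x).
rewrite big_cons H1 H2 /= Ex Ech eP eB qP qB xK yK /=; split.
- by apply: leq_ltn_trans ltB; rewrite /= mulSn addnA addnC leq_add2l leq_add.
- by rewrite /Fof addnA.
- by rewrite mulSn leq_add.
Qed.

Definition kept (vs ks : seq nat) (st : state) : Prop :=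
  (forall y, y \notin vs -> va st y = va st1 y) /\
  (forall k q x, k \notin ks -> ar st k q x = ar st1 k q x).

(** The recurrence in two halves: no choice is cheaper than the entry, which serves the lower bound,
    and every finite entry is attained, which serves the top-down pass. *)
Definition solved (st : state) (x : nat) : Prop :=
  (forall j, j < n -> w x = drop j s ->
     Fof st (prev t d j, prev t d j) x = 0 /\
     forall ab, Fof st ab x < n -> ab = (prev t d j, prev t d j)) /\
  (d \notin w x ->
    (forall c, valid ch x c ->
       Fof st (choice_ends d c) x <= cost (Fof st) ch x c) /\
    (forall ab, Fof st ab x < n ->
       exists c, [/\ valid ch x c, choice_ends d c = ab
         & cost (Fof st) ch x c = Fof st ab x])).

Lemma eq_cost st st' x c :
  (forall q (e : 'I_sigma), ch e x != 0 ->
     ar st' kCost q (ch e x) = ar st kCost q (ch e x)) ->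
  valid ch x c -> cost (Fof st') ch x c = cost (Fof st) ch x c.
Proof.
move=> E /and3P[_ _ /forallP cL]; congr (_ + _).
rewrite !big_seq; apply: eq_bigr => p pc; apply: E.
by rewrite -(eqP (cL p.1)); apply: map_f.
Qed.

Lemma eq_solved st st' x :
  (forall q, ar st' kCost q x = ar st kCost q x) ->
  (forall q (e : 'I_sigma), ch e x != 0 ->
     ar st' kCost q (ch e x) = ar st kCost q (ch e x)) ->
  solved st x -> solved st' x.
Proof.
move=> E1 E2 [H1 H2]; have EF ab : Fof st' ab x = Fof st ab x by apply: E1.
split=> [j jn Ew|dx].
  have [F0 F1] := H1 j jn Ew; split; first by rewrite EF.
  by move=> ab; rewrite EF; apply: F1.
have [H3 H4] := H2 dx; split=> [c vc|ab].
  by rewrite EF (eq_cost E2) //; apply: H3.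
rewrite EF => /H4[c [vc Ec Ecost]]; exists c; split=> //.
by rewrite (eq_cost E2).
Qed.

Lemma child_neq x (e : 'I_sigma) : 0 < x < cnt -> ch e x != 0 -> ch e x != x.
Proof.
move=> xP n0; apply/eqP => E; have := child_size cP xP n0.
by rewrite E ltnn.
Qed.

Section Node.

Variables (x : nat) (st : state).
Hypothesis xP : 0 < x < cnt.
Hypothesis st_v : va st vV = x.
Hypothesis st_n : va st vN = n.
Hypothesis st_k : forall k q y, k != kCost -> ar st k q y = ar st1 k q y.
Hypothesis st_c : forall q y, ar st kCost q y <= n.

Record noded (st' : state) : Prop := Noded {
  nd_va : forall y, y != vA -> y != vX -> va st' y = va st y;
  nd_ar : forall k q y, (k != kCost) || (y != x) -> ar st' k q y = ar st k q y;
  nd_le : forall q y, ar st' kCost q y <= n;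
  nd_solved : solved st' x;
  nd_tk : tk st' = tk st
}.

Let xK : x < KN.
Proof. by have := cnt_lt_KN; move: xP; clear; lia. Qed.

Let nB : n < B.
Proof. by have := sums_lt_B; clear; lia. Qed.

Lemma sq_PP q : q < sigma * sigma -> q < PP.
Proof. by have := PP_gt; clear; lia. Qed.

Definition cleared (done : seq nat) (st' : state) : Prop :=
  [/\ forall y, va st' y = va st y, tk st' = tk st
    & forall k q y, ar st' k q y =
        if [&& k == kCost, y == x & q \in done] then n else ar st k q y].

Lemma wp_clear : wp (foreach (pairs sigma) (fun q => Sto kCost (Cst q) (Var vV)
  (Var vN)))
  (cleared (pairs sigma)) st.
Proof.
apply: (wp_foreach (I := cleared)) => //.
  by split=> // k q y; rewrite !andbF.
move=> done q rest st2 _; rewrite mem_iota add0n => /= qs [V K A].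
apply: wp_sto.
  by rewrite /= V st_v xK (sq_PP qs) (ltn_trans (sq_PP qs) PP_lt).
split=> //= k q' y; rewrite A mem_rcons inE !V st_v st_n.
case: (k =P kCost) => //= _; case: (q' =P q) => [->|_] /=; last first.
  by [].
by case: (y == x).
Qed.

Section Cleared.

Variable st2 : state.
Hypothesis clP : cleared (pairs sigma) st2.

Let V y : va st2 y = va st y. Proof. by case: clP. Qed.

Let Fx ab : Fof st2 ab x = n.
Proof.
by case: clP => _ _ A; rewrite /Fof A !eqxx mem_iota add0n pair_code_lt.
Qed.

Let Ak k q y : k != kCost -> ar st2 k q y = ar st1 k q y.
Proof. by move=> kP; case: clP => _ _ A; rewrite A (negPf kP) st_k. Qed.

Let Ale q y : ar st2 kCost q y <= n.
Proof. by case: clP => _ _ A; rewrite A; case: ifP. Qed.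

Lemma clear_ar k q y : (k != kCost) || (y != x) -> ar st2 k q y = ar st k q y.
Proof. by case: clP => _ _ A; rewrite A -negb_and => /negPf H;
  rewrite andbA H. Qed.

Lemma wp_leaf : d \in w x -> wp (leaf_code sigma) noded st2.
Proof.
move=> dx; have xl : x < cnt by case/andP: xP.
have pn := r_pos rP xl; have n0 := n_gt0.
have nK : n < KN by have := KN_ge; have := sigma_gt0; clear; nia.
have PP0 : 0 < PP by have := PP_gt; clear; lia.
have B0 : 0 < B by move: nB; clear; lia.
have B1 : 1 < B by move: nB nK n0 (B_gt); clear; lia.
set p := ar st1 kPos 0 x in pn.
pose Q st3 := [/\ forall y, y != vA -> va st3 y = va st2 y,
   va st3 vA = prev t d p, tk st3 = tk st2 & ar st3 = ar st2].
apply: wp_sq; apply: wp_mono (_ : wp _ Q st2); last first.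
  have Ep := prev_input pn.
  have pE : ar st2 kPos 0 x = p by rewrite Ak.
  apply: wp_ite; rewrite /= V st_v ?PP0 ?B0 ?xK ?pE //.
    move=> p0; rewrite (negPf p0) in Ep.
    apply: wp_asg.
      rewrite /= V st_v pE PP0 B0 B1 xK lt0n p0 /=.
      by move: pn nK; clear; lia.
    rewrite /= V st_v pE; split=> //=; last by rewrite Ak // Ep.
    by move=> y /negPf->.
  move=> p0; rewrite {1}p0 eqxx in Ep.
  apply: wp_asg.
    by rewrite /= !V st_n PP0 B0 B1 n0 /=; move: nK; clear; lia.
  rewrite /= !V st_n; split=> //=; last by rewrite Ak // Ep.
  by move=> y /negPf->.
move=> st3 [V3 Ea K3 A3].
set a := prev t d p in Ea.
have aP : pair_code (a, a) < sigma * sigma by apply: pair_code_lt.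
have qP := sq_PP aP; rewrite /pair_code /= in aP qP.
have qB := ltn_trans qP PP_lt.
have V3v : va st3 vV = x by rewrite V3 // V.
apply: wp_sto.
  rewrite /= Ea V3v xK qP qB B0 /= andbT.
  have := sigma_gt0; have := PP_gt; have := PP_lt; have := ltn_ord a.
  by move: qB; clear; nia.
rewrite /= Ea V3v; split=> /=.
- by move=> y yA yX; rewrite V3 // V.
- move=> k q y kP; rewrite A3 clear_ar //.
  case: and3P => // -[/eqP Ek _ /eqP Ey].
  by move: kP; rewrite Ek Ey !eqxx.
- by move=> q y; rewrite A3; case: ifP.
- have Ew := leaf_drop xP dx.
  split; last by rewrite dx.
  move=> j jn Ewj; have pj : j = p.
    have jn' : j < size s by rewrite size_s.
    have pn' : p < size s by rewrite size_s.
    apply: (prefix_drop_inj dt jn' pn' dx).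
      by rewrite Ewj prefix_refl.
    by rewrite Ew prefix_refl.
  rewrite pj -/a /Fof /pair_code /= !eqxx; split=> // -[a' b'] /=.
  case: eqP => [E _|_]; last first.
    by rewrite andbC /= A3 => H; have := Fx (a', b'); rewrite /Fof /= => E;
      move: H; rewrite E ltnn.
  exact: (@pair_code_inj sigma (a', b') (a, a)).
- by rewrite K3; case: clP.
Qed.

(** Costs may be taken in the initial state [st2], since only the entries of [x] change and [x] is
    not its own child. *)
Definition tried (done : seq (choice sigma)) (st' : state) : Prop :=
  [/\ forall y, y != vX -> va st' y = va st2 y,
      forall k q y, (k != kCost) || (y != x) -> ar st' k q y = ar st2 k q y,
      forall q, ar st' kCost q x <= n,
      forall c, c \in done -> valid ch x c ->
        Fof st' (choice_ends d c) x <= cost (Fof st2) ch x c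
    & (forall ab, Fof st' ab x < n -> exists c, [/\ valid ch x c,
        choice_ends d c = ab & cost (Fof st2) ch x c = Fof st' ab x])
      /\ tk st' = tk st2].

Lemma wp_choices : d \notin w x ->
  wp (foreach (choices sigma) (@try_choice sigma)) noded st2.
Proof.
move=> dx; apply: (wp_foreach (I := tried)).
- split=> //; split=> // ab; by rewrite Fx ltnn.
- move=> done c rest st3 _ cC [V3 A3 L3 H1 [H2 K3]].
  have c0 : c != [::] by move: cC; rewrite mem_choices => /andP[].
  have V3v : va st3 vV = x by rewrite V3 // V.
  have A3ch e y : ar st3 kCh e y = ch e y by rewrite A3 // Ak.
  have A3le q y : ar st3 kCost q y <= n.
    by have [->|ne] := eqVneq y x; [apply: L3 | rewrite A3 ?ne ?orbT].
  have [S1 E1] := valid_exprP cC xP V3v A3ch.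
  have Ecost : valid ch x c -> cost (Fof st3) ch x c = cost (Fof st2) ch x c.
    by apply: eq_cost => q e n0; rewrite A3 ?(child_neq xP n0) ?orbT.
  apply: wp_ite => //; rewrite E1.
    case vc: (valid ch x c) => // _.
    have [S2 E2 ltB] := cost_exprP cC xP vc V3v A3ch A3le.
    rewrite Ecost // in E2 ltB.
    apply: wp_sq; apply: wp_asg; first by rewrite S2.
    rewrite E2; set k := cost _ _ _ _ in E2 ltB *.
    have qP : end_code c < PP.
      by rewrite (end_codeE d c0); apply/sq_PP/pair_code_lt.
    have qB := ltn_trans qP PP_lt.
    apply: wp_ite; first by rewrite /= V3v qP qB xK.
      rewrite /= V3v eqb0 negbK => lt.
      apply: wp_sto; first by rewrite /= V3v qP qB xK.
      rewrite /= V3v; split=> /=.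
      + by move=> y /negPf yX; rewrite yX V3 // yX.
      + move=> k' q y kP; rewrite A3 //; case: and3P => // -[/eqP Ek _ /eqP Ey].
        by move: kP; rewrite Ek Ey !eqxx.
      + move=> q; case: ifP => _; last exact: L3.
        by apply: ltnW; apply: leq_trans lt (L3 _).
      + move=> c'; rewrite mem_rcons inE => /orP[/eqP->|c'd] vc'.
          by rewrite /Fof /= (end_codeE d c0) !eqxx.
        rewrite /Fof /=; case: ifP => [/andP[/eqP E _]|_]; last exact: H1.
        apply: leq_trans (ltnW lt) _; rewrite -E; exact: H1.
      + split=> // ab; rewrite /Fof /= (end_codeE d c0) eqxx andbT.
        case: eqP => [/pair_code_inj-> _|_]; last exact: H2.
        by exists c.
    rewrite /= V3v => /eqP; rewrite eqb0 -leqNgt => le.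
    apply: wp_skip; split=> //=.
    + by move=> y /negPf yX; rewrite yX V3 // yX.
    + move=> c'; rewrite mem_rcons inE => /orP[/eqP->|c'd] vc'; last exact: H1.
      by rewrite /Fof -(end_codeE d c0).
  move=> v0; apply: wp_skip; split=> //.
  move=> c'; rewrite mem_rcons inE => /orP[/eqP->|c'd] vc'; last exact: H1.
  by rewrite vc' in v0.
move=> st3 [V3 A3 L3 H1 [H2 K3]]; split.
- by move=> y yA yX; rewrite V3 // V.
- by move=> k q y kP; rewrite A3 // clear_ar.
- move=> q y; have [->|ne] := eqVneq y x; first exact: L3.
  by rewrite A3 ?ne ?orbT.
- have Ecost c : valid ch x c -> cost (Fof st3) ch x c = cost (Fof st2) ch x c.
    by apply: eq_cost => q e n0; rewrite A3 ?(child_neq xP n0) ?orbT.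
  split=> [j jn Ew|_].
    by move: dx; rewrite Ew mem_drop_end // size_s.
  split=> [c vc|ab].
    rewrite Ecost //; apply: H1 => //; rewrite mem_choices.
    by case/and3P: vc => -> ->.
  by move=> /H2[c [vc <- Ec]]; exists c; rewrite Ecost.
- by rewrite K3; case: clP.
Qed.

End Cleared.

Lemma wp_node :
  wp (foreach (pairs sigma) (fun q => Sto kCost (Cst q) (Var vV) (Var vN)) ;;
      Ite leaf_expr (leaf_code sigma) (foreach (choices sigma) (@try_choice
        sigma)))
    noded st.
Proof.
apply: wp_sq; apply: wp_mono wp_clear => st2 clP.
have [V K A] := clP.
have EL : eval leaf_expr st2 = (d \in w x).
  by rewrite /= !V st_v st_n !A /= !st_k // leaf_end.
have xl : x < cnt by case/andP: xP.
have pn := r_pos rP xl.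
have szw := expl_size (c_expl cP xP); rewrite size_s in szw.
have nB3 : n + n + 2 < B.
  have H : 2 * n + 2 <= KN.
    by apply: leq_trans KN_ge; rewrite leq_pmulr // addn_gt0 orbT.
  by have := B_gt; move: H; clear; lia.
have PP0 : 0 < PP by have := PP_gt; clear; lia.
have B0 : 1 < B by move: nB3; clear; lia.
apply: wp_ite.
- rewrite /= !V st_v st_n !A /= !st_k // r_len //= PP0 xK B0 /=.
  have szw' : size (w x) <= n := szw.
  by rewrite (ltnW B0) /=; move: pn szw' nB3; clear; lia.
- by rewrite EL eqb0 negbK; apply: wp_leaf.
- by rewrite EL => /eqP; rewrite eqb0; apply: wp_choices.
Qed.

End Node.

Record bottomed (st : state) : Prop := Bottomed {
  bt_kept : kept [:: vJ; vV; vA; vX] [:: kCost] st;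
  bt_le : forall q y, ar st kCost q y <= n;
  bt_solved : forall x, 0 < x < cnt -> solved st x;
  bt_tk : tk st = tk st1 + size l
}.

Lemma nth_order_inj i j : i < size l -> j < size l ->
  nth 0 l i = nth 0 l j -> i = j.
Proof.
move=> il jl /eqP; rewrite nth_uniq ?(bo_uniq (r_order rP)) //.
exact: eqP.
Qed.

Lemma wp_bottom : wp (bottom_code sigma) bottomed st1.
Proof.
have szl := order_size; have cK := cnt_lt_KN.
have PP0 : 0 < PP by have := PP_gt; clear; lia.
have B1 : 1 < B by move: szl cK (B_gt); clear; lia.
apply: wp_sq; apply: wp_asg; first by [].
rewrite /= (r_T rP); set st2 := setv _ _ _.
pose I st := [/\ kept [:: vJ; vV; vA; vX] [:: kCost] st,
  forall q y, ar st kCost q y <= n, va st vJ <= size l,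
  forall i, va st vJ <= i < size l -> solved st (nth 0 l i)
  & tk st + va st vJ = tk st1 + size l].
apply: (@wp_whl _ _ _ I (fun st => va st vJ)).
- split=> //.
  + by split=> // y; rewrite !inE !negb_or => /and4P[/= /negPf->].
  + by move=> q y; rewrite /= (r_cost rP).
  + by move=> i /= /andP[le lt]; have := leq_trans lt le; rewrite ltnn.
- by [].
- move=> st [K L jl H T] /= j0; rewrite j0 addn0 in T; split=> // x.
  rewrite -(bo_mem (r_order rP)) => xl.
  by rewrite -(nth_index 0 xl); apply: H; rewrite j0 index_mem.
move=> st [[V A] L jl H T] /= jn0.
set j := (va st vJ).-1.
have Ej : va st vJ = j.+1 by rewrite prednK // lt0n.
rewrite Ej in jl H T.
apply: wp_sq; apply: wp_asg; first by rewrite /= Ej B1.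
rewrite /= Ej subn1 /=.
apply: wp_sq; apply: wp_asg.
  by rewrite /= PP0 (ltnW B1) /=; move: jl szl cK; clear; lia.
rewrite /= A // (r_ord rP jl); set x := nth 0 l j.
have xP := order_cnt jl; rewrite -/x in xP.
set st3 := setv _ _ _.
apply: wp_mono (@wp_node x st3 xP _ _ _ _) => //.
- move=> st' [V' A' L' S' T'].
  have Ej' : va st' vJ = j by rewrite V'.
  split=> /=; last by rewrite Ej'.
  split=> //=; rewrite ?Ej'.
  + split=> [y yP|k q y kP].
      have yA : y != vA by move: yP; rewrite !inE !negb_or => /and4P[].
      have yX : y != vX by move: yP; rewrite !inE !negb_or => /and4P[].
      rewrite V' //= -(V y) //.
      by move: yP; rewrite !inE !negb_or => /and4P[/negPf-> /negPf->].
    by rewrite A' ?(A k) //; move: kP; rewrite inE => ->.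
  + exact: ltnW.
  + move=> i /andP[]; rewrite leq_eqVlt => /orP[/eqP<- //|ji] il.
    have ne : nth 0 l i != x.
      by apply/eqP => /(nth_order_inj il jl) E; rewrite E ltnn in ji.
    have S : solved st (nth 0 l i) by apply: H; rewrite ji.
    apply: (eq_solved _ _ S) => [q|q e n0]; rewrite A' ?ne ?orbT //=.
    (* The children of a node already solved stand further right in the order, so none of them is
       the node being written. *)
    have [k /andP[ik kl] Ek] := bo_child (r_order rP) il n0.
    rewrite -Ek.
    apply/eqP => /(nth_order_inj kl jl) E.
    by move: ji ik; rewrite E; clear; lia.
  + by rewrite T' /=; move: T; clear; lia.
- by rewrite /st3 /= V // (r_n rP).
- by move=> k q y kP; rewrite /st3 /= A // inE.
Qed.

End Dp.

(** * The top-down pass *)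

Section TopCodes.

Variable sigma : nat.
Implicit Types (c : choice sigma).

(* The symbols that do not occur in [c] come last, so that the ranks are
   distinct. *)
Definition rank c (e : 'I_sigma) : nat :=
  if e \in symbols c then index e (symbols c) else sigma + e.

Lemma rank_inj c : uniq (symbols c) -> injective (rank c).
Proof.
move=> cU e e'; rewrite /rank.
have lt x : x \in symbols c -> index x (symbols c) < sigma.
  move=> xc; apply: leq_trans (symbols_size cU).
  by rewrite -(size_map fst) index_mem.
case: ifP => ec; case: ifP => e'c E.
- by rewrite -(nth_index e ec) E nth_index.
- by have := lt _ ec; rewrite E ltnNge leq_addr.
- by have := lt _ e'c; rewrite -E ltnNge leq_addr.
- by move/addnI: E; apply: val_inj.
Qed.

Definition out_index (k : nat) : expr :=
  Op OAdd (Op OMul (Var vV) (Cst (sigma + 2))) (Cst k).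

Definition ranks_code c : cmd :=
  foreach (enum 'I_sigma) (fun e => Put kOut (out_index (2 + e)) (Cst (rank c
    e))).

(** Several choices may pass the tests. Each writes all ranks of the row and the targets of all
    children, so the last one prevails entirely. *)
Definition take_choice c : cmd :=
  Ite (valid_expr c)
    (Ite (Op OEq (Get kTgt (Var vV)) (Cst (end_code c)))
       (Ite (Op OEq (cost_expr c) (Var vM))
          (foreach c (fun p => Put kTgt (Ld kCh (Cst (nat_of_ord p.1)) (Var vV))
                                 (Cst (pair_code p.2))) ;;
           ranks_code c)
          Skip)
       Skip)
    Skip.

(** The ends of the whole transform are free, so the cheapest pair becomes the target of the
    root. *)
Definition root_code : cmd :=
  Asg vM (Var vN) ;;
  foreach (pairs sigma) (fun q =>
    Ite (Op OLt (Ld kCost (Cst q) (Cst 1)) (Var vM))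
      (Asg vM (Ld kCost (Cst q) (Cst 1)) ;; Put kTgt (Cst 1) (Cst q))
      Skip).

(** At a leaf the ranks of the empty choice give the natural order. *)
Definition row_code : cmd :=
  Asg vM (Ld kCost (Get kTgt (Var vV)) (Var vV)) ;;
  Put kOut (out_index 0) (Get kPos (Var vV)) ;;
  Put kOut (out_index 1) (Op OSub (Get kLen (Var vV)) (Cst 1)) ;;
  Ite leaf_expr (ranks_code [::]) (foreach (choices sigma) take_choice).

Definition top_code : cmd :=
  root_code ;;
  Asg vJ (Cst 0) ;;
  Whl (Op OLt (Var vJ) (Var vT))
    (Asg vV (Get kOrd (Var vJ)) ;;
     row_code ;;
     Asg vJ (Op OAdd (Var vJ) (Cst 1))).

End TopCodes.

(** * Correctness of the top-down pass *)

Section Top.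

Variables (sigma : nat) (t : seq 'I_sigma) (d : 'I_sigma).
Hypothesis dt : d \notin t.

Notation s := (rcons t d).

Variables (n B KN PP : nat).

Hypothesis size_s : size s = n.
Hypothesis KN_ge : (2 * n + 2) * (sigma + 2) <= KN.
Hypothesis B_gt : KN < B.
Hypothesis PP_lt : PP < B.
Hypothesis PP_gt : sigma * sigma + 2 * sigma < PP.

Local Notation wp := (wp B KN PP).

Variables (st1 : state) (cnt : nat) (w : nat -> seq 'I_sigma) (l : seq nat).

Let ch := ar st1 kCh.

Hypothesis rP : ready t d n st1 cnt w l.

Let cP : ctree s cnt w ch := r_tree rP.

Variable st2 : state.
Hypothesis btP : bottomed t d n st1 cnt w l st2.

Local Notation F := (@Fof sigma st2).

Let PP0 : 0 < PP. Proof. by have := PP_gt; clear; lia. Qed.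

Let B1 : 1 < B.
Proof. by have := cnt_lt_KN KN_ge rP; have := B_gt; clear; lia. Qed.

Let row_lt x k : 0 < x < cnt -> k < sigma + 2 -> x * (sigma + 2) + k < KN.
Proof. by move=> xP kP; have := cnt_KN KN_ge rP; nia. Qed.

Lemma row_inj x y k k' : k < sigma + 2 -> k' < sigma + 2 ->
  x * (sigma + 2) + k = y * (sigma + 2) + k' -> x = y /\ k = k'.
Proof.
move=> kl kl' E; have m0 : 0 < sigma + 2 by rewrite addn2.
split.
  have := congr1 (divn^~ (sigma + 2)) E.
  by rewrite /= !divnMDl // !divn_small // !addn0.
by have := congr1 (modn^~ (sigma + 2)) E; rewrite /= !modnMDl !modn_small.
Qed.

Lemma rank_lt (c : choice sigma) e : uniq (symbols c) -> rank c e < B.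
Proof.
move=> cU; apply: leq_trans (ltnW PP_lt); apply: leq_trans (ltnW PP_gt).
have := ltn_ord e; rewrite /rank; case: ifP => ec; last by clear; lia.
have : index e (symbols c) < sigma.
  by apply: leq_trans (symbols_size cU); rewrite -(size_map fst) index_mem.
clear; lia.
Qed.

Record ranked (x : nat) (c : choice sigma) (es : seq 'I_sigma)
    (st st' : state) : Prop := Ranked {
  rk_va : forall y, va st' y = va st y;
  rk_tk : tk st' = tk st;
  rk_ar : forall k q i, k != kOut -> ar st' k q i = ar st k q i;
  rk_out : forall i, (forall e : 'I_sigma, i <> x * (sigma + 2) + (2 + e)) ->
    ar st' kOut 0 i = ar st kOut 0 i;
  rk_rank : forall e, e \in es ->
    ar st' kOut 0 (x * (sigma + 2) + (2 + e)) = rank c e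
}.

Lemma wp_ranks x c st : 0 < x < cnt -> uniq (symbols c) -> va st vV = x ->
  wp (ranks_code c) (ranked x c (enum 'I_sigma) st) st.
Proof.
move=> xP cU Ex; apply: (wp_foreach (I := fun es => ranked x c es st)) => //.
move=> done e rest st' _ _ [V K A O R].
have eP : 2 + e < sigma + 2 by rewrite addnC ltn_add2r.
have xe := row_lt xP eP.
have := KN_ge => KN_ge'.
have lt1 : x * (sigma + 2) < KN by apply: leq_ltn_trans xe; apply: leq_addr.
have lt2 : sigma + 2 < KN by have := n_gt0 size_s; move: KN_ge' (sigma_gt0 d);
  clear; nia.
have lt3 : 2 + e < B by apply: ltn_trans B_gt; apply: ltn_trans eP lt2.
apply: wp_sto.
  rewrite /= V Ex PP0 rank_lt // (ltn_trans lt1) // (ltn_trans lt2) // lt3.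
  by rewrite xe (ltn_trans xe) // (ltnW B1).
rewrite /= V Ex; split=> //=.
- by move=> k q i /negPf kP; rewrite kP /= A // kP.
- by move=> i iP; case: eqP (iP e) => // _ _; apply: O.
- move=> e'; rewrite mem_rcons inE; case: eqP => [-> _|ne e'd] /=.
    by rewrite eqxx.
  case: eqP => [E|_]; last exact: R.
  by case: ne; apply: val_inj; move/addnI: E => /addnI.
Qed.

Definition child_of x y : bool := has (fun e : 'I_sigma => ch e x == y) (enum
  'I_sigma).

Lemma child_ofP x y : reflect (exists e : 'I_sigma, ch e x = y) (child_of x y).
Proof.
apply: (iffP hasP) => [[e _ /eqP E]|[e E]]; exists e => //.
  by rewrite mem_enum.
exact/eqP.
Qed.

Record aimed (x : nat) (c : choice sigma) (st st' : state) : Prop := Aimed {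
  am_va : forall y, va st' y = va st y;
  am_tk : tk st' = tk st;
  am_ar : forall k q i, k != kTgt -> ar st' k q i = ar st k q i;
  am_tgt : forall y, ~~ child_of x y -> ar st' kTgt 0 y = ar st kTgt 0 y;
  am_PP : forall y, ar st' kTgt 0 y < PP;
  am_child : forall p, p \in c -> ar st' kTgt 0 (ch p.1 x) = pair_code p.2
}.

Lemma wp_aim x c st : 0 < x < cnt -> valid ch x c -> va st vV = x ->
  (forall e y, ar st kCh e y = ch e y) -> (forall y, ar st kTgt 0 y < PP) ->
  wp (foreach c (fun p => Put kTgt (Ld kCh (Cst (nat_of_ord p.1)) (Var vV))
                                 (Cst (pair_code p.2)))) (aimed x c st) st.
Proof.
move=> xP /and3P[_ cU /forallP cL] Ex Ech tP.
have xK : x < KN by have := cnt_lt_KN KN_ge rP; move: xP; clear; lia.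
apply: (wp_foreach (I := fun c' => aimed x c' st)) => //.
move=> done p rest st' Ec pc [V K A T P R].
have n0 : ch p.1 x != 0 by rewrite -(eqP (cL p.1)); apply: map_f.
have yP := child_bounds cP xP n0.
have yK : ch p.1 x < KN by have := cnt_lt_KN KN_ge rP; move: yP; clear; lia.
have eP : p.1 < PP by have := ltn_ord p.1; have := PP_gt; clear; lia.
have qP : pair_code p.2 < PP.
  by have := pair_code_lt p.2; have := PP_gt; clear; lia.
apply: wp_sto.
  rewrite /= V Ex A // Ech PP0 xK yK eP (ltn_trans eP) // (ltn_trans qP) //.
  by rewrite (ltnW B1).
rewrite /= V Ex A // Ech; split=> //=.
- by move=> k q i /negPf kP; rewrite kP /= A // kP.
- move=> y yn; case: eqP => [Ey|_]; last exact: T.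
  by case/child_ofP: yn; exists p.1.
- by move=> y; case: eqP.
- move=> p'; rewrite mem_rcons inE => /orP[/eqP->|p'd]; first by rewrite eqxx.
  have p'c : p' \in c by rewrite Ec mem_cat p'd.
  case: eqP => [E|_]; last exact: R.
  have n0' : ch p'.1 x != 0 by rewrite E.
  have [_ E1] := child_inj cP xP xP n0' E.
  move: cU; rewrite /symbols Ec map_cat cat_uniq => /and3P[_ /hasPn H _].
  have := H p.1; rewrite /= inE eqxx => /(_ isT) /negP; case.
  by rewrite -E1; apply: map_f.
Qed.

Definition row st x (c : choice sigma) : Prop :=
  [/\ ar st kOut 0 (x * (sigma + 2)) = ar st1 kPos 0 x,
      ar st kOut 0 (x * (sigma + 2) + 1) = size (w x)
    & forall e : 'I_sigma,
      ar st kOut 0 (x * (sigma + 2) + (2 + e)) = rank c e].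

(** The written row together with the choice behind it. Finiteness of the target guarantees that
    such a choice exists, and the last clause hands the targets down to the children. *)
Definition good st x : Prop :=
  exists c ab, [/\ ar st kTgt 0 x = pair_code ab, F ab x < n, row st x c
    & uniq (symbols c) /\ (d \notin w x -> [/\ valid ch x c, choice_ends d c =
      ab,
         cost F ch x c = F ab x
       & forall p, p \in c -> ar st kTgt 0 (ch p.1 x) = pair_code p.2])].

Definition below (st : state) : Prop :=
  [/\ forall y, y \notin [:: vM; vJ; vV] -> va st y = va st2 y,
      forall k q i, k \notin [:: kTgt; kOut] -> ar st k q i = ar st2 k q i
    & forall y, ar st kTgt 0 y < PP].

Section Row.

Variables (x : nat) (ab : 'I_sigma * 'I_sigma) (st : state).
Hypothesis xP : 0 < x < cnt.
Hypothesis bP : below st.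
Hypothesis st_v : va st vV = x.
Hypothesis st_t : ar st kTgt 0 x = pair_code ab.
Hypothesis Fx : F ab x < n.

Record rowed (st' : state) : Prop := Rowed {
  rw_va : forall y, y != vM -> va st' y = va st y;
  rw_tk : tk st' = tk st;
  rw_ar : forall k q i, k \notin [:: kTgt; kOut] -> ar st' k q i = ar st k q i;
  rw_tgt : forall y, ~~ child_of x y -> ar st' kTgt 0 y = ar st kTgt 0 y;
  rw_PP : forall y, ar st' kTgt 0 y < PP;
  rw_out : forall y k, y != x -> k < sigma + 2 ->
    ar st' kOut 0 (y * (sigma + 2) + k) = ar st kOut 0 (y * (sigma + 2) + k);
  rw_good : good st' x
}.

Let st1E k q i : k \notin [:: kCost; kTgt; kOut] -> ar st k q i = ar st1 k q i.
Proof.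
move=> kP; have [[_ A1] _ _ _] := btP; have [_ A _] := bP.
rewrite A ?A1 //; move: kP; rewrite !inE !negb_or => /and3P[k1 k2 k3] //.
by rewrite k2.
Qed.

Let xK : x < KN.
Proof. by have := cnt_lt_KN KN_ge rP; move: xP; clear; lia. Qed.

Let not_self : ~~ child_of x x.
Proof.
apply/child_ofP => -[e E]; have n0 : ch e x != 0 by rewrite E; lia.
by have := child_neq rP xP n0; rewrite -/ch E eqxx.
Qed.

Definition matched (c : choice sigma) : Prop :=
  [/\ valid ch x c, choice_ends d c = ab & cost F ch x c = F ab x].

Record ended (st3 : state) (c : choice sigma) (st' : state) : Prop := Ended {
  en_va : forall y, va st' y = va st3 y;
  en_tk : tk st' = tk st3;
  en_ar : forall k q i, k \notin [:: kTgt; kOut] -> ar st' k q i = ar st3 k q i;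
  en_tgt : forall y, ~~ child_of x y -> ar st' kTgt 0 y = ar st3 kTgt 0 y;
  en_PP : forall y, ar st' kTgt 0 y < PP;
  en_out : forall i, (forall e : 'I_sigma, i <> x * (sigma + 2) + (2 + e)) ->
    ar st' kOut 0 i = ar st3 kOut 0 i;
  en_rank : forall e : 'I_sigma, ar st' kOut 0 (x * (sigma + 2) + (2 + e)) =
    rank c e;
  en_child : d \notin w x ->
    forall p, p \in c -> ar st' kTgt 0 (ch p.1 x) = pair_code p.2
}.

Lemma wp_row : wp (row_code sigma) rowed st.
Proof.
have xl : x < cnt by case/andP: xP.
have [bV bA bT] := bP; have [[_ A1] L2 S2 _] := btP.
have qP : pair_code ab < PP by rewrite -st_t.
apply: wp_sq; apply: wp_asg; first by rewrite /= st_v st_t PP0 xK qP (ltnW B1).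
rewrite /= st_v st_t bA // -/(Fof st2 ab x).
have xm0 : x * (sigma + 2) + 0 < KN by apply: row_lt; rewrite // addn2.
have xm1 : x * (sigma + 2) + 1 < KN by apply: row_lt; rewrite // addn2.
have xmB : x * (sigma + 2) < B by move: xm0 B_gt; clear; lia.
have smB : sigma + 2 < B.
  by have := n_gt0 size_s; move: KN_ge B_gt (sigma_gt0 d); clear; nia.
have B0 : 0 < B by rewrite ltnW.
apply: wp_sq; apply: wp_sto.
  by rewrite /= st_v PP0 B0 xK smB xmB xm0 (ltn_trans xm0).
rewrite /= st_v addn0 st1E //.
apply: wp_sq; apply: wp_sto.
  rewrite /= st_v st1E // (r_len rP) // PP0 B0 B1 xK smB xmB xm1.
  by rewrite (ltn_trans xm1).
rewrite /= st_v st1E // (r_len rP) // subn1 /=.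
set st3 := seta _ _ _ _ _.
have V3 y : y != vM -> va st3 y = va st y by move=> /negPf yP; rewrite /= yP.
have M3 : va st3 vM = F ab x by [].
have V3v : va st3 vV = x by rewrite V3.
have A3 k q i : k != kOut -> ar st3 k q i = ar st k q i.
  by move=> /negPf kP; rewrite /= kP.
have m0 : 0 < sigma + 2 by rewrite addn2.
have m1 : 1 < sigma + 2 by rewrite addn2.
have O3 y k : y != x -> k < sigma + 2 ->
    ar st3 kOut 0 (y * (sigma + 2) + k) = ar st kOut 0 (y * (sigma + 2) + k).
  move=> /eqP yx kl /=; case: eqP => [/(row_inj kl m1)[]//|_].
  case: eqP => // E; have := E; rewrite -[RHS]addn0 => /(row_inj kl m0)[]//.
have R3 : ar st3 kOut 0 (x * (sigma + 2)) = ar st1 kPos 0 x.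
  rewrite /= eqxx; case: eqP => // E; have := E.
  by rewrite -[LHS]addn0 => /addnI.
have R3' : ar st3 kOut 0 (x * (sigma + 2) + 1) = size (w x) by rewrite /= eqxx.
have finish c st' : uniq (symbols c) -> (d \notin w x -> matched c) ->
    ended st3 c st' -> rowed st'.
  move=> cU cM [V K A T P O R H]; split=> //.
  - by move=> y yM; rewrite V V3.
  - by move=> k q i kP; rewrite A // A3 //; move: kP;
      rewrite !inE negb_or => /andP[].
  - move=> y k yx kl; rewrite O ?O3 // => e E.
    have el : 2 + e < sigma + 2 by rewrite addnC ltn_add2r.
    by have [E' _] := row_inj kl el E; rewrite E' eqxx in yx.
  - exists c, ab; rewrite T // A3 //; split=> //.
      split=> //.
        rewrite O // => e; rewrite -[LHS]addn0 => /addnI; clear; lia.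
      rewrite O // => e /addnI; clear; lia.
    split=> // dx; have [v1 v2 v3] := cM dx; split=> //; exact: H.
clearbody st3.
have EL : eval leaf_expr st3 = (d \in w x).
  have -> : eval leaf_expr st3 = (ar st3 kPos 0 (va st3 vV)
      + ar st3 kLen 0 (va st3 vV) == va st3 vN + 1) by [].
  rewrite V3v V3 // bV // (proj1 (bt_kept btP)) // (r_n rP) !A3 // !st1E //.
  by rewrite (leaf_end dt size_s rP xP).
have xlen : size (w x) <= n by rewrite -size_s;
  apply: (expl_size (c_expl cP xP)).
have posn := r_pos rP xl.
have nB3 : n + n + 2 < B.
  have H : 2 * n + 2 <= KN.
    by apply: leq_trans KN_ge; rewrite leq_pmulr.
  by move: H B_gt; clear; lia.
have Tst y : ar st3 kTgt 0 y < PP by rewrite A3.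
apply: wp_ite.
- rewrite /= V3v V3 // bV // (proj1 (bt_kept btP)) //.
  rewrite (r_n rP) !A3 // !st1E // (r_len rP) //.
  rewrite PP0 B0 xK B1 /=; move: posn xlen nB3; clear; lia.
- rewrite EL eqb0 negbK => dx.
  apply: wp_mono (wp_ranks xP (c := [::]) isT V3v) => st' [V K A O R].
  apply: (finish [::]) => //; first by rewrite dx.
  split=> //.
  + by move=> k q i kP; rewrite A //; move: kP; rewrite !inE negb_or => /andP[].
  + by move=> y _; rewrite A.
  + by move=> y; rewrite A.
  + by move=> e; apply: R; rewrite mem_enum.
rewrite EL => /eqP; rewrite eqb0 => dx.
have [_ /(_ dx)[_ hi]] := S2 x xP.
pose I (done : seq (choice sigma)) st' :=
  [/\ forall y, va st' y = va st3 y,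
      tk st' = tk st3,
      forall k q i, k \notin [:: kTgt; kOut] -> ar st' k q i = ar st3 k q i,
      (forall y, ~~ child_of x y -> ar st' kTgt 0 y = ar st3 kTgt 0 y) /\
      (forall y, ar st' kTgt 0 y < PP)
    & (forall i, (forall e : 'I_sigma, i <> x * (sigma + 2) + (2 + e)) ->
         ar st' kOut 0 i = ar st3 kOut 0 i) /\
      ((exists2 c, c \in done & matched c) ->
        exists c, matched c /\ ended st3 c st')].
apply: (wp_foreach (I := I)).
- by split=> //; split=> // -[c].
- move=> done c rest st' _ cC [V K A [T P] [O G]].
  have c0 : c != [::] by move: cC; rewrite mem_choices => /andP[].
  have cU : uniq (symbols c) by move: cC; rewrite mem_choices => /andP[].
  have Vv : va st' vV = x by rewrite V.
  have Ach e y : ar st' kCh e y = ch e y by rewrite A // A3 // st1E.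
  have AF q y : ar st' kCost q y = ar st2 kCost q y by rewrite A // A3 // bA.
  have Ale q y : ar st' kCost q y <= n by rewrite AF.
  have [E1 E2] := valid_exprP size_s KN_ge B_gt PP_lt PP_gt rP cC xP Vv Ach.
  have skip : ~ matched c -> wp Skip (I (rcons done c)) st'.
    move=> nm; apply: wp_skip; split=> //; split=> // -[c'].
    rewrite mem_rcons inE => /orP[/eqP->|c'd] m; first by case: nm.
    by apply: G; exists c'.
  apply: wp_ite => //; rewrite E2; last first.
    by move=> /eqP; rewrite eqb0 => v0; apply: skip => -[v1 _ _];
      rewrite v1 in v0.
  case vc: (valid ch x c) => // _.
  have [S1 E3 ltB] := cost_exprP dt size_s KN_ge B_gt PP_lt PP_gt rP cC xP vc
    Vv Ach Ale.
  have Ecost : cost (Fof st') ch x c = cost F ch x c.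
    by apply: (eq_cost _ vc) => q e _; apply: AF.
  rewrite Ecost in E3 ltB.
  have eP : end_code c < B.
    apply: ltn_trans PP_lt; rewrite (end_codeE d c0).
    by have := pair_code_lt (choice_ends d c); move: PP_gt; clear; lia.
  have Tx : ar st' kTgt 0 x = pair_code ab by rewrite T // A3.
  have Mx : va st' vM = F ab x by rewrite V.
  apply: wp_ite; first by rewrite /= Vv PP0 B0 xK eP.
    rewrite /= Vv Tx eqb0 negbK (end_codeE d c0) => /eqP/pair_code_inj Eab.
    apply: wp_ite; first by rewrite /= S1.
      rewrite /= E3 Mx eqb0 negbK => /eqP EF.
      apply: wp_sq; apply: wp_mono (wp_aim xP vc Vv Ach P).
      move=> st4 [V4 K4 A4 T4 P4 C4].
      have V4v : va st4 vV = x by rewrite V4.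
      apply: wp_mono (wp_ranks xP cU V4v) => st5 [V5 K5 A5 O5 R5].
      have en : ended st3 c st5.
        split.
        + by move=> y; rewrite V5 V4.
        + by rewrite K5 K4.
        + move=> k q i kP; rewrite A5 ?A4 ?A //;
            by move: kP; rewrite !inE negb_or => /andP[].
        + by move=> y yc; rewrite A5 // T4 // T.
        + by move=> y; rewrite A5.
        + by move=> i iP; rewrite O5 // A4 // O.
        + by move=> e; apply: R5; rewrite mem_enum.
        + by move=> _ p pc; rewrite A5 // C4.
      have [e1 e2 e3 e4 e5 e6 e7 e8] := en.
      by split=> //; split=> // _; exists c.
    rewrite /= E3 Mx => /eqP; rewrite eqb0 => /eqP ne; apply: skip => -[_ _ E].
    by case: ne.
  rewrite /= Vv Tx (end_codeE d c0) => /eqP; rewrite eqb0 => /eqP ne.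
  by apply: skip => -[_ E _]; case: ne; rewrite E.
move=> st' [V K A [T P] [O G]].
(* Attainment in [solved] provides a choice that passes the three tests, so the row has been
   written. *)
have [c [vc Ec Ecost]] := hi ab Fx.
have [|c' [m' en]] := G.
  by exists c => //; rewrite mem_choices; case/and3P: vc => -> ->.
apply: (finish c') => //.
by case: m' => /and3P[].
Qed.

End Row.

Lemma child_row_neq x y (e : 'I_sigma) : 0 < x < cnt -> 0 < y < cnt -> y != x ->
  ch e y != 0 -> ~~ child_of x (ch e y).
Proof.
move=> xP yP /eqP yx n0; apply/child_ofP => -[e' E].
by have [] := child_inj cP yP xP n0 (esym E).
Qed.

(** A node has one parent, so the targets written at [x] belong to no child of [y], and rows of
    different nodes are disjoint. *)
Lemma good_stable x y st st' : 0 < x < cnt -> 0 < y < cnt -> y != x ->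
  ~~ child_of x y -> rowed x st st' -> good st y -> good st' y.
Proof.
move=> xP yP yx yc R [c [ab [T Fy [r1 r2 r3] [cU cM]]]].
have O k : k < sigma + 2 ->
    ar st' kOut 0 (y * (sigma + 2) + k) = ar st kOut 0 (y * (sigma + 2) + k).
  by move=> kl; apply: (rw_out R).
exists c, ab; rewrite (rw_tgt R) //; split=> //.
  split=> [|| e]; last by rewrite O // addnC ltn_add2r.
    by rewrite -[_ * _]addn0 O ?addn0 // addn2.
  by rewrite O // addn2.
split=> // dy; have [vc Ec Ecost H] := cM dy; split=> // p pc.
have /and3P[_ _ /forallP cL] := vc.
have n0 : ch p.1 y != 0 by rewrite -(eqP (cL p.1)); apply: map_f.
by rewrite (rw_tgt R) ?H //; apply: child_row_neq.
Qed.

Lemma pair_code_surj q : q < sigma * sigma ->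
  exists ab : 'I_sigma * 'I_sigma, q = pair_code ab.
Proof.
move=> qs; have s0 := sigma_gt0 d.
have al : q %/ sigma < sigma by rewrite ltn_divLR.
have bl : q %% sigma < sigma by rewrite ltn_mod.
by exists (Ordinal al, Ordinal bl); rewrite /pair_code /= -divn_eq.
Qed.

Definition rooted (st : state) : Prop :=
  exists ab, [/\ ar st kTgt 0 1 = pair_code ab, F ab 1 < n
    & forall ab', F ab 1 <= F ab' 1].

Lemma wp_root : (exists ab, F ab 1 < n) ->
  wp (root_code sigma) (fun st => [/\ below st, rooted st & tk st = tk st2])
    st2.
Proof.
move=> [ab0 F0]; have [[V1 A1] L2 _ _] := btP.
have oneP : 0 < 1 < cnt by have := c_cnt cP.
have oneK : 1 < KN by have := cnt_lt_KN KN_ge rP; move: oneP; clear; lia.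
apply: wp_sq; apply: wp_asg; first by [].
rewrite /= V1 // (r_n rP).
pose I (done : seq nat) st := [/\ below st, tk st = tk st2,
  va st vM <= n, forall q, q \in done -> va st vM <= ar st2 kCost q 1
  & va st vM < n -> exists2 ab, ar st kTgt 0 1 = pair_code ab & F ab 1 = va st
    vM].
apply: (wp_foreach (I := I)).
- split=> //=; last by rewrite ltnn.
  split=> //=; first by move=> y; rewrite inE negb_or => /andP[/negPf->].
  by move=> y; rewrite A1 // (r_tgt rP).
- move=> done q rest st _ + [[V A T] K Mn H G].
  rewrite mem_iota add0n => /= qs.
  have qP : q < PP by move: qs PP_gt; clear; lia.
  have qB := ltn_trans qP PP_lt.
  have Aq : ar st kCost q 1 = ar st2 kCost q 1 by rewrite A.
  apply: wp_ite; first by rewrite /= qP qB oneK B1.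
    rewrite /= Aq eqb0 negbK => lt.
    apply: wp_sq; apply: wp_asg; first by rewrite /= qP qB oneK B1.
    rewrite /= Aq; apply: wp_sto; first by rewrite /= PP0 oneK B1 (ltnW B1) qB.
    split=> //=.
    + split=> //=.
      * move=> y yP; rewrite -(V y yP); move: yP; rewrite inE negb_or.
        by case/andP=> /negPf->.
      * move=> k q' i kP; rewrite -(A k q' i kP); move: kP; rewrite inE negb_or.
        by case/andP=> /negPf->.
      * by move=> y; case: eqP.
    + move=> q'; rewrite mem_rcons inE => /orP[/eqP->//|/H le].
      exact: leq_trans (ltnW lt) le.
    + by move=> _; have [ab Eq] := pair_code_surj qs; exists ab;
        rewrite // /Fof -Eq.
  rewrite /= Aq => /eqP; rewrite eqb0 -leqNgt => le.
  apply: wp_skip; split=> // q'.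
  by rewrite mem_rcons inE => /orP[/eqP->//|]; apply: H.
move=> st [bP K Mn H G]; split=> //.
have Hab ab : va st vM <= F ab 1.
  by apply: H; rewrite mem_iota add0n pair_code_lt.
have [ab E1 E2] := G (leq_ltn_trans (Hab ab0) F0).
by exists ab; split; rewrite // E2 //; apply: leq_ltn_trans (Hab ab0) F0.
Qed.

Record topped (st : state) : Prop := Topped {
  tp_below : below st;
  tp_good : forall x, 0 < x < cnt -> good st x;
  tp_root : rooted st;
  tp_tk : tk st = tk st2 + size l
}.

(** Passes finiteness from the target of a node to the targets of its children. *)
Lemma cost_ge_part (c : choice sigma) x p : p \in c -> F p.2 (ch p.1 x) <= cost
  F ch x c.
Proof.
move=> pc; rewrite /cost; apply: leq_trans (leq_addr _ _).
elim: c pc => //= q c IH; rewrite inE big_cons => /orP[/eqP->|/IH H].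
  exact: leq_addr.
exact: leq_trans H (leq_addl _ _).
Qed.

Lemma wp_top : (exists ab, F ab 1 < n) -> wp (top_code sigma) topped st2.
Proof.
move=> F0; have [[V1 A1] L2 _ _] := btP.
have szl := order_size rP; have cK := cnt_lt_KN KN_ge rP.
apply: wp_sq; apply: wp_mono (wp_root F0) => st3 [b3 r3 k3].
apply: wp_sq; apply: wp_asg; first by rewrite /= ltnW.
set st4 := setv _ _ _.
pose I st := [/\ below st, rooted st, va st vJ <= size l,
  forall i, i < va st vJ -> good st (nth 0 l i) & tk st = tk st2 + va st vJ].
have ET st : below st -> va st vT = size l.
  by move=> [V _ _]; rewrite V // V1 // (r_T rP).
apply: (@wp_whl _ _ _ I (fun st => size l - va st vJ)).
- split=> //; last by rewrite /= k3 addn0.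
  have [V A T] := b3; split=> // y yP; rewrite -(V y yP) /=.
  by move: yP; rewrite !inE !negb_or => /and3P[_ /negPf->].
- by [].
- move=> st [bP r jl H T] /= /eqP; rewrite eqb0 -leqNgt (ET _ bP) => le.
  have Ej : va st vJ = size l by apply/eqP; rewrite eqn_leq jl le.
  split=> //; last by rewrite T Ej.
  move=> x; rewrite -(bo_mem (r_order rP)) => xl.
  by rewrite -(nth_index 0 xl); apply: H; rewrite Ej index_mem.
move=> st [bP r _ H T] /=; rewrite eqb0 negbK (ET _ bP) => jl.
set j := va st vJ in jl H T *.
have [V A P] := bP.
have Ex : ar st kOrd 0 j = nth 0 l j by rewrite A // A1 // (r_ord rP jl).
have jK : j < KN by move: jl szl cK; clear; lia.
apply: wp_sq; apply: wp_asg; first by rewrite /= PP0 -/j jK ltnW.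
rewrite /= -/j Ex; set x := nth 0 l j.
have xP : 0 < x < cnt := order_cnt rP jl.
set st5 := setv _ _ _.
have b5 : below st5.
  split=> // y yP; rewrite -(V y yP) /=.
  by move: yP; rewrite !inE !negb_or => /and3P[_ _ /negPf->].
have v5 : va st5 vV = x by [].
(* Except at the root, the target was written by the parent, which stands earlier in the order. *)
have [ab Tx Fx] : exists2 ab, ar st5 kTgt 0 x = pair_code ab & F ab x < n.
  have [E|ne] := x =P 1.
    by have [ab [E1 E2 _]] := r; exists ab; rewrite // E.
  have [i ij [e Ee]] := bo_parent (r_order rP) jl ne.
  have il : i < size l by apply: ltn_trans jl.
  have [c [ab' [_ Fi _ [_ cM]]]] := H _ ij.
  set y := nth 0 l i in Ee Fi cM.
  have yP : 0 < y < cnt := order_cnt rP il.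
  have n0 : ch e y != 0 by rewrite /ch Ee -/x; move: xP; clear; lia.
  have dy : d \notin w y.
    by apply/negP => dy; rewrite (leaf_childless dt cP _ yP dy) in n0.
  have [vc Ec Ecost Hc] := cM dy.
  have /and3P[_ _ /forallP cL] := vc.
  have /mapP[p pc Ep] : e \in symbols c by rewrite (eqP (cL e)).
  exists p.2.
    by have := Hc p pc; rewrite -Ep /ch Ee.
  by apply: leq_ltn_trans Fi; rewrite -Ecost -[x]Ee Ep;
    apply: (cost_ge_part y pc).
apply: wp_sq; apply: wp_mono (wp_row xP b5 v5 Tx Fx) => st6 R6.
have Ej6 : va st6 vJ = j by rewrite (rw_va R6).
apply: wp_asg; first by rewrite /= Ej6 B1; move: jK B_gt; clear; lia.
rewrite /= Ej6 addn1; split; last by move: jl; clear; lia.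
set st7 := tick _.
have b7 : below st7.
  split=> [y yP|k q i kP|y].
  - have [V5 _ _] := b5; rewrite -(V5 y yP) /=.
    move: yP; rewrite !inE !negb_or => /and3P[yM /negPf-> yV].
    by rewrite (rw_va R6).
  - have [_ A5 _] := b5; rewrite -(A5 _ _ _ kP) /=.
    by rewrite (rw_ar R6).
  - exact: (rw_PP R6).
split=> //.
- have [ab1 [E1 E2 E3]] := r; exists ab1; split=> //.
  rewrite /= (rw_tgt R6) //; apply/child_ofP => -[e E].
  by case: (child_ne1 cP xP E).
- move=> i; rewrite /= ltnS leq_eqVlt => /orP[/eqP->|ij].
    exact: (rw_good R6).
  have il : i < size l by apply: ltn_trans jl.
  have yP : 0 < nth 0 l i < cnt := order_cnt rP il.
  have yx : nth 0 l i != x.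
    by apply/eqP => /(nth_order_inj rP il jl) E; rewrite E ltnn in ij.
  have yc : ~~ child_of x (nth 0 l i).
    apply/child_ofP => -[e E].
    have n0 : ch e x != 0 by rewrite E; move: yP; clear; lia.
    have [k /andP[jk kl] Ek] := bo_child (r_order rP) jl n0.
    have := nth_order_inj rP kl il; rewrite Ek -/x -/ch E => /(_ erefl) Eki.
    by move: ij jk; rewrite Eki; clear; lia.
  have := good_stable xP yP yx yc R6; apply; exact: H.
- by rewrite /= (rw_tk R6) /= T addnS.
Qed.

End Top.

(** * The program *)

(** A nonempty input has [2 * n + 2 <= 4 * n], so [n] times this factor holds a row for every
    node. *)
Definition array_factor (sigma : nat) : nat := 4 * (sigma + 2).

Definition params (sigma : nat) : nat := sigma * sigma + 2 * sigma + 1.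

(* Register 0 becomes the address of the row of the root, which is node [1]. *)
Definition main_cmd (sigma : nat) : cmd :=
  build_code sigma ;; child_code ;; bfs_code sigma ;; bottom_code sigma ;;
  top_code sigma ;;
  Asg 1 (Op OSub (Var vCnt) (Cst 1)) ;;
  Asg 0 (Op OAdd (Op OMul (Var vN) (Cst (array_factor sigma * kOut)))
           (Cst (sigma + 2))).

(** The first two instructions put the array length into register [nvar], where [address_code]
    expects it. *)
Definition main_program (sigma : nat) : program :=
  [:: Const nvar.+1 (array_factor sigma); Bin Mul nvar 0 nvar.+1]
  ++ cmd_code (main_cmd sigma) 2 ++ [:: Halt].

Definition natural_family (sigma : nat) : order_family sigma :=
  fun _ a b => a <= b.

Lemma natural_total sigma :
  total_order (fun a b : 'I_sigma => a <= b).
Proof.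
split; first by move=> x y; apply: leq_total.
  by move=> x y /anti_leq/val_inj.
by move=> x y z; apply: leq_trans.
Qed.

Lemma eq_ctree sigma (s : seq 'I_sigma) cnt w ch ch' :
  (forall e x, ch' e x = ch e x) -> ctree s cnt w ch -> ctree s cnt w ch'.
Proof.
move=> E [H1 H2 H3 H4 H5 H6 H7 H8]; split=> //.
- by move=> x e xP; rewrite E; apply: H6.
- by move=> x e xP; rewrite E; apply: H7.
- by move=> y /H8[x [e [xP <-]]]; exists x, e; rewrite E.
Qed.

Lemma eq_bfs_order sigma cnt ch ch' l : (forall e x, ch' e x = ch e x) ->
  bfs_order sigma cnt ch l -> bfs_order sigma cnt ch' l.
Proof.
move=> E [H1 H2 H3 H4]; split=> //.
- by move=> j e jl; rewrite E; apply: H3.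
- by move=> k kl /(H4 k kl)[j jk [e Ee]]; exists j => //; exists e; rewrite E.
Qed.

(** * Composition of the passes *)

Section Main.

Variables (sigma : nat) (t : seq 'I_sigma) (d : 'I_sigma).
Hypothesis dt : d \notin t.

Notation s := (rcons t d).

Variables (n B KN PP : nat).

Hypothesis size_s : size s = n.
Hypothesis KN_E : KN = n * array_factor sigma.
Hypothesis PP_E : PP = params sigma.
Hypothesis B_ge : 2 * KN * (nkind * PP) <= B.

Local Notation wp := (wp B KN PP).

Let n0 : 0 < n. Proof. exact: n_gt0 size_s. Qed.

Let KN_ge : (2 * n + 2) * (sigma + 2) <= KN.
Proof. by rewrite KN_E /array_factor; move: n0; clear; nia. Qed.

Let B_gt : KN < B.
Proof.
have : 0 < KN by rewrite KN_E /array_factor muln_gt0 n0 addn2.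
by move: B_ge; rewrite PP_E /params; clear; nia.
Qed.

Let PP_gt : sigma * sigma + 2 * sigma < PP.
Proof. by rewrite PP_E /params addn1. Qed.

Let PP_lt : PP < B.
Proof.
have : 0 < KN by rewrite KN_E /array_factor muln_gt0 n0 addn2.
by move: B_ge; rewrite PP_E /params; clear; nia.
Qed.

Definition start : state :=
  State (fun x => if x == 0 then n else 0)
    (fun k q x => if (k == 0) && (q == 0) then nth 0 [seq val a | a <- s] x
      else 0)
    0.

Lemma start_input j (c : 'I_sigma) z : drop j s = c :: z ->
  ar start kS 0 j = c.
Proof.
move=> E; rewrite /= -[j]addn0 -nth_drop -map_drop E /=.
by [].
Qed.

Section Optimality.

Variables (st1 : state) (cnt : nat) (w : nat -> seq 'I_sigma) (l : seq nat).
Variables (st2 : state).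
Hypothesis rP : ready t d n st1 cnt w l.
Hypothesis bP : bottomed t d n st1 cnt w l st2.

Let cP := r_tree rP.
Let F := @Fof sigma st2.

Let oneP : 0 < 1 < cnt. Proof. by have := c_cnt cP. Qed.

Lemma F_leaf x j : 0 < x < cnt -> j < size s -> w x = drop j s ->
  F (prev t d j, prev t d j) x = 0 /\
  forall ab, F ab x < size s -> ab = (prev t d j, prev t d j).
Proof. by move=> xP; rewrite size_s; apply: (proj1 (bt_solved bP xP)). Qed.

Lemma F_le x c : 0 < x < cnt -> d \notin w x -> valid (ar st1 kCh) x c ->
  F (choice_ends d c) x <= cost F (ar st1 kCh) x c.
Proof.
by move=> xP dx; have [H _] := proj2 (bt_solved bP xP) dx; apply: H.
Qed.

Lemma root_bound pi : context_adaptive pi ->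
  exists ab, F ab 1 <= changes d (segment t d pi [::]).
Proof.
move=> piP; exists (ends d (segment t d pi (w 1))).
by rewrite -(c_root cP); apply: (lower_bound dt cP F_leaf F_le piP oneP).
Qed.

Lemma root_segment_neq0 pi : segment t d pi [::] != [::].
Proof. by have := segment_neq0 cP pi oneP; rewrite (c_root cP). Qed.

(** Any family will do: its transform has at most [n] symbols and so fewer than [n] changes, and the
    entry for its ends is no larger. *)
Lemma root_finite : exists ab, F ab 1 < n.
Proof.
have natP : context_adaptive (@natural_family sigma).
  by move=> x; apply: natural_total.
have [ab le] := root_bound natP; exists ab; apply: leq_ltn_trans le _.
apply: leq_trans (changes_lt d (root_segment_neq0 _)) _.
by rewrite -size_s; apply: segment_size.
Qed.

Variable st3 : state.
Hypothesis tP : topped d n PP st1 cnt w l st2 st3.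

Definition target x : 'I_sigma * 'I_sigma :=
  odflt (d, d) [pick ab | pair_code ab == ar st3 kTgt 0 x].

Lemma targetE x ab : ar st3 kTgt 0 x = pair_code ab -> target x = ab.
Proof.
rewrite /target => ->; case: pickP => [ab' /eqP/pair_code_inj //|/(_ ab)].
by rewrite eqxx.
Qed.

(** At the root [realized] gives exactly the least entry of the table, and [root_bound] puts some
    entry below the changes of any competing family. *)
Lemma family_optimal pi : context_adaptive pi ->
  (forall x c, 0 < x < cnt -> row st1 w st3 x c ->
     forall a b, pi (w x) a b = (rank c a <= rank c b)) ->
  minimizes_runs s pi.
Proof.
move=> piP piE; split=> // pi' pi'P.
rewrite !bwt_segment !(runs_changes d) ?root_segment_neq0 // ltnS.
have tgtP x : 0 < x < cnt -> F (target x) x < size s.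
  by move=> xP; have [c [ab [Et Fx _ _]]] := tp_good tP xP;
    rewrite (targetE Et) size_s.
have chosenP x : 0 < x < cnt -> d \notin w x ->
  exists c, [/\ valid (ar st1 kCh) x c, choice_ends d c = target x,
      cost F (ar st1 kCh) x c = F (target x) x,
      forall p, p \in c -> target (ar st1 kCh p.1 x) = p.2
    & {in symbols c &, forall e e',
        pi (w x) e e' = (index e (symbols c) <= index e' (symbols c))}].
  move=> xP dx; have [c [ab [Et Fx R [cU /(_ dx)[v1 v2 v3 v4]]]]] := tp_good tP
    xP.
  exists c; rewrite (targetE Et); split=> //.
    by move=> p /v4; apply: targetE.
  by move=> e e' ec e'c; rewrite (piE x c) // /rank ec e'c.
have [_ E] := realized dt cP F_leaf piP tgtP chosenP oneP.
rewrite (c_root cP) in E; rewrite E.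
have [ab le] := root_bound pi'P; apply: leq_trans le.
have [ab1 [Et _ H]] := tp_root tP.
by rewrite (targetE Et); apply: H.
Qed.

End Optimality.

Definition outcome (st : state) : Prop :=
  exists st1 cnt w l st2 st3,
    [/\ ready t d n st1 cnt w l, bottomed t d n st1 cnt w l st2,
        topped d n PP st1 cnt w l st2 st3 /\
          (forall k q x, ar st k q x = ar st3 k q x),
        va st 0 = KN * kOut + (sigma + 2) /\ va st 1 = cnt - 1
      & tk st <= 21 * n].

Lemma wp_main : wp (main_cmd sigma) outcome start.
Proof.
have KN2 : 2 * n + 2 <= KN.
  by apply: leq_trans KN_ge; rewrite leq_pmulr // addn2.
have sP : sigma < PP by move: PP_gt; clear; lia.
apply: wp_sq.
have z0 k q x : k != kS -> ar start k q x = 0 by move=> /negPf kP;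
  rewrite /= kP.
apply: wp_mono (wp_build size_s n0 KN2 B_gt PP_lt sP start_input erefl erefl
  z0).
move=> stA bA.
have chz e x : ar start kCh e x = 0 by [].
apply: wp_sq; apply: wp_mono (wp_child size_s n0 KN2 B_gt PP_lt sP start_input
  bA chz).
move=> stB cB.
have cntA : va stA vCnt <= 2 * n + 2 by have := b_cnt bA; rewrite subn0.
have cK : va stA vCnt <= KN by apply: leq_trans KN2.
apply: wp_sq; apply: wp_mono (wp_bfs size_s n0 KN2 B_gt PP_lt sP (ch_tree cB)
  cK).
move=> stC [l [L oC tC]].
have AC k q x : k != kOrd -> k != kCh -> ar stC k q x = ar stA k q x.
  by move=> k1 k2; rewrite (li_ar L) // (ch_ar cB).
have Ech e x : ar stC kCh e x = ar stB kCh e x by rewrite (li_ar L).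
have rC : ready t d n stC (va stA vCnt) (wordat s stA) l.
  split.
  - by rewrite (li_va L) // (ch_va cB) // (b_n bA).
  - by rewrite (li_va L) // (ch_va cB).
  - exact: li_size L.
  - exact: cntA.
  - by move=> j c z E; rewrite AC // (b_frame bA) // (start_input E).
  - exact: eq_ctree Ech (ch_tree cB).
  - by move=> x xl; rewrite AC // (b_pos bA).
  - by move=> x /andP[x0 xl]; rewrite AC // (b_len bA) // tlenS.
  - move=> x /andP[x0 xl]; rewrite AC // {1}/wordat (b_len bA) //.
    by rewrite tlenS.
  - exact: eq_bfs_order Ech oC.
  - exact: li_order L.
  - by move=> q x; rewrite AC // (b_frame bA).
  - by move=> q x; rewrite AC // (b_frame bA).
apply: wp_sq; apply: wp_mono (wp_bottom dt size_s KN_ge B_gt PP_lt PP_gt rC).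
move=> stD bD.
apply: wp_sq; apply: wp_mono (wp_top dt size_s KN_ge B_gt PP_lt PP_gt rC bD
  (root_finite rC bD)).
move=> stE tE.
have [VE _ _] := tp_below tE; have [VD _] := bt_kept bD.
have Ecnt : va stE vCnt = va stA vCnt by rewrite VE // VD // (r_cnt rC).
have En : va stE vN = n by rewrite VE // VD // (r_n rC).
have cnt1 := c_cnt (r_tree rC).
have KB : KN * 16 * 2 <= B by move: B_ge; rewrite PP_E /params; clear; nia.
have E9 : n * (array_factor sigma * kOut) = KN * kOut by rewrite mulnA -KN_E.
have f9 : array_factor sigma * kOut <= KN * kOut.
  by rewrite leq_mul2r KN_E leq_pmull ?orbT.
have s2 : sigma + 2 <= KN.
  by apply: leq_trans KN_ge; rewrite leq_pmull // addn2.
have KN0 : 0 < KN by apply: leq_trans s2; rewrite addn2.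
apply: wp_sq; apply: wp_asg.
  by rewrite /= Ecnt; move: cnt1 KB KN0; clear; lia.
rewrite /= Ecnt; apply: wp_asg.
  by rewrite /= En E9; move: f9 s2 KB KN0; clear; lia.
exists stC, (va stA vCnt), (wordat s stA), l, stD, stE.
split=> //; first by rewrite /= En E9.
(* At most [4 * n + 1] ticks for the construction, [2 * n + 2] each for the child table and the
   traversal, and [2 * n + 1] for each pass: [12 * n + 7] in all, within the bound as [n] is
   positive. *)
have T1 := b_time bA; have T2 := ch_tk cB; have T3 := bt_tk bD.
have T4 := tp_tk tE; have szl := order_size rC.
by move: T1 T2 T3 T4 tC szl cntA n0; rewrite subn0 /=; clear; lia.
Qed.

End Main.

(** * The family read from memory *)

Section Output.

Variables (sigma : nat) (t : seq 'I_sigma) (d : 'I_sigma).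

Notation s := (rcons t d).

Variables (n KN PP cnt : nat) (w : nat -> seq 'I_sigma) (l : seq nat).
Variables (st1 st2 st3 : state) (c : config).

Hypothesis size_s : size s = n.
Hypothesis KN_ge : (2 * n + 2) * (sigma + 2) <= KN.
Hypothesis PP_gt0 : 0 < PP.
Hypothesis rP : ready t d n st1 cnt w l.
Hypothesis tP : topped d n PP st1 cnt w l st2 st3.
Hypothesis reg0 : reg c 0 = KN * kOut + (sigma + 2).
Hypothesis reg1 : reg c 1 = cnt - 1.
Hypothesis memE : forall k q i, k < nkind -> q < PP -> i < KN ->
  Defs.mem c (addr KN k q i) = ar st3 k q i.

Let cP := r_tree rP.

Lemma cellE j i : j.+1 < cnt -> i < sigma + 2 ->
  Defs.mem c (reg c 0 + j * (sigma + 2) + i) =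
  ar st3 kOut 0 (j.+1 * (sigma + 2) + i).
Proof.
move=> jl il; rewrite -memE //; last first.
  have := cnt_KN KN_ge rP; have : j.+1 * (sigma + 2) + i < cnt * (sigma + 2).
    apply: leq_trans (_ : j.+2 * (sigma + 2) <= _);
      last by rewrite leq_mul2r jl orbT.
    by rewrite [j.+2 * _]mulSn addnC ltn_add2r.
  by move=> H1 H2; apply: leq_trans H1 H2.
by congr (Defs.mem c _); rewrite reg0 /addr mulSn muln0 addn0 !addnA.
Qed.

Definition context_of (j : nat) : seq 'I_sigma :=
  take (Defs.mem c (reg c 0 + j * (sigma + 2) + 1))
    (rot (Defs.mem c (reg c 0 + j * (sigma + 2) + 0)) s).

(** The stored occurrence of a node does not wrap around, so cutting the rotation is the same as
    cutting the suffix. Entry [j] belongs to node [j.+1], as the table starts at the root. *)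
Lemma context_ofE j : j.+1 < cnt -> context_of j = w j.+1.
Proof.
move=> jl; have xP : 0 < j.+1 < cnt by [].
have m2 : 1 < sigma + 2 by rewrite addn2.
rewrite /context_of !cellE //; last exact: ltnW.
have [ch [ab [_ _ [r0 r1 _] _]]] := tp_good tP xP.
rewrite addn0 r0 r1 /rot takel_cat -?(r_word rP) //.
rewrite size_drop {1}(r_word rP xP) size_take_min size_drop.
exact: geq_minr.
Qed.

(** Different nodes are different words, so the first entry found for [w x] is the row of [x]. *)
Lemma output_node x ch (a b : 'I_sigma) : 0 < x < cnt -> row st1 w st3 x ch ->
  output_family s c (w x) a b = (rank ch a <= rank ch b).
Proof.
move=> xP [_ _ R]; rewrite /output_family reg1.
set P := fun j => _ == w x; set j := find P _.
have PE i : i.+1 < cnt -> P i = (w i.+1 == w x).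
  by move=> il; rewrite -context_ofE.
have x1 : x.-1.+1 = x by rewrite prednK //; case/andP: xP.
have hasP : has P (iota 0 (cnt - 1)).
  apply/hasP; exists x.-1; last by rewrite PE x1 ?eqxx //; case/andP: xP.
  by rewrite mem_iota add0n; move: xP; clear; lia.
have jl : j < cnt - 1 by move: hasP; rewrite has_find size_iota.
have jl' : j.+1 < cnt by move: jl; clear; lia.
have := nth_find 0 hasP; rewrite -/j nth_iota // add0n PE // => /eqP Ew.
have jP : 0 < j.+1 < cnt by [].
have Ej : j.+1 = x := c_inj cP jP xP Ew.
have lt (e : 'I_sigma) : 2 + e < sigma + 2 by rewrite addnC ltn_add2r.
by rewrite jl !cellE // Ej !R.
Qed.

Lemma output_other x (a b : 'I_sigma) : ~~ expl s x ->
  output_family s c x a b = (a <= b).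
Proof.
move=> Ex; rewrite /output_family reg1; set P := fun j => _ == x.
case: ifP => // jl; case/negP: Ex.
have hasP : has P (iota 0 (cnt - 1)) by rewrite has_find size_iota.
have := nth_find 0 hasP; rewrite nth_iota // add0n => /eqP.
have jl' : (find P (iota 0 (cnt - 1))).+1 < cnt by move: jl; clear; lia.
rewrite -/(context_of _) context_ofE // => <-.
exact: (c_expl cP).
Qed.

Lemma output_adaptive : context_adaptive (output_family s c).
Proof.
move=> x; have [Ex|nEx] := boolP (expl s x); last first.
  have E a b : output_family s c x a b = (a <= b) by apply: output_other.
  split; first by move=> a b; rewrite !E leq_total.
    by move=> a b; rewrite !E => /anti_leq/val_inj.
  by move=> b a e; rewrite !E; apply: leq_trans.
have [y yP <-] := c_surj cP Ex.
have [ch [ab [_ _ R [cU _]]]] := tp_good tP yP.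
have E a b : output_family s c (w y) a b = (rank ch a <= rank ch b).
  exact: output_node yP R.
split; first by move=> a b; rewrite !E leq_total.
  by move=> a b; rewrite !E => /anti_leq/(rank_inj cU).
by move=> b a e; rewrite !E; apply: leq_trans.
Qed.

End Output.

(** * The complete program on the word RAM *)

Lemma code_at_program i1 i2 (code : seq instr) :
  code_at ([:: i1; i2] ++ code ++ [:: Halt]) 2 code.
Proof. by move=> i il; rewrite add2n /= nth_cat il. Qed.

Lemma program_end i1 i2 (code : seq instr) :
  nth Halt ([:: i1; i2] ++ code ++ [:: Halt]) (2 + size code) = Halt.
Proof. by rewrite add2n /= nth_cat ltnn subnn. Qed.

(** The input fits into the first block because [n <= n * K], and every other cell is 0, as in
    [start]. *)
Lemma start_agree sigma (t : seq 'I_sigma) d n K PP w code :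
  size (rcons t d) = n -> n < 2 ^ w -> K < 2 ^ w -> n * K < 2 ^ w ->
  n <= n * K -> sigma <= 2 ^ w ->
  let p := [:: Const nvar.+1 K; Bin Mul nvar 0 nvar.+1] ++ code in
  let c := iter 2 (step w p) (init w (rcons t d)) in
  pc c = 2 /\ agree w (n * K) PP (start t d n) (pair_of c).
Proof.
move=> size_s nB KB nKB nK sB p c; split=> //.
have w0 : 0 < 2 ^ w by rewrite expn_gt0.
have symP i : nth 0 [seq val a | a <- rcons t d] i < 2 ^ w.
  have [il|il] := ltnP i (size (rcons t d));
    last by rewrite nth_default ?size_map.
  rewrite (nth_map d) //; apply: leq_trans sB; exact: ltn_ord.
have E : pair_of c = (update (update (update (fun=> 0) 0 n) nvar.+1 K) nvar (n
  * K),
    fun i => trunc w (nth 0 [seq val a | a <- rcons t d] i)).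
  rewrite /c /pair_of /= /step /current /= /eval_binop /= /trunc.
  by rewrite size_s !modn_small.
rewrite E; split=> //=.
- split=> [r|i] /=.
    by do 3!case: ifP => // _.
  by rewrite ltn_mod.
- by move=> x xl; rewrite ltn_eqF // ltn_eqF // ltnW.
- move=> k q i kl ql il; rewrite trunc_small //.
  case: andP => [[/eqP-> /eqP->]|ne]; first by rewrite /addr muln0 addn0 muln0.
  rewrite nth_default // size_map size_s; apply: leq_trans nK _.
  rewrite /addr; apply: leq_trans (leq_addr _ _); apply: leq_pmulr.
  by case: k q ne {kl ql} => [|k] [|q] // [].
Qed.

Theorem theorem23 (sigma : nat) :
  exists (p : program) (C k : nat),
  forall (w : nat) (s : seq 'I_sigma),
    ends_with_unique_symbol s ->
    up_log 2 (size s) + k <= w ->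
    exists t : nat,
      let c := iter t (step w p) (init w s) in
      [/\ t <= C * size s,
          halted p c,
          output_in_memory sigma w c
        & minimizes_runs s (output_family s c)].
Proof.
set K := array_factor sigma; set PP := params sigma.
set sz := size (cmd_code (main_cmd sigma) 2).
(* At most [21 * n] ticks cost at most [sz * (21 * n + 1)] steps, hence at most [22 * sz * n]; the 2
   counts the instructions before the compiled code. The 32 is twice the number of array kinds, and
   the additive constant makes [2 ^ w] at least [n * (32 * K * PP)]. *)
exists (main_program sigma), (22 * sz + 2), (up_log 2 (32 * K * PP)).
move=> w s [t [d [Es dt]]] wP; rewrite {}Es in wP *.
set n := size (rcons t d) in wP *.
have n0 : 0 < n by rewrite /n size_rcons.
have bigP : n * (32 * K * PP) <= 2 ^ w.
  apply: leq_trans (_ : 2 ^ (up_log 2 n + up_log 2 (32 * K * PP)) <= _).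
    by rewrite expnD leq_mul // up_logP.
  by rewrite leq_pexp2l.
have K0 : 7 < K.
  rewrite /K /array_factor addn2; clear; lia.
have PP0 : 0 < PP by rewrite /PP /params addn1.
set KN := n * K.
have KNP : 2 * KN * (nkind * PP) <= 2 ^ w.
  by apply: leq_trans bigP; rewrite /KN; clear; nia.
have KN0 : 0 < KN by rewrite muln_gt0 n0 (ltn_trans _ K0).
have memP : KN * (nkind * PP) <= 2 ^ w.
  by apply: leq_trans KNP; rewrite -mulnA mul2n -addnn leq_addr.
have KP : K * (32 * PP) <= 2 ^ w.
  by apply: leq_trans bigP; move: n0; clear; nia.
have nkP : nkind < 2 ^ w by apply: leq_trans KP; move: K0 PP0; clear; nia.
have [st ex [st1 [cnt [wd [l [st2 [st3 [rP bP [tP EA] [E0 E1] T]]]]]]]] :=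
  wp_main dt erefl erefl erefl KNP.
have KNB : KN < 2 ^ w.
  apply: leq_trans KNP; apply: leq_trans (_ : 2 * KN <= _).
    by rewrite mul2n -addnn -[X in X < _]addn0 ltn_add2l.
  by rewrite leq_pmulr // muln_gt0.
have nKN : n <= KN by rewrite leq_pmulr // (ltn_trans _ K0).
have nB : n < 2 ^ w := leq_ltn_trans nKN KNB.
have KB : K < 2 ^ w by apply: leq_ltn_trans KNB; rewrite leq_pmull.
have sB : sigma <= 2 ^ w.
  by apply: leq_trans (ltnW KB); rewrite /K /array_factor; clear; lia.
set p := main_program sigma.
have codeP : code_at p 2 (cmd_code (main_cmd sigma) 2) by apply:
  code_at_program.
have endP : nth Halt p (2 + sz) = Halt by apply: program_end.
have [pc0 A0] := start_agree PP (cmd_code (main_cmd sigma) 2 ++ [:: Halt])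
  (erefl n) nB KB KNB nKN sB.
have [t1 t1P [pc1 A1]] := cmd_codeP KN0 PP0 memP nkP ex codeP pc0 A0.
exists (t1 + 2); rewrite iterD; set c := iter t1 _ _ in pc1 A1 *.
have [_ R _ M] := A1.
have reg0 : reg c 0 = KN * kOut + (sigma + 2) by rewrite -E0; apply: R.
have reg1 : reg c 1 = cnt - 1 by rewrite -E1; apply: R.
have memE k q i : k < nkind -> q < PP -> i < KN ->
    Defs.mem c (addr KN k q i) = ar st3 k q i.
  by move=> kl ql il; rewrite -EA -M.
have KN_ge : (2 * n + 2) * (sigma + 2) <= KN.
  by rewrite /KN /K /array_factor; move: n0; clear; nia.
have cntK := cnt_KN KN_ge rP.
split.
- have T' : t1 <= sz * (21 * n).+1.
    apply: leq_trans t1P _; rewrite leq_mul2l ltnS.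
    by rewrite (leq_trans (leq_subr _ _) T) orbT.
  by move: T' n0; clear; nia.
- by rewrite /halted /current pc1 -/sz endP.
- rewrite /output_in_memory reg0 reg1.
  have : (cnt - 1) * (sigma + 2) <= KN.
    by apply: leq_trans cntK; rewrite leq_mul2r leq_subr orbT.
  have : sigma + 2 <= KN.
    by apply: leq_trans KN_ge; rewrite leq_pmull // addn2.
  have : 16 * KN <= 2 ^ w by apply: leq_trans memP; move: PP0; clear; nia.
  by clear; lia.
- apply: (family_optimal dt erefl rP bP tP).
    exact: (output_adaptive KN_ge PP0 rP tP reg0 reg1 memE).
  move=> x ch xP R3 a b.
  exact: (output_node KN_ge PP0 rP tP reg0 reg1 memE).
Qed.
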